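(* The following initial-boundary value problem has a unique classical solution in the class of functions with at most linear growth in $s$: find $\varphi(t,s,i,y)$ such that $$\frac{\partial \varphi}{\partial t}(t,s,i,y)+\frac{\partial \varphi}{\partial y}(t,s,i,y)+r(i)s\frac{\partial \varphi}{\partial s}(t,s,i,y)+\frac12\sigma^2(i)s^2\frac{\partial^2\varphi}{\partial s^2}(t,s,i,y)+\sum_{j\neq i}\lambda_{ij}(y)\big(\varphi(t,s,j,0)-\varphi(t,s,i,y)\big)=r(i)\varphi(t,s,i,y)$$ for all $(t,s,i,y)\in\mathcal{D}$, with $\lim_{s\downarrow 0}\varphi(t,s,i,y)=0$ for all $t\in[0,T]$, $i\in\mathcal{X}$, $y\in[0,t]$, and $\varphi(T,s,i,y)=(s-K)^+$ for all $s\in(0,\infty)$, $0\le y\le T$, $i\in\mathcal{X}$.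
   Context: Fix $T>0$, $K>0$, a positive integer $k$, $\mathcal{X}=\{1,\dots,k\}$, and functions $r:\mathcal{X}\to[0,\infty)$, $\sigma:\mathcal{X}\to(0,\infty)$. For $i\ne j$ in $\mathcal{X}$ let $\lambda_{ij}:[0,\infty)\to(0,\infty)$, and set $\lambda_{ii}(y):=-\sum_{j\ne i}\lambda_{ij}(y)$, $\Lambda_i(y):=\int_0^y|\lambda_{ii}(v)|\,dv$, $F(y\mid i):=1-e^{-\Lambda_i(y)}$, $f(y\mid i):=\frac{d}{dy}F(y\mid i)$, $p_{ij}(y):=\lambda_{ij}(y)/|\lambda_{ii}(y)|$ for $j\neq i$, $p_{ii}(y):=0$, $\hat p_{ij}:=\int_0^\infty p_{ij}(y)\,dF(y\mid i)$. Standing assumption: (i) each $\lambda_{ij}$ is differentiable; (ii) $\lim_{y\to\infty}\Lambda_i(y)=\infty$ for each $i$; (iii) the matrix $(\hat p_{ij})$ is irreducible. Let $\mathcal{D}:=\{(t,s,i,y)\in(0,T)\times(0,\infty)\times\mathcal{X}\times(0,T): y\in(0,t)\}$ and $\overline{\mathcal{D}}:=\{(t,s,i,y): t\in[0,T],\ s\in(0,\infty),\ i\in\mathcal{X},\ y\in[0,t]\}$. Functions on $\mathcal{D}$ are understood to be continuous up to $\overline{\mathcal{D}}$, so that the values at $y=0$ and at $t=T$ make sense. A classical solution is such a function that is in $C^{1,2,1}(\mathcal{D})$ (for each $i$, continuously differentiable in $t$, twice continuously differentiable in $s$, continuously differentiable in $y$ on $\mathcal{D}$) and satisfies the equation and conditions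 pointwise. At most linear growth means $\sup_{\mathcal{D}}\left|\frac{\varphi(t,s,i,y)}{1+s}\right|<\infty$. *)

(* Defs.v *)
From HB Require Import structures.
From mathcomp Require Import all_boot all_order all_algebra.
From mathcomp Require Import all_classical all_reals all_analysis.

Set Implicit Arguments.
Unset Strict Implicit.
Unset Printing Implicit Defensive.

Import Order.TTheory GRing.Theory Num.Theory.
Import numFieldNormedType.Exports.

Local Open Scope classical_set_scope.
Local Open Scope ring_scope.

Section Kernel.
Context {R : realType} {k : nat}.

(* Differentiability of a function on [0, +oo[: at 0 the difference quotient
   is taken from the right only, so values at negative reals are irrelevant. *)
Definition derivable_nonneg (g : R -> R) : Prop :=
  forall y : R, 0 <= y ->
    cvg ((fun h : R => h^-1 * (g (y + h) - g y))
           @ within [set h : R | 0 <= y + h] 0^').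

(* The state space {1, ..., k} is 'I_k.  The family lam is only meaningful off
   the diagonal; its diagonal entries are never used, lam_diag replaces them. *)
Implicit Types (lam : 'I_k -> 'I_k -> R -> R) (i j : 'I_k).

Definition lam_diag lam i (y : R) : R := - \sum_(j | j != i) lam i j y.

Definition Lam lam i (y : R) : R :=
  \int[lebesgue_measure]_(v in `[0, y]) `|lam_diag lam i v|.

Definition holding_cdf lam i (y : R) : R := 1 - expR (- Lam lam i y).

Definition holding_pdf lam i : R -> R := derive1 (holding_cdf lam i).

Definition jump_prob lam i j (y : R) : R :=
  if j == i then 0 else lam i j y / `|lam_diag lam i y|.

(* The holding-time distribution has density holding_pdf on the positive
   half-line, so that dF(y | i) is holding_pdf lam i y dy. *)
Definition embedded_mx lam : 'M[R]_k :=
  \matrix_(i, j) \int[lebesgue_measure]_(y in `]0, +oo[)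
                    (jump_prob lam i j y * holding_pdf lam i y).

(* Irreducibility of a matrix with nonnegative entries: any two states
   communicate. *)
Definition irreducible_mx (A : 'M[R]_k) : Prop :=
  forall i j, exists m : nat, 0 < (A ^+ m) i j.

End Kernel.

Section Problem.
Context {R : realType} {k : nat}.
Implicit Types (T : R) (phi : R -> R -> 'I_k -> R -> R) (i : 'I_k).

(* A triple (t, s, y); the domain of the problem is the union over i of copies
   of dom T, i being a discrete coordinate. *)
Definition dom T : set (R * R * R) :=
  [set x | [/\ 0 < x.1.1 < T, 0 < x.1.2, 0 < x.2 < T & 0 < x.2 < x.1.1]].

Definition dom_bar T : set (R * R * R) :=
  [set x | [/\ 0 <= x.1.1 <= T, 0 < x.1.2 & 0 <= x.2 <= x.1.1]].

Definition d_t phi (t s : R) i (y : R) : R := derive1 (fun t' => phi t' s i y) t.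
Definition d_s phi (t s : R) i (y : R) : R := derive1 (fun s' => phi t s' i y) s.
Definition d_ss phi (t s : R) i (y : R) : R :=
  derive1n 2 (fun s' => phi t s' i y) s.
Definition d_y phi (t s : R) i (y : R) : R := derive1 (phi t s i) y.

Definition slice phi i : R * R * R -> R := fun x => phi x.1.1 x.1.2 i x.2.

Definition continuous_to_boundary T phi : Prop :=
  forall i, {within dom_bar T, continuous (slice phi i)}.

Definition C121 T phi : Prop :=
  forall i,
  [/\ forall t s y : R, dom T (t, s, y) ->
        [/\ derivable (fun t' => phi t' s i y) t 1,
            derivable (fun s' => phi t s' i y) s 1,
            derivable (fun s' => d_s phi t s' i y) s 1 &
            derivable (phi t s i) y 1],
      {within dom T, continuous (slice (d_t phi) i)},
      {within dom T, continuous (slice (d_s phi) i)},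
      {within dom T, continuous (slice (d_ss phi) i)} &
      {within dom T, continuous (slice (d_y phi) i)}].

Definition linear_growth T phi : Prop :=
  has_ubound [set z : R | exists (t s : R) i (y : R),
                dom T (t, s, y) /\ z = `|phi t s i y / (1 + s)|].

Definition satisfies_pde T (r sigma : 'I_k -> R) (lam : 'I_k -> 'I_k -> R -> R)
    phi : Prop :=
  forall (t s : R) i (y : R), dom T (t, s, y) ->
    d_t phi t s i y + d_y phi t s i y + r i * s * d_s phi t s i y
      + 2^-1 * sigma i ^+ 2 * s ^+ 2 * d_ss phi t s i y
      + \sum_(j | j != i) lam i j y * (phi t s j 0 - phi t s i y)
    = r i * phi t s i y.

Definition boundary_condition T phi : Prop :=
  forall (t : R) i (y : R), 0 <= t <= T -> 0 <= y <= t ->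
    phi t s i y @[s --> 0^'+] --> 0.

Definition terminal_condition T (K : R) phi : Prop :=
  forall (s : R) i (y : R), 0 < s -> 0 <= y <= T -> phi T s i y = Num.max (s - K) 0.

Definition classical_solution T (K : R) (r sigma : 'I_k -> R)
    (lam : 'I_k -> 'I_k -> R -> R) phi : Prop :=
  [/\ continuous_to_boundary T phi, C121 T phi,
      satisfies_pde T r sigma lam phi,
      boundary_condition T phi & terminal_condition T K phi].

End Problem.

(* Main.v *)
(* Let z = (x, v) record the logarithm of the spot and the accumulated variance.
   Between jumps of the regime, z moves with velocity (r(i), sigma(i)^2), so
   conditionally on the regime path the price is s times a normalised
   Black-Scholes call evaluated at the end point of z.  The price is therefore
   s Phi_i(T - t, y, (ln s, 0)), where Phi averages the call over the regime
   path and solves a renewal equation.  The latter is a contraction, because the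
   survival probability is bounded below, and this gives both existence and a
   maximum principle.  As the sigma(i)^2 are bounded below, for t < T the call is
   only evaluated at variances bounded away from 0, where it is smooth; by the
   maximum principle Phi is differentiable in z and along (t, z), with
   derivatives solving the same equation with differentiated data.  The flow
   property of the equation then gives the derivative in the age y, and the
   PDE follows from the Black-Scholes equation dcall/dv = (call'' + call')/2
   in x.

   For uniqueness, suppose that the difference w of two solutions satisfies
   |w| <= A (1 + s) exp(C (T - t)).  Compare w with half that bound plus
   d ((1 + s^2 + 1/s) exp(C (T - t)) + 1/y + 1/(t - y)): for C large this is a
   strict supersolution, the nonlocal terms being controlled by the assumed
   bound, so w cannot exceed it at an interior maximum; letting d tend to 0, the
   bound holds with A / 2.  Iterating, w = 0. *)
Require Import Defs.
From HB Require Import structures.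
From mathcomp Require Import all_boot all_order all_algebra.
From mathcomp Require Import all_classical all_reals all_analysis.
From mathcomp Require Import ring lra.

Set Implicit Arguments.
Unset Strict Implicit.

Import Order.TTheory GRing.Theory Num.Theory.
Import numFieldNormedType.Exports.

Local Open Scope classical_set_scope.
Local Open Scope ring_scope.

(** * Oriented integrals of continuous functions *)

Section Primitives.
Context {R : realType}.
Implicit Types (f g F G : R -> R) (a b c x y : R).

(** Carrying [z] along turns derivatives of the solution into derivatives of the data. Moving the
    start by [h *: e] and lengthening the time by [al * h] displaces the end point by
    [h *: (e + al *: c j)], up to a negligible probability, where [j] is the regime at maturity; so
    the differentiated data depend on the final regime although the call does not. The age offers no
    such translation. But lengthening the time by [h] while pulling the start back along the
    velocity of regime [i] leads, without a jump, to the original point with age increased by [h];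
    the increment in the age is read off from this.

    For uniqueness the obstacle is that the nonlocal term looks at age 0, on the boundary of the
    domain, where an interior maximum gives no information. It is treated as a source controlled by
    the previous bound, so that each regime is compared alone. In the barrier, [s ^+ 2] and [1/s]
    exclude large and small spots, while [1/y] and [1/(t - y)] exclude the two age boundaries; the
    transport operator kills [1/(t - y)] and makes [1/y] strictly decrease. *)

Lemma is_derive_continuous F (d : R) x : is_derive x 1 F d -> {for x, continuous F}.
Proof. by case=> dF _; exact/differentiable_continuous/derivable1_diffP. Qed.

Lemma is_derive_affine a b x : is_derive x 1 (fun z => a * z + b) a.
Proof.
have da : is_derive x 1 (a \*: id) a.
  by have := @is_deriveZ R R R id a x 1 1 (is_derive_id _ _); rewrite /GRing.scale /= mulr1.
by have := is_deriveD da (is_derive_cst b x 1); rewrite addr0.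
Qed.

Lemma mean_value F f a b : a <= b -> (forall x, a <= x <= b -> is_derive x 1 F (f x)) ->
  exists2 c, a <= c <= b & F b - F a = f c * (b - a).
Proof.
move=> ab dF.
have [x|x|c] := @MVT_segment _ F f a b ab.
- by rewrite in_itv /= => /andP[/ltW ax /ltW xb]; apply: dF; rewrite ax xb.
- apply: derivable_within_continuous => y; rewrite in_itv /= => aby.
  by have [] := dF _ aby.
- by rewrite in_itv /= => cab E; exists c.
Qed.

Lemma eq_derive_cst F G f a b : a <= b ->
  (forall x, a <= x <= b -> is_derive x 1 F (f x)) ->
  (forall x, a <= x <= b -> is_derive x 1 G (f x)) -> F b - F a = G b - G a.
Proof.
move=> ab dF dG.
have [x /[dup] /dF dFx /dG dGx|c _ /eqP] := @mean_value (F - G) (cst 0) a b ab.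
  by apply: is_derive_eq; rewrite subrr.
rewrite mul0r !fctE => /eqP; lra.
Qed.

(** The fundamental theorem of calculus gives a primitive only to the right of the lower bound
    [- n]. Normalised to vanish at 0, these primitives agree wherever they are comparable, so taking
    [n] beyond [|x|] at each [x] glues them on the whole line. *)
Lemma continuous_primitive f : continuous f ->
  exists F, forall x, is_derive x 1 F (f x).
Proof.
move=> cf.
pose G (n : nat) x := \int[lebesgue_measure]_(t in `[(- n%:R), x]) f t.
have dG n x : - n%:R < x -> is_derive x 1 (G n) (f x).
  move=> nx.
  have xx : x < x + 1 by rewrite ltrDl.
  have int : lebesgue_measure.-integrable `[(- n%:R), (x + 1)] (EFin \o f).
    apply: continuous_compact_integrable; first exact: segment_compact.
    exact: continuous_subspaceT.
  have [d e] := continuous_FTC1_closed xx int nx (cf x).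
  by apply: DeriveDef; [exact: d|rewrite -derive1E; exact: e].
pose H n x := G n x - G n 0.
have dH n x : - n%:R < x -> is_derive x 1 (H n) (f x).
  move=> nx; have := dG n x nx => d.
  by apply: is_derive_eq; rewrite subr0.
have HE (n m : nat) x : `|x| < n.+1%:R -> (n <= m)%N -> H m.+1 x = H n.+1 x.
  move=> nx nm.
  have nmR : (- m.+1%:R : R) <= - n.+1%:R by rewrite lerN2 ler_nat.
  have H0 k : H k 0 = 0 by rewrite /H subrr.
  have n0 : - (n.+1%:R : R) < 0 by rewrite oppr_lt0 ltr0n.
  have nx' : - n.+1%:R < x by rewrite ltrNl (le_lt_trans (ler_norm _))// normrN.
  have [x0|/ltW x0] := leP x 0.
    have := @eq_derive_cst (H m.+1) (H n.+1) f x 0 x0.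
    rewrite !H0 !sub0r => /(_ _ _)/oppr_inj; apply => y /andP[xy _]; apply: dH.
      exact: le_lt_trans nmR (lt_le_trans nx' xy).
    exact: lt_le_trans nx' xy.
  have := @eq_derive_cst (H m.+1) (H n.+1) f 0 x x0.
  rewrite !H0 !subr0; apply => y /andP[y0 _]; apply: dH.
    exact: le_lt_trans nmR (lt_le_trans n0 y0).
  exact: lt_le_trans n0 y0.
pose N x := Num.bound (`|x| : R).
have NP x : `|x| < (N x).+1%:R.
  rewrite (lt_le_trans (Num.Theory.archi_boundP _)) ?normr_ge0//.
  by rewrite ler_nat.
exists (fun x => H (N x).+1 x) => x.
pose n := Num.bound (`|x| + 1).
have xn : `|x| + 1 < n.+1%:R.
  rewrite (lt_le_trans (Num.Theory.archi_boundP _)) ?addr_ge0//.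
  by rewrite ler_nat.
have xn' : - n.+1%:R < x.
  rewrite ltrNl (le_lt_trans (ler_norm _))// normrN (lt_trans _ xn)//.
  by rewrite ltrDl.
apply: (near_eq_is_derive _ (dH n.+1 x xn')).
near=> y.
have yx : `|x - y| < 1 by near: y; exact: (@nbhsx_ballx _ _ x 1).
have yn : `|y| < n.+1%:R.
  rewrite (le_lt_trans _ xn)// -[y](subKr x) (le_trans (ler_normB _ _))//.
  by rewrite lerD2l ltW.
have [nN|/ltnW Nn] := leqP n (N y); [exact/esym/HE|exact: HE].
Unshelve. all: by end_near. Qed.
End Primitives.

(* For a continuous integrand the oriented integral is the increment of a
   primitive: it is additive whatever the order of the bounds. *)
Section Integral.
Context {R : realType}.
Implicit Types (f g F G : R -> R) (a b c x y : R).

Definition primitive f : R -> R :=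
  xget (cst 0) [set F | forall x, is_derive x 1 F (f x)].

Definition integ f a b : R := primitive f b - primitive f a.

Lemma primitiveP f : continuous f -> forall x, is_derive x 1 (primitive f) (f x).
Proof.
move=> /continuous_primitive[F FP].
by apply: (@xgetPex _ (cst 0) [set F | forall x, is_derive x 1 F (f x)]); exists F.
Qed.

Lemma integ_derive f F a b : continuous f -> a <= b ->
  (forall x, a <= x <= b -> is_derive x 1 F (f x)) -> integ f a b = F b - F a.
Proof. by move=> cf ab dF; apply: (@eq_derive_cst _ _ _ f _ _ ab) => // x _; exact: primitiveP. Qed.

Lemma integxx f a : integ f a a = 0. Proof. exact: subrr. Qed.

Lemma integ_cat f a b c : integ f a c = integ f a b + integ f b c.
Proof. by rewrite /integ; lra. Qed.

Lemma integ_cst (d : R) a b : a <= b -> integ (cst d) a b = d * (b - a).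
Proof.
move=> ab; have dF x : is_derive x 1 ( *%R d) d.
  by have := @is_deriveZ R R R id d x 1 1 (is_derive_id _ _); rewrite /GRing.scale /= mulr1.
rewrite (integ_derive (@cst_continuous _ _ d) ab (fun x _ => dF x)) /=.
by rewrite mulrBr.
Qed.

Lemma integD f g a b : continuous f -> continuous g -> a <= b ->
  integ (fun x => f x + g x) a b = integ f a b + integ g a b.
Proof.
move=> cf cg ab.
have dF x : is_derive x 1 (primitive f + primitive g) (f x + g x).
  by have := primitiveP cf x; have := primitiveP cg x => ? ?; exact: is_deriveD.
rewrite (integ_derive _ ab (fun x _ => dF x)).
  by rewrite !fctE /integ; ring.
by move=> x; apply: cvgD; [exact: cf|exact: cg].
Qed.

Lemma integZ f (d : R) a b : continuous f -> a <= b ->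
  integ (fun x => d * f x) a b = d * integ f a b.
Proof.
move=> cf ab.
have dF x : is_derive x 1 (d *: primitive f) (d * f x).
  by have := primitiveP cf x => ?; exact: is_deriveZ.
rewrite (integ_derive _ ab (fun x _ => dF x)).
  by rewrite !fctE /integ /GRing.scale /= mulrBr.
by move=> x; apply: cvgM; [exact: cvg_cst|exact: cf].
Qed.

Lemma integB f g a b : continuous f -> continuous g -> a <= b ->
  integ (fun x => f x - g x) a b = integ f a b - integ g a b.
Proof.
move=> cf cg ab.
have -> : (fun x => f x - g x) = (fun x => f x + (- 1) * g x).
  by apply/funext => x; rewrite mulN1r.
rewrite integD ?integZ ?mulN1r//.
by move=> x; apply: cvgM; [exact: cvg_cst|exact: cg].
Qed.

Lemma ler_integ f g a b : continuous f -> continuous g -> a <= b ->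
  (forall x, a <= x <= b -> f x <= g x) -> integ f a b <= integ g a b.
Proof.
move=> cf cg ab fg; rewrite -subr_ge0 -integB//.
have cgf : continuous (fun x => g x - f x).
  by move=> x; apply: cvgB; [exact: cg|exact: cf].
have [x _|c cab E] := @mean_value _ (primitive (fun x => g x - f x))
  (fun x => g x - f x) a b ab.
  exact: primitiveP.
by rewrite /integ E mulr_ge0 ?subr_ge0// fg.
Qed.

Lemma ler_norm_integ f g a b : continuous f -> continuous g -> a <= b ->
  (forall x, a <= x <= b -> `|f x| <= g x) -> `|integ f a b| <= integ g a b.
Proof.
move=> cf cg ab fg; rewrite ler_norml; apply/andP; split.
  rewrite lerNl -mulN1r -integZ//; apply: ler_integ => //.
    by move=> x; apply: cvgM; [exact: cvg_cst|exact: cf].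
  by move=> x /fg; rewrite ler_norml mulN1r => /andP[+ _]; rewrite lerNl.
by apply: ler_integ => // x /fg; rewrite ler_norml => /andP[].
Qed.

Lemma integ_shift f a b c : continuous f -> a <= b ->
  integ f (a + c) (b + c) = integ (fun x => f (x + c)) a b.
Proof.
move=> cf ab.
have dF x : is_derive x 1 (primitive f \o +%R^~ c) (f (x + c)).
  have := primitiveP cf (x + c) => ?.
  have ? : is_derive x 1 (+%R^~ c) 1 by apply: is_derive_eq; rewrite addr0.
  by apply: is_derive_eq; rewrite mulr1.
rewrite (integ_derive _ ab (fun x _ => dF x))// => x.
apply: continuous_comp; last exact: cf.
by apply: cvgD; [exact: cvg_id|exact: cvg_cst].
Qed.

(** Rescaling to a fixed interval turns dependence on a moving bound into dependence of the
    integrand on a parameter. The integral being oriented, [a] may have any sign. *)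
Lemma integ_scale f a : continuous f ->
  integ f 0 a = a * integ (fun x => f (a * x)) 0 1.
Proof.
move=> cf.
have cfa : continuous (fun x => f (a * x)).
  move=> x; apply: continuous_comp; last exact: cf.
  by apply: cvgM; [exact: cvg_cst|exact: cvg_id].
have dF x : is_derive x 1 (primitive f \o *%R a) (a * f (a * x)).
  have := primitiveP cf (a * x) => ?.
  have ? : is_derive x 1 ( *%R a) a.
    by have := @is_deriveZ R R R id a x 1 1 (is_derive_id _ _); rewrite /GRing.scale /= mulr1.
  by apply: is_derive_eq; rewrite mulrC.
rewrite -integZ// (integ_derive _ ler01 (fun x _ => dF x)) /= ?mulr1 ?mulr0//.
by move=> x; apply: cvgM; [exact: cvg_cst|exact: cfa].
Qed.

Lemma continuous_partial {T U V : topologicalType} (f : T -> U -> V) (q : T) :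
  continuous (fun p : T * U => f p.1 p.2) -> continuous (f q).
Proof.
move=> cf x.
have cq : {for x, continuous (fun y : U => (q, y))}.
  by apply: cvg_pair; [exact: cvg_cst|exact: cvg_id].
exact: (continuous_comp cq (cf (q, x))).
Qed.

Lemma continuous_integ01 {T : topologicalType} (f : T -> R -> R) :
  continuous (fun p : T * R => f p.1 p.2) -> continuous (fun p => integ (f p) 0 1).
Proof.
move=> cf p; apply/cvgrPdist_le => /= e e0.
have cfp q : continuous (f q).
  exact: continuous_partial.
(* Compactness makes the closeness of [f q x] to [f p x] uniform in [x], for [q] near [p]. *)
have /compact_near_coveringP := @segment_compact R 0 1.
move=> /(_ _ (nbhs p) (fun q x => `|f p x - f q x| <= e) _) near01.
have {}near01 : \forall q \near p, `[0, 1] `<=` (fun x => `|f p x - f q x| <= e).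
  apply: near01 => x _.
  have e20 : 0 < e / 2 by rewrite divr_gt0.
  have /cvgrPdist_le/(_ _ e20)[[A B] [/= pA xB]] := cf (p, x).
  move=> AB; exists (B, A) => //= -[y q] [/= By Aq].
  have fq := AB (q, y) (conj Aq By).
  have fy := AB (p, y) (conj (nbhs_singleton pA) By).
  rewrite -[f p y](subrK (f p x)) -addrA (le_trans (ler_normD _ _))// [e]splitr.
  by rewrite lerD// distrC.
near=> q.
have fpq : `[0, 1] `<=` (fun x => `|f p x - f q x| <= e) by near: q.
rewrite -integB// (le_trans (@ler_norm_integ _ (cst e) 0 1 _ _ _ _))//.
- by move=> x; apply: cvgB; exact: cfp.
- exact: cst_continuous.
- by rewrite integ_cst// subr0 mulr1.
Unshelve. all: by end_near. Qed.

Lemma continuous_integ {T : topologicalType} (f : T -> R -> R) (a : T -> R) :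
  continuous (fun p : T * R => f p.1 p.2) -> continuous a ->
  continuous (fun p => integ (f p) 0 (a p)).
Proof.
move=> cf ca.
have cfp q : continuous (f q).
  exact: continuous_partial.
under eq_fun do rewrite integ_scale//.
move=> p; apply: cvgM; first exact: ca.
apply: (@continuous_integ01 _ (fun q x => f q (a q * x))) => -[q x] /=.
have ca1 : {for (q, x), continuous (a \o fst)}.
  by apply: continuous_comp; [exact: cvg_fst|exact: ca].
have ca2 : {for (q, x), continuous (fun u : T * R => a u.1 * u.2)}.
  by apply: cvgM; [exact: ca1|exact: cvg_snd].
have cax : {for (q, x), continuous (fun u : T * R => (u.1, a u.1 * u.2))}.
  exact: (cvg_pair (@cvg_fst _ _ _ _ _) ca2).
exact: (continuous_comp cax (cf (q, a q * x))).
Qed.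
End Integral.

(** * The renewal equation *)

Section ContinuityRules.
Context {R : realType}.

Lemma continuousD_fun {T : topologicalType} {V : normedModType R} (f g : T -> V) :
  continuous f -> continuous g -> continuous (fun x => f x + g x).
Proof. by move=> cf cg x; apply: cvgD; [exact: cf|exact: cg]. Qed.

Lemma continuousN_fun {T : topologicalType} {V : normedModType R} (f : T -> V) :
  continuous f -> continuous (fun x => - f x).
Proof. by move=> cf x; apply: cvgN; exact: cf. Qed.

Lemma continuousM_fun {T : topologicalType} (f g : T -> R) :
  continuous f -> continuous g -> continuous (fun x => f x * g x).
Proof. by move=> cf cg x; apply: cvgM; [exact: cf|exact: cg]. Qed.

Lemma continuousZ_fun {T : topologicalType} {V : normedModType R} (f : T -> R) (g : T -> V) :
  continuous f -> continuous g -> continuous (fun x => f x *: g x).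
Proof. by move=> cf cg x; apply: cvgZ; [exact: cf|exact: cg]. Qed.

Lemma continuous_fst_fun {T U V : topologicalType} (f : T -> U * V) :
  continuous f -> continuous (fun x => (f x).1).
Proof. by move=> cf x; apply: continuous_comp; [exact: cf|exact: cvg_fst]. Qed.

Lemma continuous_snd_fun {T U V : topologicalType} (f : T -> U * V) :
  continuous f -> continuous (fun x => (f x).2).
Proof. by move=> cf x; apply: continuous_comp; [exact: cf|exact: cvg_snd]. Qed.

Lemma continuous_pair_fun {T U V : topologicalType} (f : T -> U) (g : T -> V) :
  continuous f -> continuous g -> continuous (fun x => (f x, g x)).
Proof. by move=> cf cg x; apply: cvg_pair; [exact: cf|exact: cg]. Qed.

Lemma continuous_comp_fun {T U V : topologicalType} (f : U -> V) (g : T -> U) :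
  continuous f -> continuous g -> continuous (fun x => f (g x)).
Proof. by move=> cf cg x; apply: continuous_comp; [exact: cg|exact: cf]. Qed.

Lemma continuous_sum_fun {T : topologicalType} (I : finType) (P : pred I) (f : I -> T -> R) :
  (forall i, continuous (f i)) -> continuous (fun x => \sum_(i | P i) f i x).
Proof.
move=> cf; elim: (index_enum I) => [|i s cs].
  by under eq_fun do rewrite big_nil; exact: cst_continuous.
under eq_fun do rewrite big_cons.
by case: (P i) => //; exact: (continuousD_fun (cf i) cs).
Qed.

Lemma continuous_expR_fun {T : topologicalType} (f : T -> R) :
  continuous f -> continuous (fun x => expR (f x)).
Proof. exact: continuous_comp_fun (@continuous_expR R). Qed.

Lemma continuous_max_fun {T : topologicalType} (f g : T -> R) :
  continuous f -> continuous g -> continuous (fun x => Num.max (f x) (g x)).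
Proof. by move=> cf cg x; exact: (continuous_max (cf x) (cg x)). Qed.

Lemma continuous_min_fun {T : topologicalType} (f g : T -> R) :
  continuous f -> continuous g -> continuous (fun x => Num.min (f x) (g x)).
Proof. by move=> cf cg x; exact: (continuous_min (cf x) (cg x)). Qed.

End ContinuityRules.

Ltac cont_step := match goal with
  | |- continuous (fun x => x) => by move=> ?; exact: cvg_id
  | |- continuous id => by move=> ?; exact: cvg_id
  | H : ?G |- ?G => exact: H
  | |- continuous (fun _ => ?c) => exact: cst_continuous
  | |- continuous (@snd _ _) => by move=> ?; exact: cvg_snd
  | |- continuous (@fst _ _) => by move=> ?; exact: cvg_fst
  | |- continuous (cst _) => exact: cst_continuous
  | |- continuous (fun x => @?f x + @?g x) => apply: (@continuousD_fun _ _ _ f g)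
  | |- continuous (fun x => - @?f x) => apply: (@continuousN_fun _ _ _ f)
  | |- continuous (fun x => @?f x * @?g x) => apply: (@continuousM_fun _ _ f g)
  | |- continuous (fun x => @?f x *: @?g x) => apply: (@continuousZ_fun _ _ _ f g)
  | |- continuous (fun x => Num.max (@?f x) (@?g x)) => apply: (@continuous_max_fun _ _ f g)
  | |- continuous (fun x => Num.min (@?f x) (@?g x)) => apply: (@continuous_min_fun _ _ f g)
  | |- continuous (fun x => expR (@?f x)) => apply: (@continuous_expR_fun _ _ f)
  | |- continuous (fun x => fst (@?f x)) => apply: (@continuous_fst_fun _ _ _ f)
  | |- continuous (fun x => snd (@?f x)) => apply: (@continuous_snd_fun _ _ _ f)
  | |- continuous (fun x => (@?f x, @?g x)) => apply: (@continuous_pair_fun _ _ _ f g)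
  | |- continuous (fun x => @bigop _ _ _ _ (@?f x)) => apply: continuous_sum_fun => ?
  end.
Ltac cont := repeat (cbv beta; cont_step).

(** Rates that are total, continuous and bounded on the whole line free the renewal equation from
    side conditions on ages. Any primitive of the total rate can serve as [cumul], since only its
    increments matter. *)
Record jump_rates (R : realType) (k : nat) := JumpRates {
  rate : 'I_k -> 'I_k -> R -> R;
  cumul : 'I_k -> R -> R;
  rate_bound : R;
  rate_continuous : forall i j, continuous (rate i j);
  rate_ge0 : forall i j y, 0 <= rate i j y;
  cumul_derive : forall i (y : R), is_derive y 1 (cumul i) (\sum_(j | j != i) rate i j y);
  rate_le : forall i y, \sum_(j | j != i) rate i j y <= rate_bound
}.

(** * The renewal operator and its survival weights *)

Section Volterra.
Context {R : realType} {Z : normedModType R} {k : nat}.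
Variables (m : jump_rates R k) (c : 'I_k -> Z).
Local Notation lam := (rate m).
Local Notation Lam := (cumul m).
Local Notation L := (rate_bound m).
Implicit Types (i j : 'I_k) (t y v : R) (z : Z).
Implicit Types (F : 'I_k -> R -> Z -> R) (Phi Psi : 'I_k -> R -> R -> Z -> R).

Definition tot i y := \sum_(j | j != i) lam i j y.

Lemma Lam_derive i y : is_derive y 1 (Lam i) (tot i y). Proof. exact: cumul_derive. Qed.

Lemma tot_le i y : tot i y <= L. Proof. exact: rate_le. Qed.

(* In state [i] the point [z] moves with constant velocity [c i]; [surv i y v] is
   the probability that a sojourn of age [y] lasts [v] longer, and [volterra]
   conditions on the first jump within time [t]. *)
Definition surv i y v := expR (Lam i y - Lam i (y + v)).

Definition src Phi i t y z v :=
  surv i y v * \sum_(j | j != i) lam i j (y + v) * Phi j (t - v) 0 (z + v *: c i).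

Definition volterra F Phi i t y z :=
  surv i y t * F i (y + t) (z + t *: c i) + integ (src Phi i t y z) 0 t.

Definition jointly_continuous Phi :=
  forall i, continuous (fun p : R * R * Z => Phi i p.1.1 p.1.2 p.2).

Definition data_continuous F := forall i, continuous (fun p : R * Z => F i p.1 p.2).

Lemma jointly_continuous_comp Phi i {T : topologicalType} (a b : T -> R) (d : T -> Z) :
  jointly_continuous Phi -> continuous a -> continuous b -> continuous d ->
  continuous (fun x => Phi i (a x) (b x) (d x)).
Proof.
move=> cPhi ca cb cd.
apply: (@continuous_comp_fun _ _ _ (fun p : R * R * Z => Phi i p.1.1 p.1.2 p.2)
  (fun x => (a x, b x, d x))); first exact: cPhi.
by cont.
Qed.

Lemma data_continuous_comp F i {T : topologicalType} (b : T -> R) (d : T -> Z) :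
  data_continuous F -> continuous b -> continuous d ->
  continuous (fun x => F i (b x) (d x)).
Proof.
move=> cF cb cd.
apply: (@continuous_comp_fun _ _ _ (fun p : R * Z => F i p.1 p.2)
  (fun x => (b x, d x))); first exact: cF.
by cont.
Qed.

Lemma Lam_continuous i : continuous (Lam i).
Proof. by move=> y; exact: is_derive_continuous (Lam_derive i y). Qed.

Lemma tot_continuous i : continuous (tot i).
Proof. by rewrite /tot; cont; exact: rate_continuous. Qed.

Lemma tot_ge0 i y : 0 <= tot i y.
Proof. by apply: sumr_ge0 => j _; exact: rate_ge0. Qed.

Lemma surv_continuous i {T : topologicalType} (a b : T -> R) :
  continuous a -> continuous b -> continuous (fun x => surv i (a x) (b x)).
Proof.
move=> ca cb; rewrite /surv; cont.
  exact: continuous_comp_fun (@Lam_continuous i) _.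
by apply: continuous_comp_fun (@Lam_continuous i) _; cont.
Qed.

Lemma src_continuous Phi i {T : topologicalType} (a b : T -> R) (d : T -> Z) (e : T -> R) :
  jointly_continuous Phi -> continuous a -> continuous b -> continuous d -> continuous e ->
  continuous (fun x => src Phi i (a x) (b x) (d x) (e x)).
Proof.
move=> cPhi ca cb cd ce; rewrite /src; cont; first exact: surv_continuous.
  by apply: continuous_comp_fun (@rate_continuous _ _ m _ _) _; cont.
by apply: jointly_continuous_comp => //; cont.
Qed.

Lemma src_continuous_v Phi i t y z : jointly_continuous Phi -> continuous (src Phi i t y z).
Proof.
move=> cPhi.
by apply: (@src_continuous Phi i R (cst t) (cst y) (cst z) (fun v => v)) => //; cont.
Qed.

Lemma surv_gt0 i y v : 0 < surv i y v. Proof. exact: expR_gt0. Qed.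

Lemma surv0 i y : surv i y 0 = 1. Proof. by rewrite /surv addr0 subrr expR0. Qed.

Lemma surv_cat i y u v : surv i y (u + v) = surv i y u * surv i (y + u) v.
Proof. by rewrite /surv -expRD addrA; congr expR; ring. Qed.

Lemma Lam_increment i y v : 0 <= v -> 0 <= Lam i (y + v) - Lam i y <= L * v.
Proof.
move=> v0; have yv : y <= y + v by rewrite lerDl.
have [d _ ->] := mean_value yv (fun x _ => Lam_derive i x).
by rewrite addrC addKr mulr_ge0 ?tot_ge0//= ler_wpM2r// tot_le.
Qed.

Lemma surv_le1 i y v : 0 <= v -> surv i y v <= 1.
Proof. by move=> /(Lam_increment i y) /andP[+ _]; rewrite -expR0 ler_expR; lra. Qed.

Lemma surv_ge i y v : 0 <= v -> expR (- (L * v)) <= surv i y v.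
Proof. by move=> /(Lam_increment i y) /andP[_]; rewrite ler_expR; lra. Qed.

Lemma tot_surv_continuous i y : continuous (fun v => tot i (y + v) * surv i y v).
Proof.
cont; last by apply: (@surv_continuous i R (cst y) (fun v => v)); cont.
by apply: (@continuous_comp_fun _ _ _ (tot i) (fun v => y + v)); cont; exact: tot_continuous.
Qed.

(** The integrand is the density of the residual sojourn time, that is, minus the derivative of
    [surv] in its last argument. *)
Lemma integ_surv i y t : 0 <= t ->
  integ (fun v => tot i (y + v) * surv i y v) 0 t = 1 - surv i y t.
Proof.
move=> t0.
have dS (x : R) : is_derive x 1 (fun v => - surv i y v) (tot i (y + x) * surv i y x).
  have dL := Lam_derive i (y + x).
  have ? : is_derive x 1 (+%R y) 1.
    by have := @is_deriveD R R R (cst y) id x 1 0 1 _ _; rewrite add0r; apply.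
  have dL' : is_derive x 1 (Lam i \o +%R y) (tot i (y + x)).
    by apply: is_derive_eq; rewrite mulr1.
  have d2 : is_derive x 1 (fun v => Lam i y - Lam i (y + v)) (- tot i (y + x)).
    have -> : - tot i (y + x) = 0 - tot i (y + x) by rewrite sub0r.
    exact: (@is_deriveB _ _ _ (cst (Lam i y)) (Lam i \o +%R y)).
  have d3 : is_derive x 1 (expR \o (fun v => Lam i y - Lam i (y + v)))
      (surv i y x * - tot i (y + x)) by apply: is_derive1_comp.
  by apply: is_derive_eq; rewrite mulrN opprK mulrC.
rewrite (integ_derive _ t0 (fun x _ => dS x)) ?surv0 ?opprK 1?addrC//.
exact: tot_surv_continuous.
Qed.

Lemma src_le Phi i t y z v (M : R) :
  (forall j, j != i -> `|Phi j (t - v) 0 (z + v *: c i)| <= M) ->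
  `|src Phi i t y z v| <= M * (tot i (y + v) * surv i y v).
Proof.
move=> PM; rewrite /src normrM gtr0_norm ?surv_gt0// mulrCA mulrA.
rewrite [leLHS]mulrC ler_wpM2r ?(ltW (surv_gt0 _ _ _))// /tot mulr_suml.
rewrite (le_trans (ler_norm_sum _ _ _))// ler_sum// => j ji.
by rewrite normrM ger0_norm ?rate_ge0// ler_wpM2l ?rate_ge0// PM.
Qed.

Lemma integ_src_le Phi i t y z (M : R) : jointly_continuous Phi -> 0 <= t ->
  (forall v j, 0 <= v <= t -> j != i -> `|Phi j (t - v) 0 (z + v *: c i)| <= M) ->
  `|integ (src Phi i t y z) 0 t| <= M * (1 - surv i y t).
Proof.
move=> cPhi t0 PM; rewrite -integ_surv//.
have cs : continuous (fun v => tot i (y + v) * surv i y v) by exact: tot_surv_continuous.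
rewrite -integZ//; apply: ler_norm_integ => //; first exact: src_continuous_v.
  by cont; exact: cs.
by move=> v vt; apply: src_le => j; exact: PM.
Qed.

End Volterra.

Section GeometricLimit.
Context {R : realType}.

Lemma geometric_small (C q e : R) : 0 <= q < 1 -> 0 < e -> exists n, C * q ^+ n <= e.
Proof.
move=> /andP[q0 q1] e0.
have /cvgrPdist_le/(_ _ e0)[n _ /(_ n (leqnn _))] : geometric C q @ \oo --> (0 : R).
  by apply: cvg_geometric; rewrite ger0_norm.
by rewrite /= sub0r normrN => /(le_trans (ler_norm _)) ?; exists n.
Qed.

Lemma geometric_limit {T : topologicalType} (f : nat -> T -> R) (B q : R) :
  0 <= B -> 0 <= q < 1 -> (forall n, continuous (f n)) ->
  (forall n x, `|f n.+1 x - f n x| <= B * q ^+ n) ->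
  exists g : T -> R, continuous g /\
    forall n x, `|g x - f n x| <= B / (1 - q) * q ^+ n.
Proof.
move=> B0 /[dup] q01 /andP[q0 q1] cf df; pose C := B / (1 - q).
have q1' : 0 < 1 - q by rewrite subr_gt0.
have C0 : 0 <= C by rewrite divr_ge0// ltW.
have CE n : C * q ^+ n - C * q ^+ n.+1 = B * q ^+ n.
  by rewrite exprS -mulrBr -[X in X - _]mul1r -mulrBl mulrA /C divfK// gt_eqF.
(* Adding or subtracting the tail [C * q ^+ n] of the geometric series gives a decreasing and an
   increasing sequence. The limit is then an infimum, within the tail of every [f n]. *)
pose u n x := f n x + C * q ^+ n; pose l n x := f n x - C * q ^+ n.
have uS n x : u n.+1 x <= u n x.
  by have := df n x; rewrite ler_norml /u -CE; lra.
have lS n x : l n x <= l n.+1 x.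
  by have := df n x; rewrite ler_norml /l -CE; lra.
have lu n x : l n x <= u n x.
  by have := mulr_ge0 C0 (exprn_ge0 n q0); rewrite /l /u; lra.
have uD n p x : u (n + p)%N x <= u n x.
  by elim: p => [|p IH]; rewrite ?addn0// addnS (le_trans (uS _ _)).
have lD n p x : l n x <= l (n + p)%N x.
  by elim: p => [|p IH]; rewrite ?addn0// addnS (le_trans _ (lS _ _)).
have lu2 n p x : l n x <= u p x.
  by rewrite (le_trans (lD n p x))// (le_trans (lu _ _))// addnC.
pose g x := inf (range (u ^~ x)).
have gP n x : `|g x - f n x| <= C * q ^+ n.
  have gu : g x <= u n x.
    by apply: ge_inf; [exists (l 0%N x) => _ [p _ <-]; exact: lu2|exists n].
  have lg : l n x <= g x.
    by apply: lb_le_inf; [exists (u 0%N x), 0%N|move=> _ [p _ <-]; exact: lu2].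
  by move: gu lg; rewrite ler_norml /u /l; lra.
exists g; split=> // x; apply/cvgrPdist_le => /= e e0.
have e3 : 0 < e / 3 by rewrite divr_gt0.
have [n Cn] := geometric_small C q01 e3.
near=> y.
have fxy : `|f n x - f n y| <= e / 3.
  by near: y; move: (cf n x) => /cvgrPdist_le /(_ _ e3).
have gx := gP n x; have gy := gP n y.
by move: fxy gx gy Cn; rewrite !ler_norml; lra.
Unshelve. all: by end_near. Qed.

End GeometricLimit.

(** * Maximum principle, flow property and existence for the renewal equation *)

Section Solution.
Context {R : realType} {Z : normedModType R} {k : nat}.
Variables (m : jump_rates R k) (c : 'I_k -> Z) (T : R).
Local Notation L := (rate_bound m).
Local Notation volt := (volterra m c).
Local Notation jump := (src m c).
Implicit Types (i j : 'I_k) (t y v : R) (z : Z).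
Implicit Types (F G : 'I_k -> R -> Z -> R) (Phi Psi : 'I_k -> R -> R -> Z -> R).

Lemma rate_bound_ge0 i : 0 <= L.
Proof. exact: le_trans (tot_ge0 m i 0) (tot_le m i 0). Qed.

Lemma survC_le i t y : 0 <= t <= T -> 0 <= 1 - surv m i y t <= 1 - expR (- (L * T)).
Proof.
move=> /andP[t0 tT]; rewrite subr_ge0 surv_le1//= lerD2l lerN2.
rewrite (le_trans _ (surv_ge _ _ _ t0))// ler_expR lerN2 ler_wpM2l//.
exact: rate_bound_ge0 i.
Qed.

Lemma contraction_factor i : 0 <= T -> 0 <= 1 - expR (- (L * T)) < 1.
Proof.
move=> T0; rewrite subr_ge0 -{1}expR0 ler_expR oppr_le0 mulr_ge0 ?(rate_bound_ge0 i)//=.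
by rewrite gtrBl expR_gt0.
Qed.

(* [surv] and the integrated jump rate sum to 1, so that a solution is an
   average of its data and of itself; the weight of the latter is bounded away
   from 1. *)
Lemma max_principle (Q : R -> R -> Z -> Prop) F Phi (e M : R) :
  jointly_continuous Phi -> 0 <= e ->
  (forall t y z, Q t y z -> 0 <= t <= T) ->
  (forall i t y z v, Q t y z -> 0 <= v <= t -> Q (t - v) 0 (z + v *: c i)) ->
  (forall i t y z, Q t y z -> Phi i t y z = volt F Phi i t y z) ->
  (forall i t y z, Q t y z -> `|F i (y + t) (z + t *: c i)| <= e) ->
  (forall i t y z, Q t y z -> `|Phi i t y z| <= M) ->
  forall i t y z, Q t y z -> `|Phi i t y z| <= e.
Proof.
move=> cPhi e0 Qt Qv PhiE Fe PhiM i t y z Qz.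
have T0 : 0 <= T by have /andP[] := Qt _ _ _ Qz; exact: le_trans.
have q01 := contraction_factor i T0; set q := 1 - _ in q01.
have M0 : 0 <= M by exact: le_trans (normr_ge0 _) (PhiM i _ _ _ Qz).
(* Each use of the equation improves the excess of the a priori bound [M] over [e] by the factor
   [q]; [Q] contains the states reached by a jump, so the induction hypothesis applies inside the
   integral. *)
suff H n : forall i t y z, Q t y z -> `|Phi i t y z| <= e + M * q ^+ n.
  apply/ler_addgt0Pr => d d0.
  have [n Mn] := geometric_small M q01 d0.
  by rewrite (le_trans (H n _ _ _ _ Qz))// lerD2l.
elim: n => [|n IH] {}i {}t {}y {}z {}Qz.
  by rewrite expr0 mulr1 (le_trans (PhiM _ _ _ _ Qz))// lerDr.
have /andP[t0 tT] := Qt _ _ _ Qz.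
have Sq := @survC_le i t y (Qt _ _ _ Qz); have S0 := surv_gt0 m i y t.
rewrite (PhiE _ _ _ _ Qz) /volterra.
have Mq0 : 0 <= M * q ^+ n by rewrite mulr_ge0// exprn_ge0//; case/andP: q01.
rewrite (le_trans (ler_normD _ _))//.
have src_le : `|integ (jump Phi i t y z) 0 t| <= (e + M * q ^+ n) * (1 - surv m i y t).
  by apply: integ_src_le => // v j vt _; apply: IH; exact: (Qv i t y).
have Fe' : `|surv m i y t * F i (y + t) (z + t *: c i)| <= surv m i y t * e.
  rewrite normrM gtr0_norm//; apply: ler_wpM2l; [exact: ltW|exact: Fe].
rewrite (le_trans (lerD Fe' src_le))// exprSr mulrA.
have : (1 - surv m i y t) * (M * q ^+ n) <= q * (M * q ^+ n).
  by rewrite ler_wpM2r//; case/andP: Sq.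
lra.
Qed.

Lemma volterra_continuous F Phi i {U : topologicalType} (a b : U -> R) (d : U -> Z) :
  data_continuous F -> jointly_continuous Phi ->
  continuous a -> continuous b -> continuous d ->
  continuous (fun x => volt F Phi i (a x) (b x) (d x)).
Proof.
move=> cF cPhi ca cb cd; rewrite /volterra; cont.
- exact: surv_continuous.
- by apply: data_continuous_comp => //; cont.
- apply: (@continuous_integ _ _ (fun x => jump Phi i (a x) (b x) (d x)) a) => //.
  apply: src_continuous => //.
  + by apply: (@continuous_comp_fun _ _ _ a (fun p => p.1)) => //; cont.
  + by apply: (@continuous_comp_fun _ _ _ b (fun p => p.1)) => //; cont.
  + by apply: (@continuous_comp_fun _ _ _ d (fun p => p.1)) => //; cont.
  + by move=> p; exact: cvg_snd.
Qed.

Lemma src_linear (a b : R) Phi Psi i t y z v :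
  jump (fun j t y z => a * Phi j t y z + b * Psi j t y z) i t y z v =
  a * jump Phi i t y z v + b * jump Psi i t y z v.
Proof.
rewrite /src !mulr_sumr -big_split /=; apply: eq_bigr => j _; ring.
Qed.

Lemma volterra_linear (a b : R) F G Phi Psi i t y z :
  jointly_continuous Phi -> jointly_continuous Psi -> 0 <= t ->
  volt (fun i y z => a * F i y z + b * G i y z)
       (fun i t y z => a * Phi i t y z + b * Psi i t y z) i t y z =
  a * volt F Phi i t y z + b * volt G Psi i t y z.
Proof.
move=> cPhi cPsi t0; rewrite /volterra.
have -> : jump (fun i t y z => a * Phi i t y z + b * Psi i t y z) i t y z =
    (fun v => a * jump Phi i t y z v + b * jump Psi i t y z v).
  by apply/funext => v; exact: src_linear.
have cs1 : continuous (jump Phi i t y z) by exact: src_continuous_v.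
have cs2 : continuous (jump Psi i t y z) by exact: src_continuous_v.
rewrite integD ?integZ//; [by ring|by cont|by cont].
Qed.

(** Cutting the integral at [s] separates an early first jump from a late one. As [surv] is
    multiplicative along a sojourn, the late part is the same operator restarted at age [y + s] and
    point [z + s *: c i]. *)
Lemma volterra_flow F Phi i (s h y : R) z :
  jointly_continuous Phi -> 0 <= h ->
  volt F Phi i (s + h) y z =
  surv m i y s * volt F Phi i h (y + s) (z + s *: c i) + integ (jump Phi i (s + h) y z) 0 s.
Proof.
move=> cPhi h0; rewrite /volterra (integ_cat _ 0 s) [s + h]addrC.
have cs : continuous (jump Phi i (h + s) y z) by exact: src_continuous_v.
have -> : integ (jump Phi i (h + s) y z) s (h + s) =
    integ (fun x => jump Phi i (h + s) y z (x + s)) 0 h.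
  by rewrite -integ_shift// add0r.
have -> : (fun x => jump Phi i (h + s) y z (x + s)) =
    (fun x => surv m i y s * jump Phi i h (y + s) (z + s *: c i) x).
  apply/funext => x; rewrite /src mulrA -surv_cat [s + x]addrC; congr (_ * _).
  apply: eq_bigr => j _; congr (rate m i j _ * Phi j _ _ _); first by ring.
    by ring.
  by rewrite -addrA -scalerDl [s + x]addrC.
rewrite integZ//; last exact: src_continuous_v.
have zE : z + (s + h) *: c i = z + s *: c i + h *: c i by rewrite scalerDl addrA.
have yE : y + (s + h) = y + s + h by rewrite addrA.
by rewrite [h + s]addrC surv_cat zE yE; ring.
Qed.

Lemma solution_exists F (B : R) : 0 <= T -> data_continuous F ->
  (forall i y z, `|F i y z| <= B) ->
  exists Phi, [/\ jointly_continuous Phi, forall i t y z, `|Phi i t y z| <= B &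
    forall i t y z, 0 <= t <= T -> Phi i t y z = volt F Phi i t y z].
Proof.
(* Clamping the time keeps all Picard iterates continuous and bounded by [B] at every real time,
   with the contraction factor of the horizon [T]. *)
move=> T0 cF FB; pose cl t := Num.max 0 (Num.min t T).
have clP t : 0 <= cl t <= T by rewrite /cl le_max lexx/= ge_max T0 ge_min lexx orbT.
have cl_cont : continuous cl by rewrite /cl; cont.
pose P := fix P n := if n is n'.+1 then fun i t y z => volt F (P n') i (cl t) y z
                     else fun _ _ _ _ => 0.
have PS n i t y z : P n.+1 i t y z = volt F (P n) i (cl t) y z by [].
have cP n : jointly_continuous (P n).
  elim: n => [|n IH] i /=; first exact: cst_continuous.
  apply: volterra_continuous => //; cont.
  by apply: (@continuous_comp_fun _ _ _ cl (fun p => p.1.1)) => //; cont.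
have B0 : 'I_k -> 0 <= B by move=> i; exact: le_trans (normr_ge0 _) (FB i 0 0).
have S1 i t y : surv m i y (cl t) * B + B * (1 - surv m i y (cl t)) = B by ring.
have FSB i t y z :
    `|surv m i y (cl t) * F i (y + cl t) (z + cl t *: c i)| <= surv m i y (cl t) * B.
  by rewrite normrM gtr0_norm ?surv_gt0//; apply: ler_wpM2l; [exact/ltW/surv_gt0|exact: FB].
have PB n i t y z : `|P n i t y z| <= B.
  elim: n i t y z => [|n IH] i t y z /=; first by rewrite normr0 (B0 i).
  rewrite /volterra -(S1 i t y) (le_trans (ler_normD _ _))// lerD//.
  by apply: integ_src_le => //; case/andP: (clP t).
have dvolt Phi Psi i t y z (M : R) : jointly_continuous Phi -> jointly_continuous Psi ->
    0 <= t -> (forall j t z, `|Phi j t 0 z - Psi j t 0 z| <= M) ->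
    `|volt F Phi i t y z - volt F Psi i t y z| <= M * (1 - surv m i y t).
  move=> cPhi cPsi t0 PM.
  have := @volterra_linear 1 (- 1) F F Phi Psi i t y z cPhi cPsi t0.
  rewrite mul1r mulN1r => <-.
  rewrite /volterra mul1r mulN1r subrr mulr0 add0r.
  apply: integ_src_le => // [|v j _ _]; last by rewrite mul1r mulN1r.
  move=> j; cont; [exact: cPhi|exact: cPsi].
have q01 i := contraction_factor i T0; set q := 1 - _ in q01.
have Pq i n t y z : `|P n.+1 i t y z - P n i t y z| <= B * q ^+ n.
  elim: n i t y z => [|n IH] i t y z.
    by rewrite [X in _ - X]/= subr0 expr0 mulr1 PB.
  have /andP[ct cT] := clP t.
  have := dvolt (P n.+1) (P n) i (cl t) y z (B * q ^+ n) (cP _) (cP _) ct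
    (fun j t' z' => IH j t' 0 z').
  move=> /le_trans; apply.
  rewrite exprSr mulrA ler_wpM2l//; last by have /andP[] := survC_le i y (clP t).
  by rewrite mulr_ge0 ?(B0 i)// exprn_ge0//; case/andP: (q01 i).
have /choice[Phi0 PhiP] i := @geometric_limit R _ (fun n (p : R * R * Z) => P n i p.1.1 p.1.2 p.2)
  B q (B0 i) (q01 i) (fun n => cP n i) (fun n p => Pq i n _ _ _).
pose Phi i t y z := Phi0 i (t, y, z).
have cPhi : jointly_continuous Phi.
  move=> i; have [ci _] := PhiP i.
  apply: (@continuous_comp_fun _ _ _ (Phi0 i) (fun p : R * R * Z => (p.1.1, p.1.2, p.2))) => //.
  by cont.
pose C := B / (1 - q).
have PhiC n i t y z : `|Phi i t y z - P n i t y z| <= C * q ^+ n.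
  by have [_ /(_ n (t, y, z))] := PhiP i.
have C0 : 'I_k -> 0 <= C; first move=> i.
  by rewrite divr_ge0 ?(B0 i)// subr_ge0 ltW//; case/andP: (q01 i).
exists Phi; split=> // i t y z.
  apply/ler_addgt0Pr => e e0.
  have [n Cn] := geometric_small C (q01 i) e0.
  rewrite -[Phi i t y z](subrK (P n i t y z)) (le_trans (ler_normD _ _))// addrC.
  by rewrite lerD// (le_trans (PhiC _ _ _ _ _)).
move=> tT; apply/eqP; rewrite -subr_eq0 -normr_le0; apply/ler_addgt0Pr => e e0.
have [n Cn] := geometric_small (2 * C) (q01 i) e0; rewrite add0r.
have /andP[q0 q1] := q01 i; have /andP[t0 _] := tT.
have clt : cl t = t by rewrite /cl; move: tT => /andP[t00 tT']; rewrite (min_idPl tT') (max_idPr t00).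
have Cq0 : 0 <= C * q ^+ n by apply: mulr_ge0; [exact: C0 i|exact: exprn_ge0].
have d1 : `|Phi i t y z - volt F (P n) i t y z| <= C * q ^+ n.
  have := PhiC n.+1 i t y z; rewrite PS clt => /le_trans; apply.
  by rewrite exprSr mulrA; apply: ler_piMr; [exact: Cq0|exact: ltW].
have d2 : `|volt F (P n) i t y z - volt F Phi i t y z| <= C * q ^+ n.
  rewrite distrC.
  have := dvolt Phi (P n) i t y z (C * q ^+ n) cPhi (cP n) t0 (fun j t z => PhiC n j t 0 z).
  move=> /le_trans; apply; apply: ler_piMr; first exact: Cq0.
  by rewrite gerBl ltW ?surv_gt0.
rewrite -(subrKA (volt F (P n) i t y z)) (le_trans (ler_normD _ _))//.
by rewrite (le_trans (lerD d1 d2))// -mulr2n -mulr_natl mulrA.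
Qed.

End Solution.

(** * Differentiation of solutions of the renewal equation *)

Section FirstOrder.
Context {R : realType}.

Definition fwd {U : topologicalType} (u0 : U) : set_system (U * R) :=
  filter_prod (nbhs u0) (0 : R)^'+.

Global Instance fwd_filter {U : topologicalType} (u0 : U) : ProperFilter (fwd u0).
Proof. exact: filter_prod_proper. Qed.

(* The base point varies along with the step: this makes right difference
   quotients control the left ones. *)
Definition first_order {U : topologicalType} (D : U -> R -> R) (l : R) (u0 : U) :=
  p.2^-1 * D p.1 p.2 @[p --> fwd u0] --> l.

Lemma fwd_nbhs {U : topologicalType} (u0 : U) : fwd u0 `=>` nbhs (u0, 0 : R).
Proof.
by move=> A [[B C] [/= uB C0] BC]; exists (B, C) => //; split=> //=; apply: filterS C0 => x Cx _.
Qed.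

Lemma fwd_continuous {U : topologicalType} (V : topologicalType) (u0 : U) (f : U * R -> V) :
  {for (u0, 0), continuous f} -> f @ fwd u0 --> f (u0, 0).
Proof. by move=> cf A /cf /fwd_nbhs. Qed.

Lemma fwd_fst {U : topologicalType} (u0 : U) : fst @ fwd u0 --> u0.
Proof. exact: cvg_fst. Qed.

Lemma fwd_fst_comp {U V : topologicalType} (f : U -> V) (u0 : U) :
  {for u0, continuous f} -> f p.1 @[p --> fwd u0] --> f u0.
Proof. by move=> cf A /cf; exact: fwd_fst. Qed.

Lemma fwd_snd {U : topologicalType} (u0 : U) : snd @ fwd u0 --> (0 : R)^'+.
Proof. exact: cvg_snd. Qed.

Lemma fwd_gt0 {U : topologicalType} (u0 : U) : \forall p \near fwd u0, 0 < p.2.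
Proof. exact: (@fwd_snd _ u0 [set h | 0 < h] (nbhs_right_gt 0)). Qed.

Lemma fwd_lt {U : topologicalType} (u0 : U) (e : R) : 0 < e -> \forall p \near fwd u0, p.2 < e.
Proof. by move=> e0; exact: (@fwd_snd _ u0 [set h | h < e] (nbhs_right_lt e0)). Qed.

Lemma eq_first_order {U : topologicalType} (D D' : U -> R -> R) (l l' : R) u0 :
  (forall u h, D u h = D' u h) -> l = l' -> first_order D l u0 -> first_order D' l' u0.
Proof. by move=> DD' <-; rewrite (_ : D = D')//; do 2 (apply/funext => ?); exact: DD'. Qed.

Lemma first_order_comp {U V : topologicalType} (D : U -> R -> R) (l : R) (f : V -> U) v0 :
  {for v0, continuous f} -> first_order D l (f v0) -> first_order (D \o f) l v0.
Proof.
move=> cf Dl A /Dl [[B C] [/= fB C0] BC].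
exists (f @^-1` B, C); first by split=> //=; exact: (cf B).
by move=> [v h] [/= Bv Ch]; exact: (BC (f v, h)).
Qed.

Lemma first_order_derive (f : R -> R) (l x : R) :
  first_order (fun u h => f (u + h) - f u) l x -> is_derive x 1 f l.
Proof.
move=> fl.
have dl : h^-1 *: ((f \o shift x) (h *: 1) - f x) @[h --> 0^'] --> l.
  move=> A /fl [[B C] [/= xB C0] BC].
  have [d /= d0 dB] : \forall h \near (0 : R), B (x + h).
    have : x + h @[h --> (0 : R)] --> x + 0 by apply: cvgD; [exact: cvg_cst|exact: cvg_id].
    by rewrite addr0; apply.
  have [e /= e0 eC] := C0.
  exists (Num.min d e) => /=; first by rewrite lt_min d0 e0.
  move=> h /=; rewrite sub0r normrN lt_min => /andP[hd he] h0.
  rewrite /= [h *: 1]mulr1 /GRing.scale /=.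
  have [hpos|hneg] := ltP 0 h.
    rewrite [h + x]addrC; apply: (BC (x, h)); split=> /=; first exact: nbhs_singleton.
    by apply: eC => //=; rewrite sub0r normrN.
  have hneg' : h < 0 by rewrite lt_neqAle h0.
  (* A negative step from [x] is a positive step from [x + h], read backwards. *)
  have := BC (x + h, - h); rewrite /= addrK -opprB invrN mulrNN [h + x]addrC; apply.
  split=> /=; first by apply: dB => /=; rewrite sub0r normrN.
  by apply: eC; rewrite /= ?sub0r ?opprK ?oppr_gt0.
by apply: DeriveDef; [apply/cvg_ex; exists l|apply: cvg_lim].
Qed.

(** Because the base point of [first_order] moves, each limit already holds uniformly near its
    point, and a compact set is covered by such neighbourhoods. *)
Lemma first_order_uniform {U : topologicalType} (K : set U) (D : U -> R -> R) (l : U -> R) (e : R) :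
  compact K -> continuous l -> 0 < e -> (forall u, K u -> first_order D (l u) u) ->
  \forall h \near 0^'+, forall u, K u -> `|D u h - h * l u| <= e * h.
Proof.
move=> /compact_near_coveringP Kc cl e0 Dl.
apply: (Kc _ _ (fun h u => `|D u h - h * l u| <= e * h)) => u Ku.
have e2 : 0 < e / 2 by rewrite divr_gt0.
have /cvgrPdist_le/(_ _ e2) Du := Dl u Ku.
have : l p.1 @[p --> fwd u] --> l u by apply: cvg_comp (@fwd_fst _ u) (cl u).
move=> /cvgrPdist_le/(_ _ e2) lu.
near=> p.
have p0 : 0 < p.2 by near: p; exact: fwd_gt0.
have D1 : `|l u - p.2^-1 * D p.1 p.2| <= e / 2 by near: p.
have l1 : `|l u - l p.1| <= e / 2 by near: p.
have A : `|p.2^-1 * D p.1 p.2 - l p.1| <= e.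
  by rewrite [e]splitr (le_trans (ler_distD (l u) _ _))// lerD// distrC.
have -> : D p.1 p.2 - p.2 * l p.1 = p.2 * (p.2^-1 * D p.1 p.2 - l p.1).
  by rewrite mulrBr mulrA divff ?mul1r// lt0r_neq0.
by rewrite normrM gtr0_norm// mulrC ler_wpM2r// ltW.
Unshelve. all: by end_near. Qed.

End FirstOrder.

(** * Derivatives in time and in the moving point *)

Section DirectionalDerivative.
Context {R : realType} {Z : normedModType R} {k : nat}.
Variables (m : jump_rates R k) (c : 'I_k -> Z) (T : R).
Local Notation L := (rate_bound m).
Local Notation volt := (volterra m c).
Local Notation jump := (src m c).
Implicit Types (i j : 'I_k) (t y v : R) (z : Z).
Implicit Types (F G : 'I_k -> R -> Z -> R) (Phi Psi : 'I_k -> R -> R -> Z -> R).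

Definition solution F Phi := [/\ jointly_continuous Phi,
  exists B, forall i t y z, `|Phi i t y z| <= B &
  forall i t y z, 0 <= t <= T -> Phi i t y z = volt F Phi i t y z].

Lemma solution0 F Phi i y z : 0 <= T -> solution F Phi -> Phi i 0 y z = F i y z.
Proof.
move=> T0 [_ _ ->]; last by rewrite lexx.
by rewrite /volterra integxx surv0 mul1r !addr0 scale0r addr0.
Qed.

Lemma volterra_one i t y z : 0 <= t ->
  volt (fun _ _ _ => 1) (fun _ _ _ _ => 1) i t y z = 1.
Proof.
move=> t0; rewrite /volterra mulr1.
have -> : jump (fun _ _ _ _ => 1) i t y z = (fun v => tot m i (y + v) * surv m i y v).
  apply/funext => v; rewrite /src mulrC; congr (_ * _).
  by apply: eq_bigr => j _; rewrite mulr1.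
by rewrite integ_surv// addrC subrK.
Qed.

Lemma survC_small i t y : 0 <= t -> 1 - surv m i y t <= L * t.
Proof.
move=> t0; have := surv_ge m i y t0; have := expR_ge1Dx (- (L * t)); lra.
Qed.

Lemma surv_cvg1 i (a : R) (u0 : R * Z) : surv m i p.1.1 (a * p.2) @[p --> fwd u0] --> (1 : R).
Proof.
rewrite -(surv0 m i u0.1) -[X in surv m i u0.1 X](mulr0 a).
apply: (@fwd_continuous _ _ _ u0 (fun p => surv m i p.1.1 (a * p.2))).
by apply: (@surv_continuous _ _ m i _ (fun p : R * Z * R => p.1.1) (fun p => a * p.2)); cont.
Qed.

(** In the short time [a * h] a jump has probability O(h), and without one the end point is
    [z + h *: (e + a *: c i)]. Subtracting the constant solution 1 times the base value of [g] makes
    the contribution of a jump itself small, so that the remainder [r] is o(h). *)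
Lemma first_order_short_time (g : Z -> R) (l : R) (a : R) (e : Z) Phi i (u0 : R * Z) :
  0 < T -> 0 <= a -> continuous g -> solution (fun _ _ z => g z) Phi ->
  first_order (fun z h => g (z + h *: (e + a *: c i)) - g z) l u0.2 ->
  first_order (fun u h => Phi i (a * h) u.1 (u.2 + h *: e) - g u.2) l u0.
Proof.
move=> T0 a0 cg sPhi dg; have [cPhi _ PhiE] := sPhi.
have Phi0 j y z : Phi j 0 y z = g z by rewrite (solution0 _ _ _ (ltW T0) sPhi).
pose r (p : R * Z * R) := integ (jump (fun j t y z => 1 * Phi j t y z + (- g p.1.2) * 1)
  i (a * p.2) p.1.1 (p.1.2 + p.2 *: e)) 0 (a * p.2).
have aT : \forall p \near fwd u0, 0 <= a * p.2 <= T.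
  near=> p; have p0 : 0 < p.2 by near: p; exact: fwd_gt0.
  rewrite mulr_ge0 ?(ltW p0)//=.
  have : p.2 < T / (a + 1) by near: p; apply: fwd_lt; rewrite divr_gt0// ltr_wpDl.
  rewrite ltr_pdivlMr ?ltr_wpDl// => /ltW; apply: le_trans.
  by rewrite mulrC ler_wpM2l ?(ltW p0)// lerDl.
have E : \forall p \near fwd u0,
    p.2^-1 * (surv m i p.1.1 (a * p.2) * (g (p.1.2 + p.2 *: (e + a *: c i)) - g p.1.2) + r p) =
    p.2^-1 * (Phi i (a * p.2) p.1.1 (p.1.2 + p.2 *: e) - g p.1.2).
  near=> p; congr (_ * _).
  have /andP[t0 tT] : 0 <= a * p.2 <= T by near: p.
  have cone : jointly_continuous (fun (_ : 'I_k) (_ _ : R) (_ : Z) => 1 : R) by move=> j; cont.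
  have V := @volterra_linear _ _ _ m c 1 (- g p.1.2) (fun _ _ z => g z) (fun _ _ _ => 1)
    Phi (fun _ _ _ _ => 1) i (a * p.2) p.1.1 (p.1.2 + p.2 *: e) cPhi cone t0.
  have -> : Phi i (a * p.2) p.1.1 (p.1.2 + p.2 *: e) - g p.1.2 =
      1 * Phi i (a * p.2) p.1.1 (p.1.2 + p.2 *: e) + - g p.1.2 * 1 by rewrite mul1r mulr1.
  rewrite PhiE ?t0//; move: V; rewrite (volterra_one i p.1.1 _ t0) => <-.
  rewrite /volterra -/(r p) mul1r mulr1; congr (_ * (g _ - _) + _).
  by rewrite scalerDr scalerA [p.2 * a]mulrC addrA.
apply: cvg_trans (near_eq_cvg E) _.
under eq_fun do rewrite mulrDr mulrCA.
suff r0 : p.2^-1 * r p @[p --> fwd u0] --> (0 : R).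
  rewrite -[l]addr0 -[l in l + 0]mul1r.
  apply: cvgD r0; apply: cvgM; first exact: surv_cvg1.
  exact: (first_order_comp (f := snd) cvg_snd dg).
(* The jump time is written as [a * h * s] with [s] in a fixed compact interval, which gives
   uniformity in the jump time. *)
have small (d : R) : 0 < d -> \forall p \near fwd u0, forall j s, 0 <= s <= 1 ->
    `|Phi j (a * p.2 * (1 - s)) 0 (p.1.2 + p.2 *: e + (a * p.2 * s) *: c i) - g p.1.2| <= d.
  move=> d0; apply: filter_forall => j.
  have /compact_near_coveringP Kc := @segment_compact R 0 1.
  have := Kc _ _ (fun (p : R * Z * R) s =>
    `|Phi j (a * p.2 * (1 - s)) 0 (p.1.2 + p.2 *: e + (a * p.2 * s) *: c i) - g p.1.2| <= d)
    (fwd_filter u0).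
  have cN : continuous (fun q : R * (R * Z * R) =>
    Phi j (a * q.2.2 * (1 - q.1)) 0 (q.2.1.2 + q.2.2 *: e + (a * q.2.2 * q.1) *: c i) - g q.2.1.2).
    cont; first by apply: jointly_continuous_comp => //; cont.
    by apply: (@continuous_comp_fun _ _ _ g (fun q => q.2.1.2)) => //; cont.
  move=> H; have {}H : \forall p \near fwd u0, `[0, 1]%classic `<=` (fun s =>
    `|Phi j (a * p.2 * (1 - s)) 0 (p.1.2 + p.2 *: e + (a * p.2 * s) *: c i) - g p.1.2| <= d).
    apply: H => s _.
    have /cvgrPdist_le/(_ _ d0) := cN (s, (u0, 0)).
    rewrite /= !mulr0 !mul0r !scale0r !addr0 Phi0 subrr.
    move=> [[A B] [/= sA uB] AB]; exists (A, B); first by split=> //; exact: fwd_nbhs.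
    by move=> q /AB; rewrite /= sub0r normrN.
  move: H; apply: filterS => p H s s01; apply: H.
  by rewrite /= in_itv.
apply/cvgrPdist_le => /= d d0.
(* The jump probability is at most [L * (a * h)]; the added 1 keeps the denominator positive. *)
have d' : 0 < d / (a * L + 1).
  by rewrite divr_gt0// ltr_wpDl// mulr_ge0// (rate_bound_ge0 m i).
near=> p; rewrite sub0r normrN.
have p0 : 0 < p.2 by near: p; exact: fwd_gt0.
have /andP[t0 tT] : 0 <= a * p.2 <= T by near: p.
have H : forall j s, 0 <= s <= 1 -> `|Phi j (a * p.2 * (1 - s)) 0
   (p.1.2 + p.2 *: e + (a * p.2 * s) *: c i) - g p.1.2| <= d / (a * L + 1).
  by near: p; exact: small.
rewrite normrM gtr0_norm ?invr_gt0// ler_pdivrMl//.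
have : `|r p| <= d / (a * L + 1) * (1 - surv m i p.1.1 (a * p.2)).
  apply: integ_src_le => // [j|v j /andP[v0 vt] _].
    by cont; exact: cPhi.
  rewrite mul1r mulr1.
  have [ap|ap] := eqVneq (a * p.2) 0.
    have v00 : v = 0 by apply/eqP; rewrite eq_le v0 andbT -ap.
    have := H j 0; rewrite lexx ler01 mulr0 v00 scale0r ap mul0r subr0.
    exact.
  have ap0 : 0 < a * p.2 by rewrite lt_neqAle eq_sym ap.
  have := H j (v / (a * p.2)).
  rewrite divr_ge0//= ler_pdivrMr// mul1r vt mulrBr mulr1 [_ * (v / _)]mulrC divfK//.
  exact.
move=> /le_trans; apply; rewrite -mulrA [leRHS]mulrC ler_wpM2l ?(ltW d0)//.
have aL : 0 < a * L + 1 by rewrite ltr_wpDl// mulr_ge0// (rate_bound_ge0 m i).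
rewrite mulrC ler_pdivrMr// (le_trans (survC_small _ _ t0))//.
have -> : p.2 * (a * L + 1) = L * (a * p.2) + p.2 by ring.
by rewrite lerDl ltW.
Unshelve. all: by end_near. Qed.

Definition jump_stable (Q : R -> R -> Z -> Prop) :=
  forall i t y z v, Q t y z -> 0 <= v <= t -> Q (t - v) 0 (z + v *: c i).

Lemma solution_linear (a b : R) F G Phi Psi : solution F Phi -> solution G Psi ->
  solution (fun i y z => a * F i y z + b * G i y z)
           (fun i t y z => a * Phi i t y z + b * Psi i t y z).
Proof.
move=> [cPhi [B1 PhiB] PhiE] [cPsi [B2 PsiB] PsiE]; split.
- by move=> i; cont; [exact: cPhi|exact: cPsi].
- exists (`|a| * B1 + `|b| * B2) => i t y z.
  by rewrite (le_trans (ler_normD _ _))// !normrM lerD// ler_wpM2l.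
- move=> i t y z tT; rewrite PhiE// PsiE// volterra_linear//.
  by case/andP: tT.
Qed.

(** By the flow property, the solution with time [s] left serves as data for the preceding time [t].
    The equation commutes with translations of [z]. *)
Lemma solution_shift F Phi (s : R) (e : Z) : 0 <= s -> solution F Phi ->
  forall i t y z, 0 <= t -> t + s <= T ->
  Phi i (t + s) y (z + e) =
  volt (fun i y z => Phi i s y (z + e)) (fun i t y z => Phi i (t + s) y (z + e)) i t y z.
Proof.
move=> s0 [cPhi _ PhiE] i t y z t0 tsT.
have ts : 0 <= t + s <= T by rewrite addr_ge0.
have sT : 0 <= s <= T by rewrite s0 (le_trans _ tsT)// lerDr.
rewrite PhiE// volterra_flow// -PhiE// /volterra; congr (_ * Phi i _ _ _ + integ _ _ _).
  by rewrite addrAC.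
apply/funext => v; rewrite /src; congr (_ * _); apply: eq_bigr => j _.
by congr (_ * Phi j _ _ _); rewrite addrAC.
Qed.

(* The difference quotient minus the expected derivative solves the equation
   with small data, by the flow property; the maximum principle concludes. *)
Lemma directional_derivative (g : Z -> R) (l : 'I_k -> Z -> R) Phi Psi (a T' : R) (e : Z)
    (Q : R -> R -> Z -> Prop) (K : set (R * Z)) :
  0 < T -> 0 <= a -> T' < T -> continuous g -> (forall i, continuous (l i)) ->
  solution (fun _ _ z => g z) Phi -> solution (fun i _ z => l i z) Psi ->
  jump_stable Q -> (forall t y z, Q t y z -> 0 <= t <= T') ->
  compact K -> (forall i t y z, Q t y z -> K (y + t, z + t *: c i)) ->
  (forall i u, K u ->
    first_order (fun z h => g (z + h *: (e + a *: c i)) - g z) (l i u.2) u.2) ->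
  forall i t0 y0 z0,
  (\forall u \near (t0, y0, z0), Q u.1.1 u.1.2 u.2) ->
  first_order (fun (u : R * R * Z) h =>
     Phi i (u.1.1 + a * h) u.1.2 (u.2 + h *: e) - Phi i u.1.1 u.1.2 u.2)
    (Psi i t0 y0 z0) (t0, y0, z0).
Proof.
move=> T0 a0 T'T cg cl sPhi sPsi Qs QT Kc QK dg i0 t0 y0 z0 Q0.
have [cPhi [B PhiB] PhiE] := sPhi; have [cPsi _ PsiE] := sPsi.
pose D h i t y z := Phi i (t + a * h) y (z + h *: e) - Phi i t y z - h * Psi i t y z.
have unif (d : R) : 0 < d -> \forall h \near (0 : R)^'+,
    forall i t y z, Q t y z -> `|D h i t y z| <= d * h.
  move=> d0.
  have : \forall h \near (0 : R)^'+, forall i u, K u ->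
      `|Phi i (a * h) u.1 (u.2 + h *: e) - g u.2 - h * l i u.2| <= d * h.
    apply: filter_forall => i.
    apply: (first_order_uniform (D := fun u h => Phi i (a * h) u.1 (u.2 + h *: e) - g u.2)
      (l := fun u => l i u.2)) => //.
      by apply: (@continuous_comp_fun _ _ _ (l i) (fun u => u.2)) => //; cont.
    by move=> u Ku; apply: first_order_short_time => //; exact: dg.
  move=> near_data; have a1 : 0 < a + 1 by rewrite ltr_wpDl.
  near=> h.
  have h0 : 0 < h by near: h; exact: nbhs_right_gt.
  have ahT : T' + a * h <= T.
    have : h < (T - T') / (a + 1).
      by near: h; apply: nbhs_right_lt; rewrite divr_gt0 ?subr_gt0.
    by rewrite ltr_pdivlMr ?a1// mulrDr mulr1 [h * a]mulrC; lra.
  have ah0 : 0 <= a * h by rewrite mulr_ge0// ltW.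
  (* These are the data of [D h]: the short-time error of the difference quotient, which is at most
     [d * h] on [K]. *)
  pose F i y z := 1 * (1 * Phi i (a * h) y (z + h *: e) + -1 * g z) + (- h) * l i z.
  have DE i t y z :
      1 * (1 * Phi i (t + a * h) y (z + h *: e) + -1 * Phi i t y z) + (- h) * Psi i t y z =
      D h i t y z by rewrite /D !mul1r !mulN1r mulNr.
  have cD1 : jointly_continuous (fun i t y z => Phi i (t + a * h) y (z + h *: e)).
    by move=> i; apply: jointly_continuous_comp => //; cont.
  have cD2 : jointly_continuous
      (fun i t y z => 1 * Phi i (t + a * h) y (z + h *: e) + -1 * Phi i t y z).
    by move=> i; cont; [exact: cD1|exact: cPhi].
  have DF : forall i t y z, Q t y z -> D h i t y z = volt F (D h) i t y z.
    move=> i t y z /QT /andP[t00 tT].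
    have tT' : 0 <= t <= T by rewrite t00 (le_trans tT)// ltW.
    have -> : D h = (fun i t y z =>
      1 * (1 * Phi i (t + a * h) y (z + h *: e) + -1 * Phi i t y z) + (- h) * Psi i t y z).
      by do 4 (apply/funext => ?); rewrite DE.
    rewrite volterra_linear// volterra_linear// -PsiE// -(PhiE _ t)//.
    rewrite -(@solution_shift _ _ (a * h) (h *: e) ah0 sPhi i t y z t00)//.
    by rewrite (le_trans _ ahT)// lerD2r.
  have cD : jointly_continuous (D h).
    by move=> i; rewrite /D; cont; [exact: cD1|exact: cPhi|exact: cPsi].
  have [B2 PsiB] : exists B2, forall i t y z, `|Psi i t y z| <= B2 by case: sPsi.
  apply: (@max_principle _ _ _ m c T Q F (D h) (d * h) (B + B + h * B2)) => //.
  - by rewrite mulr_ge0// ltW.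
  - by move=> t y z /QT /andP[-> /le_trans]; apply; exact: ltW.
  - move=> i t y z /(QK i) Ku; have /(_ i _ Ku) : forall i u, K u ->
      `|Phi i (a * h) u.1 (u.2 + h *: e) - g u.2 - h * l i u.2| <= d * h by near: h.
    by rewrite /F !mul1r !mulN1r mulNr.
  - move=> i t y z _; rewrite /D (le_trans (ler_normB _ _))// lerD//.
      by rewrite (le_trans (ler_normB _ _))// lerD.
    by rewrite normrM gtr0_norm// ler_wpM2l// ltW.
apply/cvgrPdist_le => /= d d0; have d2 : 0 < d / 2 by rewrite divr_gt0.
have cP : Psi i0 p.1.1.1 p.1.1.2 p.1.2 @[p --> fwd (R := R) (t0, y0, z0)] --> Psi i0 t0 y0 z0.
  exact: (@fwd_fst_comp _ _ _ (fun q : R * R * Z => Psi i0 q.1.1 q.1.2 q.2) _ (cPsi i0 _)).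
move/cvgrPdist_le : cP => /(_ _ d2) /= cP.
near=> p.
have p0 : 0 < p.2 by near: p; exact: fwd_gt0.
have Qp : Q p.1.1.1 p.1.1.2 p.1.2.
  by near: p; exact: (@fwd_fst _ _ (t0, y0, z0) _ Q0).
have Dp : `|D p.2 i0 p.1.1.1 p.1.1.2 p.1.2| <= d / 2 * p.2.
  apply: (_ : forall i t y z, Q t y z -> `|D p.2 i t y z| <= d / 2 * p.2) => //.
  by near: p; exact: (@fwd_snd _ _ (t0, y0, z0) _ (unif _ d2)).
have cPp : `|Psi i0 t0 y0 z0 - Psi i0 p.1.1.1 p.1.1.2 p.1.2| <= d / 2 by near: p.
rewrite [d]splitr (le_trans (ler_distD (Psi i0 p.1.1.1 p.1.1.2 p.1.2) _ _))// lerD//.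
rewrite distrC -[X in _ - X](mulKf (lt0r_neq0 p0)) -mulrBr normrM gtr0_norm ?invr_gt0//.
by rewrite ler_pdivrMl// [leRHS]mulrC.
Unshelve. all: by end_near. Qed.

End DirectionalDerivative.

(** * Derivative in the age *)

Section AgeDerivative.
Context {R : realType} {Z : normedModType R} {k : nat}.
Variables (m : jump_rates R k) (c : 'I_k -> Z) (T : R).
Local Notation jump := (src m c).

Lemma first_order_integ {U : topologicalType} (f : U * R -> R -> R) (u0 : U) :
  continuous (fun q : (U * R) * R => f q.1 q.2) ->
  p.2^-1 * integ (f p) 0 p.2 @[p --> fwd u0] --> f (u0, 0) 0.
Proof.
move=> cf.
pose G (p : U * R) := integ (fun w => f p (p.2 * w)) 0 1.
have cG : continuous G.
  apply: (@continuous_integ01 _ _ (fun p w => f p (p.2 * w))).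
  apply: (@continuous_comp_fun _ _ _ (fun q : (U * R) * R => f q.1 q.2)
    (fun q : (U * R) * R => (q.1, q.1.2 * q.2))) => //.
  by cont.
have -> : f (u0, 0) 0 = G (u0, 0).
  rewrite /G; have -> : (fun w => f (u0, 0) ((u0, (0 : R)).2 * w)) = cst (f (u0, 0) 0).
    by apply/funext => w; rewrite mul0r.
  by rewrite integ_cst// subr0 mulr1.
apply: cvg_trans (fwd_continuous (cG (u0, 0))).
apply: near_eq_cvg; near=> p.
have p0 : 0 < p.2 by near: p; exact: fwd_gt0.
rewrite integ_scale ?mulKf ?lt0r_neq0//.
exact: (@continuous_partial _ _ _ f p cf).
Unshelve. all: by end_near. Qed.

(** Starting from [z - h *: c i] with time [t + h], a sojourn of length [h] ends at [z] with time
    [t] and age [y + h]. The flow property is solved for this value: [w] comes from the displaced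
    start, the term in [tot] from dividing by the survival probability, and the sum from jumps
    before [h]. *)
Lemma age_derivative F (Phi : 'I_k -> R -> R -> Z -> R) i t0 y0 z0 (w : R) :
  0 < t0 < T -> solution m c T F Phi ->
  first_order (fun (u : R * R * Z) h =>
     Phi i (u.1.1 + 1 * h) u.1.2 (u.2 + h *: - c i) - Phi i u.1.1 u.1.2 u.2)
    w (t0, y0, z0) ->
  first_order (fun (u : R * R * Z) h => Phi i u.1.1 (u.1.2 + h) u.2 - Phi i u.1.1 u.1.2 u.2)
    (w + tot m i y0 * Phi i t0 y0 z0 - \sum_(j | j != i) rate m i j y0 * Phi j t0 0 z0)
    (t0, y0, z0).
Proof.
move=> /andP[t00 t0T] [cPhi _ PhiE] dw.
pose I (p : R * R * Z * R) :=
  integ (jump Phi i (p.1.1.1 + p.2) p.1.1.2 (p.1.2 - p.2 *: c i)) 0 p.2.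
pose S (p : R * R * Z * R) := surv m i p.1.1.2 p.2.
have cS : continuous S.
  by apply: (@surv_continuous _ _ m i _ (fun p : R * R * Z * R => p.1.1.2) (fun p => p.2)); cont.
have S1 : S p @[p --> fwd (t0, y0, z0)] --> (1 : R).
  by rewrite -(surv0 m i y0); exact: (fwd_continuous (cS ((t0, y0, z0), 0))).
have SV : (S p)^-1 @[p --> fwd (t0, y0, z0)] --> (1 : R).
  by rewrite -[1]invr1; apply: cvgV; rewrite ?oner_neq0.
have I1 : p.2^-1 * I p @[p --> fwd (t0, y0, z0)] -->
    \sum_(j | j != i) rate m i j y0 * Phi j t0 0 z0.
  have := @first_order_integ _ (fun p => jump Phi i (p.1.1.1 + p.2) p.1.1.2 (p.1.2 - p.2 *: c i))
    (t0, y0, z0).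
  have -> : jump Phi i ((t0, y0, z0, 0 : R).1.1.1 + (t0, y0, z0, 0 : R).2) (t0, y0, z0, 0 : R).1.1.2
     ((t0, y0, z0, 0 : R).1.2 - (t0, y0, z0, 0 : R).2 *: c i) 0 =
     \sum_(j | j != i) rate m i j y0 * Phi j t0 0 z0.
    by rewrite /src /= surv0 mul1r; apply: eq_bigr => j _; rewrite !addr0 !subr0 !scale0r subr0 addr0.
  apply.
  by apply: src_continuous => //; cont.
have C1 : p.2^-1 * (1 - S p) @[p --> fwd (t0, y0, z0)] --> tot m i y0.
  have := @first_order_integ _ (fun (p : R * R * Z * R) v =>
    tot m i (p.1.1.2 + v) * surv m i p.1.1.2 v) (t0, y0, z0).
  rewrite /= addr0 surv0 mulr1 => H.
  apply: cvg_trans (H _); last first.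
    cont.
      by apply: (@continuous_comp_fun _ _ _ (tot m i)); [exact: tot_continuous|cont].
    by apply: (@surv_continuous _ _ m i _ (fun q : R * R * Z * R * R => q.1.1.1.2) (fun q => q.2)); cont.
  apply: near_eq_cvg; near=> p; rewrite integ_surv// ltW//.
  by near: p; exact: fwd_gt0.
have Phi1 : Phi i p.1.1.1 p.1.1.2 p.1.2 @[p --> fwd (R := R) (t0, y0, z0)] --> Phi i t0 y0 z0.
  exact: (@fwd_fst_comp _ _ _ (fun q : R * R * Z => Phi i q.1.1 q.1.2 q.2) _ (cPhi i _)).
have E : \forall p \near fwd (t0, y0, z0),
    (S p)^-1 * (p.2^-1 * (Phi i (p.1.1.1 + 1 * p.2) p.1.1.2 (p.1.2 + p.2 *: - c i)
       - Phi i p.1.1.1 p.1.1.2 p.1.2) +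
       p.2^-1 * (1 - S p) * Phi i p.1.1.1 p.1.1.2 p.1.2 - p.2^-1 * I p) =
    p.2^-1 * (Phi i p.1.1.1 (p.1.1.2 + p.2) p.1.2 - Phi i p.1.1.1 p.1.1.2 p.1.2).
  near=> p.
  have p0 : 0 < p.2 by near: p; exact: fwd_gt0.
  have pt : t0 / 2 < p.1.1.1 < (t0 + T) / 2.
    near: p; apply: (@fwd_fst _ _ (t0, y0, z0) [set u | t0 / 2 < u.1.1 < (t0 + T) / 2]).
    have c11 : continuous (fun u : R * R * Z => u.1.1) by cont.
    have : nbhs t0 [set t | t0 / 2 < t < (t0 + T) / 2].
      have H : \forall t \near t0, t \in `]t0 / 2, (t0 + T) / 2[.
        by apply: near_in_itvoo; rewrite in_itv /=; apply/andP; split; lra.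
      by apply: filterS H => x; rewrite in_itv.
    by move/(c11 (t0, y0, z0)).
  have ph : p.2 < (T - t0) / 2 by near: p; apply: fwd_lt; lra.
  have /andP[pt1 pt2] := pt.
  have tT : 0 <= p.1.1.1 <= T by lra.
  have thT : 0 <= p.2 + p.1.1.1 <= T by lra.
  have t0' : 0 <= p.1.1.1 by lra.
  have := @volterra_flow _ _ _ m c F Phi i p.2 p.1.1.1 p.1.1.2 (p.1.2 - p.2 *: c i) cPhi t0'.
  rewrite -!PhiE// subrK [p.2 + _]addrC -/(I p) -/(S p) => flow.
  rewrite mul1r scalerN flow.
  have Sn : S p != 0 by rewrite lt0r_neq0 ?surv_gt0.
  have pn : p.2 != 0 by rewrite lt0r_neq0.
  by field; apply/andP; split.
move=> A nA; apply: (near_eq_cvg E).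
have := cvgM SV (cvgB (cvgD dw (cvgM C1 Phi1)) I1); rewrite mul1r => H.
exact: (H _ _ _ _ A nA).
Unshelve. all: by end_near. Qed.

End AgeDerivative.

(** * The Black-Scholes call *)

Section NormalCdf.
Context {R : realType}.
Implicit Types (d e x : R).

Definition gauss d : R := expR (- (d ^+ 2 / 2)).

Lemma gauss_continuous : continuous gauss.
Proof.
move=> d; rewrite /gauss; apply: continuous_comp; last exact: continuous_expR.
by apply: cvgN; apply: cvgM; [exact: exprn_continuous|exact: cvg_cst].
Qed.

Lemma gauss_gt0 d : 0 < gauss d. Proof. exact: expR_gt0. Qed.

Lemma gauss_le1 d : gauss d <= 1.
Proof. by rewrite -expR0 ler_expR oppr_le0 mulr_ge0// sqr_ge0. Qed.

Definition gauss_int d : R := primitive gauss d.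

Lemma gauss_int_derive d : is_derive d 1 gauss_int (gauss d).
Proof. exact: primitiveP gauss_continuous _. Qed.

Lemma gauss_int_incr d e : d <= e -> gauss_int d <= gauss_int e.
Proof.
move=> de; have [c _] := mean_value de (fun x _ => gauss_int_derive x).
by rewrite -subr_ge0 => ->; rewrite mulr_ge0 ?subr_ge0// ltW// gauss_gt0.
Qed.

Lemma gauss_int_bounded d : `|gauss_int d - gauss_int 0| <= expR 1.
Proof.
have [d0|/ltW d0] := leP 0 d.
  (* As [gauss x <= expR (1 - x)], this function is nonincreasing, which bounds the primitive on the
     right; the mirrored exponential is used on the left. *)
  have dF x : is_derive x 1 (gauss_int + (fun z => expR (1 - z))) (gauss x - expR (1 - x)).
    have := gauss_int_derive x => dg.
    have d1 : is_derive x 1 (fun z => 1 - z) (-1 : R).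
      by have := @is_deriveB R R R (cst 1) id x 1 0 1 _ _; rewrite sub0r; apply.
    have d2 : is_derive x 1 (expR \o (fun z => 1 - z)) (expR (1 - x) * -1).
      exact: is_derive1_comp.
    have -> : gauss x - expR (1 - x) = gauss x + expR (1 - x) * -1 by rewrite mulrN1.
    exact: (@is_deriveD _ _ _ gauss_int (expR \o (fun z => 1 - z))).
  have [c _] := mean_value d0 (fun x _ => dF x).
  rewrite !fctE subr0 => E.
  have le0 : (gauss c - expR (1 - c)) * (d - 0) <= 0.
    rewrite mulr_le0_ge0 ?subr0// subr_le0 ler_expR.
    by have := sqr_ge0 (c - 1); rewrite sqrrB expr1n mulr1; lra.
  rewrite ger0_norm ?subr_ge0 ?gauss_int_incr//.
  by have := expR_gt0 (1 - d); lra.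
have dF x : is_derive x 1 (gauss_int - (fun z => expR (1 + z))) (gauss x - expR (1 + x)).
  have := gauss_int_derive x => dg.
  have d1 : is_derive x 1 (+%R 1) (1 : R).
    by have := @is_deriveD R R R (cst 1) id x 1 0 1 _ _; rewrite add0r; apply.
  have d2 : is_derive x 1 (expR \o (+%R 1)) (expR (1 + x) * 1) by exact: is_derive1_comp.
  rewrite mulr1 in d2.
  exact: (@is_deriveB _ _ _ gauss_int (expR \o (+%R 1))).
have [c _] := mean_value d0 (fun x _ => dF x).
rewrite !fctE addr0 => E.
have le0 : (gauss c - expR (1 + c)) * (0 - d) <= 0.
  rewrite mulr_le0_ge0 ?subr_ge0// subr_le0 ler_expR.
  by have := sqr_ge0 (c + 1); rewrite sqrrD expr1n mulr1; lra.
rewrite distrC ger0_norm ?subr_ge0 ?gauss_int_incr//.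
by have := expR_gt0 (1 + d); lra.
Qed.

Let gsup := sup (range gauss_int).
Let ginf := inf (range gauss_int).

Let gauss_has_sup : has_sup (range gauss_int).
Proof.
split; first by exists (gauss_int 0), 0.
exists (gauss_int 0 + expR 1) => _ [d _ <-].
by have := gauss_int_bounded d; rewrite ler_norml; lra.
Qed.

Let gauss_has_inf : has_inf (range gauss_int).
Proof.
split; first by exists (gauss_int 0), 0.
exists (gauss_int 0 - expR 1) => _ [d _ <-].
by have := gauss_int_bounded d; rewrite ler_norml; lra.
Qed.

Let gauss_le_sup d : gauss_int d <= gsup.
Proof. by apply: sup_upper_bound; [exact: gauss_has_sup|exists d]. Qed.

Let gauss_ge_inf d : ginf <= gauss_int d.
Proof. by apply: ge_inf; [case: gauss_has_inf|exists d]. Qed.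

Let gmass_gt0 : 0 < gsup - ginf.
Proof.
have [c _] := mean_value ler01 (fun x _ => gauss_int_derive x).
rewrite subr0 mulr1 => E; have := gauss_gt0 c; have := gauss_le_sup 1; have := gauss_ge_inf 0.
lra.
Qed.

(** Normalising by the oscillation of the primitive gives [ncdf] the limits 0 and 1 by construction,
    whatever the value of the Gaussian integral. This constant is also the maximum of the
    density. *)
Definition npeak : R := (gsup - ginf)^-1.
Definition npdf d := npeak * gauss d.
Definition ncdf d := npeak * (gauss_int d - ginf).

Lemma npeak_gt0 : 0 < npeak. Proof. by rewrite invr_gt0. Qed.

Lemma npdf_ge0 d : 0 <= npdf d.
Proof. by rewrite mulr_ge0 ?ltW ?npeak_gt0// gauss_gt0. Qed.

Lemma npdf_le d : npdf d <= npeak.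
Proof. by rewrite ler_piMr ?gauss_le1// ltW// npeak_gt0. Qed.

Lemma npdf_continuous : continuous npdf.
Proof. by move=> d; apply: cvgM; [exact: cvg_cst|exact: gauss_continuous]. Qed.

Lemma ncdf_derive d : is_derive d 1 ncdf (npdf d).
Proof.
have := gauss_int_derive d => dg.
have d1 : is_derive d 1 (gauss_int - cst ginf) (gauss d).
  by have := is_deriveB dg (is_derive_cst ginf d 1); rewrite subr0.
exact: (@is_deriveZ _ _ _ (gauss_int - cst ginf)).
Qed.

Lemma ncdf_ge0 d : 0 <= ncdf d.
Proof. by rewrite mulr_ge0 ?subr_ge0 ?gauss_ge_inf// ltW// npeak_gt0. Qed.

Lemma ncdf_le1 d : ncdf d <= 1.
Proof. by rewrite /ncdf ler_pdivrMl// mulr1 lerD2r gauss_le_sup. Qed.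

Lemma ncdf_incr d e : d <= e -> ncdf d <= ncdf e.
Proof. by move=> de; rewrite ler_wpM2l ?lerD2r ?gauss_int_incr// ltW// npeak_gt0. Qed.

Lemma ncdf_Ny e : 0 < e -> exists d, ncdf d <= e.
Proof.
move=> e0.
have [_ [d _ <-] dlt] := inf_adherent (mulr_gt0 e0 gmass_gt0) gauss_has_inf.
exists d; rewrite /ncdf ler_pdivrMl// mulrC.
by move: dlt; rewrite -/ginf; lra.
Qed.

Lemma ncdf_y e : 0 < e -> exists d, 1 - e <= ncdf d.
Proof.
move=> e0.
have [_ [d _ <-] dlt] := sup_adherent (mulr_gt0 e0 gmass_gt0) gauss_has_sup.
exists d; rewrite /ncdf ler_pdivlMl//.
by move: dlt; rewrite -/gsup; lra.
Qed.

Lemma ncdf_lipschitz d e : d <= e -> ncdf e - ncdf d <= npeak * (e - d).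
Proof.
move=> de; have [c _ ->] := mean_value de (fun x _ => ncdf_derive x).
by rewrite ler_wpM2r ?subr_ge0// npdf_le.
Qed.

Lemma npdfD d w : npdf (d + w) = expR (- (d * w + w ^+ 2 / 2)) * npdf d.
Proof.
by rewrite /npdf mulrCA /gauss -expRD; congr (_ * expR _); field.
Qed.

(* After multiplication by [expR (d * w + w ^+ 2 / 2)], the difference of the two
   sides has a nonnegative derivative in [d], by [npdfD], and it vanishes at
   minus infinity. *)
Lemma ncdf_shift_ge d w : 0 <= w -> expR (- (d * w + w ^+ 2 / 2)) * ncdf d <= ncdf (d + w).
Proof.
move=> w0; pose E x := expR (x * w + w ^+ 2 / 2).
rewrite expRN mulrC ler_pdivrMr ?expR_gt0// mulrC -/(E d).
have dq x : is_derive x 1 (fun z => E z * ncdf (z + w) - ncdf z) (w * E x * ncdf (x + w)).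
  have dl : is_derive x 1 (fun z => z * w + w ^+ 2 / 2) w.
    have -> : (fun z => z * w + w ^+ 2 / 2) = (fun z => w * z + w ^+ 2 / 2).
      by apply/funext => z; rewrite mulrC.
    exact: is_derive_affine.
  have dE : is_derive x 1 E (E x * w) by exact: (is_derive1_comp (f := expR)).
  have dsh : is_derive x 1 (+%R^~ w) (1 : R).
    by have := is_deriveD (is_derive_id x 1) (is_derive_cst w x 1); rewrite addr0.
  have := ncdf_derive (x + w) => dn.
  have dnw : is_derive x 1 (ncdf \o +%R^~ w) (npdf (x + w) * 1) by exact: is_derive1_comp.
  have := ncdf_derive x => dn'.
  have -> : w * E x * ncdf (x + w) =
      E x *: (npdf (x + w) * 1) + ncdf (x + w) *: (E x * w) - npdf x.
    have -> : npdf x = E x * npdf (x + w) by rewrite npdfD mulrA /E -expRD subrr expR0 mul1r.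
    rewrite /GRing.scale /=; ring.
  exact: (is_deriveB (is_deriveM dE dnw) dn').
rewrite -subr_ge0 -oppr_le0; apply/ler_addgt0Pr => e e0; rewrite add0r.
have [d' nd'] := ncdf_Ny e0; pose x := Num.min d d'.
have xd : x <= d by rewrite ge_min lexx.
have [c _ q] := mean_value xd (fun x _ => dq x).
have c0 : 0 <= w * E c * ncdf (c + w) * (d - x).
  apply: mulr_ge0; last by rewrite subr_ge0.
  by apply: mulr_ge0; [apply: mulr_ge0; [|exact: expR_ge0]|exact: ncdf_ge0].
have xd' : ncdf x <= ncdf d' by apply: ncdf_incr; rewrite ge_min lexx orbT.
have : 0 <= E x * ncdf (x + w) by apply: mulr_ge0; [exact: expR_ge0|exact: ncdf_ge0].
by move: c0; rewrite -q /=; lra.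
Qed.

End NormalCdf.

Section DerivativeAlongLines.
Context {R : realType}.

Lemma is_derive_translate (f : R -> R) (d h : R) :
  is_derive (0 : R) 1 (fun s => f (h + s)) d -> is_derive h 1 f d.
Proof.
move=> df.
have ds : is_derive h 1 (fun s : R => 1 * s + - h) (1 : R) by exact: is_derive_affine.
have df' : is_derive (1 * h + - h : R) (1 : R) (fun s : R => f (h + s)) d by rewrite mul1r subrr.
have := is_derive1_comp (g := fun s => 1 * s + - h) df' ds; rewrite mulr1.
rewrite (_ : (fun s => f (h + s)) \o _ = f)//.
by apply/funext => s /=; rewrite mul1r addrC subrK.
Qed.

Lemma is_derive_line {Z : normedModType R} (g : Z -> R) (l : R) (z e : Z) (h : R) :
  is_derive (0 : R) 1 (fun s => g (z + h *: e + s *: e)) l ->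
  is_derive h 1 (fun s => g (z + s *: e)) l.
Proof.
move=> dg; apply: is_derive_translate.
rewrite (_ : (fun s => _) = (fun s => g (z + h *: e + s *: e)))//.
by apply/funext => s; rewrite scalerDl addrA.
Qed.

(** The mean value theorem on the segment from the moving base point expresses the quotient as a
    value of [l] at a nearby point. *)
Lemma first_order_line {Z : normedModType R} (g l : Z -> R) (z0 e : Z) :
  (\forall z \near z0, is_derive (0 : R) 1 (fun s => g (z + s *: e)) (l z)) ->
  {for z0, continuous l} ->
  first_order (fun z h => g (z + h *: e) - g z) (l z0) z0.
Proof.
move=> dg cl; apply/cvgrPdist_le => /= d d0.
have /cvgrPdist_le/(_ _ d0) ld := cl.
have [r /= r0 rP] := (nbhs_normP _ _).1 (filterI dg ld).
have r2 : 0 < r / 2 by rewrite divr_gt0.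
have e1 : 0 < `|e| + 1 by rewrite ltr_wpDl.
near=> p.
have p0 : 0 < p.2 by near: p; exact: fwd_gt0.
have pz : `|z0 - p.1| < r / 2.
  by near: p; apply: (@fwd_fst _ _ z0 [set z | `|z0 - z| < r / 2]); apply: (nbhs_normP _ _).2; exists (r / 2).
have pr : p.2 < r / 2 / (`|e| + 1) by near: p; apply: fwd_lt; rewrite divr_gt0.
have near_z s : 0 <= s <= p.2 -> `|z0 - (p.1 + s *: e)| < r.
  move=> /andP[s0 sp]; rewrite opprD addrA (le_lt_trans (ler_normB _ _))// [r]splitr.
  rewrite ltrD// normrZ ger0_norm// (le_lt_trans (_ : _ <= p.2 * (`|e| + 1)))//.
    by rewrite ler_pM// lerDl.
  by rewrite -ltr_pdivlMr.
have dgp s : 0 <= s <= p.2 -> is_derive s 1 (fun s => g (p.1 + s *: e)) (l (p.1 + s *: e)).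
  by move=> /near_z sz; apply: is_derive_line; have [] := rP _ sz.
have [s sp] := mean_value (ltW p0) dgp.
rewrite scale0r addr0 subr0 => ->; rewrite mulrC mulfK ?lt0r_neq0//.
by have [] := rP _ (near_z s sp).
Unshelve. all: by end_near. Qed.

End DerivativeAlongLines.

(** * The call and its derivatives at positive variance *)

Section CallPrice.
Context {R : realType}.
Variable lk : R.
Implicit Types (x v p q : R).

(* Normalised Black-Scholes call: [s * call (ln s) v] is the price of a call of
   strike [expR lk] on a lognormal spot [s] of total variance [v], with zero
   interest rate; [call] has partial derivatives [beta] in [x] and [vega / 2]
   in [v]. *)
Definition dminus x v : R := (x - lk - v / 2) / Num.sqrt v.
Definition dplus x v : R := dminus x v + Num.sqrt v.
Definition beta x v : R := expR (lk - x) * ncdf (dminus x v).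
Definition vega x v : R := npdf (dplus x v) / Num.sqrt v.
Definition payoff x : R := Num.max (1 - expR (lk - x)) 0.
Definition call x v : R := if 0 < v then ncdf (dplus x v) - beta x v else payoff x.

Lemma dminusE x v : 0 < v ->
  lk - x = - (dminus x v * Num.sqrt v + Num.sqrt v ^+ 2 / 2).
Proof.
move=> v0; rewrite /dminus divfK ?gt_eqF ?sqrtr_gt0// sqr_sqrtr ?ltW//.
by ring.
Qed.

(** The classical identity S n(d+) = K n(d-) in normalised form. Owing to it, the derivatives of
    [dminus] cancel in [call_line_derive]. *)
Lemma npdf_dplus x v : 0 < v -> npdf (dplus x v) = expR (lk - x) * npdf (dminus x v).
Proof. by move=> v0; rewrite npdfD -dminusE. Qed.

(** By [dminusE] the exponential in [beta] is the factor of [ncdf_shift_ge] for the shift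
    [Num.sqrt v]. The upper bound expresses that the call is nonnegative. *)
Lemma beta_bounds x v : 0 < v -> 0 <= beta x v <= ncdf (dplus x v).
Proof.
move=> v0; rewrite mulr_ge0 ?expR_ge0 ?ncdf_ge0//=.
by rewrite /beta (dminusE x v0) ncdf_shift_ge// sqrtr_ge0.
Qed.

Lemma call_bounds x v : 0 <= call x v <= 1.
Proof.
rewrite /call; case: ifPn => [v0|_].
  have /andP[b0 bn] := beta_bounds x v0.
  by have := ncdf_le1 (dplus x v); move: b0 bn; lra.
rewrite /payoff le_max lexx orbT ge_max ler01 andbT.
by have := expR_gt0 (lk - x); lra.
Qed.

Lemma vega_ge0 x v : 0 <= vega x v.
Proof. by rewrite mulr_ge0 ?npdf_ge0// invr_ge0 sqrtr_ge0. Qed.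

Lemma vega_le x v c : 0 < c -> c <= v -> vega x v <= npeak / Num.sqrt c.
Proof.
move=> c0 cv; rewrite ler_pM ?npdf_ge0 ?invr_ge0 ?sqrtr_ge0 ?npdf_le//.
by rewrite lef_pV2 ?posrE ?sqrtr_gt0 ?(lt_le_trans c0 cv)// ler_wsqrtr.
Qed.

Lemma sqrt_line_derive v q : 0 < v ->
  is_derive (0 : R) 1 (fun h => Num.sqrt (v + h * q)) ((2 * Num.sqrt v)^-1 * q).
Proof.
move=> v0.
have dv : is_derive (0 : R) 1 (fun h => q * h + v) q by exact: is_derive_affine.
have ds : is_derive (q * 0 + v) 1 Num.sqrt (2 * Num.sqrt v)^-1.
  by rewrite mulr0 add0r; exact: is_derive1_sqrt.
have := is_derive1_comp (g := fun h => q * h + v) ds dv; rewrite (_ : Num.sqrt \o _ = (fun h => Num.sqrt (v + h * q)))//.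
by apply/funext => h /=; rewrite addrC mulrC.
Qed.

Lemma dminus_line_derive x v p q : 0 < v ->
  is_derive (0 : R) 1 (fun h => dminus (x + h * p) (v + h * q))
   ((p - q / 2) / Num.sqrt v - (x - lk - v / 2) * ((2 * Num.sqrt v)^-1 * q) / v).
Proof.
move=> v0; have s0 : Num.sqrt v != 0 by rewrite gt_eqF// sqrtr_gt0.
have dw := sqrt_line_derive q v0.
have w0 : Num.sqrt (v + 0 * q) != 0 by rewrite mul0r addr0.
have dV := is_deriveV (f := fun h => Num.sqrt (v + h * q)) w0 dw.
have dA : is_derive (0 : R) 1 (fun h => (p - q / 2) * h + (x - lk - v / 2)) (p - q / 2).
  exact: is_derive_affine.
have := is_deriveM dA dV.
rewrite (_ : _ * _ = (fun h => dminus (x + h * p) (v + h * q))); last first.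
  by apply/funext => h; rewrite /dminus fctE /=; congr (_ / _); field.
move=> H; apply: (is_derive_eq H).
rewrite /GRing.scale /= mul0r addr0 mulr0 add0r sqr_sqrtr ?ltW//.
ring.
Qed.

Lemma beta_line_derive x v p q : 0 < v ->
  is_derive (0 : R) 1 (fun h => beta (x + h * p) (v + h * q))
   (npdf (dplus x v) *
     ((p - q / 2) / Num.sqrt v - (x - lk - v / 2) * ((2 * Num.sqrt v)^-1 * q) / v)
    - p * beta x v).
Proof.
move=> v0; have dd := dminus_line_derive x p q v0.
have dE : is_derive (0 : R) 1 (expR \o (fun h => - p * h + (lk - x))) (expR (lk - x) * - p).
  have da : is_derive (0 : R) 1 (fun h => - p * h + (lk - x)) (- p) by exact: is_derive_affine.
  have de : is_derive (- p * 0 + (lk - x)) 1 expR (expR (lk - x)).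
    by rewrite mulr0 add0r; exact: is_derive_expR.
  exact: (is_derive1_comp (g := fun h => - p * h + (lk - x)) de da).
have dn : is_derive (dminus (x + 0 * p) (v + 0 * q)) 1 ncdf (npdf (dminus x v)).
  by rewrite !mul0r !addr0; exact: ncdf_derive.
have := is_deriveM dE (is_derive1_comp (g := fun h => dminus (x + h * p) (v + h * q)) dn dd).
rewrite (_ : _ * _ = (fun h => beta (x + h * p) (v + h * q))); last first.
  by apply/funext => h; rewrite /beta fctE /=; congr (expR _ * _); ring.
move=> H; apply: (is_derive_eq H).
rewrite /GRing.scale /= !mul0r !addr0 mulr0 add0r npdf_dplus// /beta.
ring.
Qed.

Lemma call_line_derive x v p q : 0 < v ->
  is_derive (0 : R) 1 (fun h => call (x + h * p) (v + h * q))
    (p * beta x v + q * (vega x v / 2)).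
Proof.
move=> v0; have s0 : Num.sqrt v != 0 by rewrite gt_eqF// sqrtr_gt0.
have dd := is_deriveD (dminus_line_derive x p q v0) (sqrt_line_derive q v0).
have dn : is_derive (dplus (x + 0 * p) (v + 0 * q)) 1 ncdf (npdf (dplus x v)).
  by rewrite !mul0r !addr0; exact: ncdf_derive.
have db := beta_line_derive x p q v0.
have dc := is_deriveB (is_derive1_comp
  (g := (fun h => dminus (x + h * p) (v + h * q)) + (fun h => Num.sqrt (v + h * q))) dn dd) db.
have near0 : \forall h \near (0 : R), 0 < v + h * q.
  have : v + h * q @[h --> (0 : R)] --> v + 0 * q.
    by apply: cvgD; [exact: cvg_cst|apply: cvgM; [exact: cvg_id|exact: cvg_cst]].
  by rewrite mul0r addr0 => /cvgr_gt; apply.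
apply: (near_eq_is_derive (f := (ncdf \o (fun h => dplus (x + h * p) (v + h * q))) -
   (fun h => beta (x + h * p) (v + h * q)))).
  by near=> h; rewrite /call ifT//; near: h.
apply: (is_derive_eq dc).
rewrite /vega; field.
by rewrite s0 gt_eqF.
Unshelve. all: by end_near. Qed.

End CallPrice.

(** * Smoothness of the call and its continuity at zero variance *)

Section CallRegularity.
Context {R : realType}.
Variable lk : R.
Local Notation beta := (beta lk).
Local Notation vega := (vega lk).
Local Notation call := (call lk).
Local Notation payoff := (payoff lk).
Implicit Types (x v p q c : R) (z : R * R).

Lemma continuousV_fun {T : topologicalType} (f : T -> R) :
  (forall u, f u != 0) -> continuous f -> continuous (fun u => (f u)^-1).
Proof. by move=> f0 cf u; apply: cvgV; [exact: f0|exact: cf]. Qed.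

Lemma continuous_sqrt_fun {T : topologicalType} (f : T -> R) :
  continuous f -> continuous (fun u => Num.sqrt (f u)).
Proof. exact: continuous_comp_fun (@sqrt_continuous R). Qed.

Lemma sqrt_cutoff_neq0 c v : 0 < c -> Num.sqrt (Num.max c v) != 0.
Proof. by move=> c0; rewrite gt_eqF// sqrtr_gt0 lt_max c0. Qed.

Lemma dminus_cutoff_continuous c : 0 < c ->
  continuous (fun z => dminus lk z.1 (Num.max c z.2)).
Proof.
move=> c0; rewrite /dminus; cont; apply: continuousV_fun => [z|].
  exact: sqrt_cutoff_neq0.
by apply: continuous_sqrt_fun; cont.
Qed.

Lemma beta_cutoff_continuous c : 0 < c -> continuous (fun z => beta z.1 (Num.max c z.2)).
Proof.
move=> c0; rewrite /beta; cont.
apply: (@continuous_comp_fun _ _ _ ncdf (fun z => dminus lk z.1 (Num.max c z.2))).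
  by move=> d; exact: is_derive_continuous (ncdf_derive d).
exact: dminus_cutoff_continuous.
Qed.

Lemma vega_cutoff_continuous c : 0 < c -> continuous (fun z => vega z.1 (Num.max c z.2)).
Proof.
move=> c0; rewrite /vega; cont.
  apply: (@continuous_comp_fun _ _ _ npdf (fun z => dplus lk z.1 (Num.max c z.2))).
    exact: npdf_continuous.
  rewrite /dplus; cont; first exact: dminus_cutoff_continuous.
  by apply: continuous_sqrt_fun; cont.
apply: continuousV_fun => [z|]; first exact: sqrt_cutoff_neq0.
by apply: continuous_sqrt_fun; cont.
Qed.

Lemma near_gt_snd z0 c : c < z0.2 -> \forall z \near z0, c < z.2.
Proof.
move=> cz; have cs : snd z @[z --> z0] --> z0.2 by exact: cvg_snd.
by move/cvgr_gt : cs; apply.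
Qed.

Lemma call_first_order z0 (e : R * R) c : 0 < c -> c < z0.2 ->
  first_order (fun z h => call (z + h *: e).1 (z + h *: e).2 - call z.1 z.2)
    (e.1 * beta z0.1 (Num.max c z0.2) + e.2 * (vega z0.1 (Num.max c z0.2) / 2)) z0.
Proof.
move=> c0 cz.
apply: (@first_order_line _ _ (fun z => call z.1 z.2) (fun z =>
  e.1 * beta z.1 (Num.max c z.2) + e.2 * (vega z.1 (Num.max c z.2) / 2))).
  near=> z; have cz2 : c < z.2 by near: z; exact: near_gt_snd.
  rewrite (max_idPr (ltW cz2)).
  exact: (call_line_derive lk z.1 e.1 e.2 (lt_trans c0 cz2)).
have cc : continuous (fun z => e.1 * beta z.1 (Num.max c z.2) + e.2 * (vega z.1 (Num.max c z.2) / 2)).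
  by cont; [exact: beta_cutoff_continuous|exact: vega_cutoff_continuous].
exact: cc.
Unshelve. all: by end_near. Qed.

Lemma beta_first_order z0 c : 0 < c -> c < z0.2 ->
  first_order (fun z h => beta (z + h *: (1, 0)).1 (Num.max c (z + h *: (1, 0)).2)
      - beta z.1 (Num.max c z.2))
    (vega z0.1 (Num.max c z0.2) - beta z0.1 (Num.max c z0.2)) z0.
Proof.
move=> c0 cz.
apply: (@first_order_line _ _ (fun z => beta z.1 (Num.max c z.2)) (fun z =>
  vega z.1 (Num.max c z.2) - beta z.1 (Num.max c z.2))).
  near=> z; have cz2 : c < z.2 by near: z; exact: near_gt_snd.
  rewrite (max_idPr (ltW cz2)).
  have := beta_line_derive lk z.1 1 0 (lt_trans c0 cz2).
  rewrite (_ : (fun h => _) = (fun s => beta (z + s *: (1, 0)).1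
    (Num.max c (z + s *: (1, 0)).2))); last first.
    by apply/funext => s /=; rewrite mulr0 scaler0 !addr0 (max_idPr (ltW cz2)).
  move=> H; apply: (is_derive_eq H); rewrite /vega; ring.
have cc : continuous (fun z => vega z.1 (Num.max c z.2) - beta z.1 (Num.max c z.2)).
  by cont; [exact: vega_cutoff_continuous|exact: beta_cutoff_continuous].
exact: cc.
Unshelve. all: by end_near. Qed.

(** The variance derivative [vega / 2] is nonnegative and dominated by the derivative of
    [npeak * Num.sqrt v]. Comparing with this function works because it stays finite at zero
    variance, although both derivatives may blow up there. *)
Lemma call_increment x v' v : 0 < v' -> v' <= v ->
  0 <= call x v - call x v' <= npeak * (Num.sqrt v - Num.sqrt v').
Proof.
move=> v'0 v'v; have vv : 0 <= v - v' by rewrite subr_ge0.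
have dl (g : R -> R) (l : R -> R) : (forall u, 0 < u ->
    is_derive (0 : R) 1 (fun h => g (u + h)) (l u)) ->
    exists2 u, v' <= u <= v & g v - g v' = l u * (v - v').
  move=> dg; have dg' u : v' <= u <= v -> is_derive u 1 g (l u).
    by move=> /andP[v'u _]; apply: is_derive_translate; apply: dg; exact: lt_le_trans v'0 v'u.
  exact: mean_value v'v dg'.
have dcall u : 0 < u -> is_derive (0 : R) 1 (fun h => call x (u + h)) (vega x u / 2).
  move=> u0; have := call_line_derive lk x 0 1 u0.
  rewrite mul0r add0r mul1r.
  by rewrite (_ : (fun h => _) = (fun h => call x (u + h)))//; apply/funext => h; rewrite mulr0 addr0 mulr1.
have dsq u : 0 < u -> is_derive (0 : R) 1
    (fun h => (npeak \*: Num.sqrt - call x) (u + h)) (npeak * (2 * Num.sqrt u)^-1 - vega x u / 2).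
  move=> u0; have d1 := sqrt_line_derive 1 u0.
  rewrite mulr1 (_ : (fun h => _) = (fun h => Num.sqrt (u + h))) in d1; last first.
    by apply/funext => h; rewrite mulr1.
  have d2 := @is_deriveZ _ _ _ _ npeak _ _ _ d1.
  exact: (is_deriveB d2 (dcall u u0)).
have [u uv E] := dl _ _ dcall; have [w wv] := dl _ _ dsq.
rewrite !fctE /GRing.scale /= => Ew.
have c1 : 0 <= call x v - call x v'.
  by rewrite E mulr_ge0// divr_ge0 ?vega_ge0.
have w0 : 0 < Num.sqrt w by rewrite sqrtr_gt0 (lt_le_trans v'0)//; case/andP: wv.
have : 0 <= (npeak * (2 * Num.sqrt w)^-1 - vega x w / 2) * (v - v').
  apply: mulr_ge0 => //.
  have -> : npeak * (2 * Num.sqrt w)^-1 - vega x w / 2 =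
      (npeak - npdf (dplus lk x w)) / (2 * Num.sqrt w).
    by rewrite /vega; field; rewrite gt_eqF.
  by rewrite divr_ge0 ?subr_ge0 ?npdf_le// mulr_ge0// ltW.
by rewrite -Ew c1 /= mulrBr /GRing.scale /=; lra.
Qed.

Lemma call_limit x v (e : R) : 0 < v -> 0 < e ->
  exists2 v', 0 < v' <= v & `|call x v' - payoff x| <= e.
Proof.
move=> v0 e0; have e2 : 0 < e / 2 by rewrite divr_gt0.
pose y := 1 - expR (lk - x).
(* The variance is [w ^+ 2]. Once [w] is small against [|x - lk|], [dminus] lies beyond the level
   [A] on the side given by the sign of [x - lk], so [ncdf] there is close to 1 or 0 as required. At
   the strike [y] is 0 and any level does. *)
have [A AP] : exists A : R, forall w : R, 0 < w -> w <= 1 -> w * (`|A| + 1) <= `|x - lk| ->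
    `|ncdf (dminus lk x (w ^+ 2)) * y - Num.max y 0| <= e / 2.
  have dm (w A : R) : 0 < w -> w <= 1 -> w * (`|A| + 1) <= `|x - lk| ->
      (lk <= x -> A <= dminus lk x (w ^+ 2)) /\ (x <= lk -> dminus lk x (w ^+ 2) <= A).
    move=> w0 w1 wA; rewrite /dminus sqrtr_sqr gtr0_norm//.
    have A1 := ler_norm A; have A2 := ler_norm (- A); rewrite normrN in A2.
    have wA1 : w * A <= w * `|A| by rewrite ler_wpM2l// ltW.
    have wA2 : w * - A <= w * `|A| by rewrite ler_wpM2l// ltW.
    have ww : w ^+ 2 <= w by rewrite expr2 ler_piMr// ltW.
    have w20 : 0 <= w ^+ 2 by rewrite exprn_ge0// ltW.
    split=> xlk.
      have xl : `|x - lk| = x - lk by rewrite ger0_norm// subr_ge0.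
      by rewrite ler_pdivlMr// [A * w]mulrC; move: wA; rewrite xl mulrDr mulr1; lra.
    have xl : `|x - lk| = - (x - lk) by rewrite ler0_norm// subr_le0.
    by rewrite ler_pdivrMr// [A * w]mulrC; move: wA wA2; rewrite xl mulrDr mulr1 mulrN; lra.
  have [xlk|lkx|xlk] := ltgtP x lk.
  - have y0 : y < 0 by rewrite subr_lt0 -expR0 ltr_expR; lra.
    have ny : 0 < e / 2 / - y by rewrite divr_gt0// oppr_gt0.
    have [A An] := ncdf_Ny ny; exists A => w w0 w1 wA.
    have [_ /(_ (ltW xlk)) dA] := dm w A w0 w1 wA.
    rewrite (max_idPr (ltW y0)) subr0 normrM (ger0_norm (ncdf_ge0 _)) (ltr0_norm y0).
    rewrite -ler_pdivlMr ?oppr_gt0//.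
    exact: le_trans (ncdf_incr dA) An.
  - have y0 : 0 < y by rewrite subr_gt0 -expR0 ltr_expR; lra.
    have y1 : y <= 1 by rewrite /y; have := expR_gt0 (lk - x); lra.
    have [A An] := ncdf_y e2; exists A => w w0 w1 wA.
    have [/(_ (ltW lkx)) dA _] := dm w A w0 w1 wA.
    rewrite (max_idPl (ltW y0)) -[X in _ - X]mul1r -mulrBl normrM (gtr0_norm y0).
    rewrite distrC ger0_norm ?subr_ge0 ?ncdf_le1//.
    have := ncdf_incr dA => dA'.
    rewrite (le_trans (ler_piMr _ y1)) ?subr_ge0 ?ncdf_le1//; lra.
  - exists 0 => w _ _ _; have -> : y = 0 by rewrite /y xlk subrr expR0 subrr.
    by rewrite mulr0 maxxx subr0 normr0 ltW.
(* The three bounds serve the estimate of [dminus], the constraint [w ^+ 2 <= v], and the difference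
   of [ncdf] at [dplus] and [dminus], which are [w] apart. *)
pose w0 := Num.min 1 (Num.min (Num.sqrt v) (e / 2 / npeak)).
pose w := if x == lk then w0 else Num.min w0 (`|x - lk| / (`|A| + 1)).
have w00 : 0 < w0.
  by rewrite !lt_min ltr01 sqrtr_gt0 v0 divr_gt0 ?npeak_gt0.
have A1 : 0 < `|A| + 1 by rewrite ltr_wpDl.
have wP : 0 < w /\ w <= w0.
  rewrite /w; case: eqVneq => [//|xlk]; split; last by rewrite ge_min lexx.
  by rewrite lt_min w00 divr_gt0// normr_gt0 subr_eq0.
have {wP}[wpos ww0] := wP.
have w1 : w <= 1 by rewrite (le_trans ww0)// ge_min lexx.
have wv : w <= Num.sqrt v by rewrite (le_trans ww0)// !ge_min lexx orbT.
have we : npeak * w <= e / 2.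
  rewrite mulrC -ler_pdivlMr ?npeak_gt0// (le_trans ww0)//.
  by rewrite !ge_min lexx !orbT.
have w20 : 0 < w ^+ 2 by rewrite exprn_gt0.
exists (w ^+ 2).
  by rewrite w20 /= -[leRHS]sqr_sqrtr ?ler_sqr ?nnegrE ?sqrtr_ge0// ltW.
have nc : `|ncdf (dminus lk x (w ^+ 2)) * y - Num.max y 0| <= e / 2.
  have [xlk|xlk] := eqVneq x lk.
    have -> : y = 0 by rewrite /y xlk subrr expR0 subrr.
    by rewrite mulr0 maxxx subr0 normr0 ltW.
  apply: AP => //; rewrite -ler_pdivlMr// /w (negbTE xlk) ge_min lexx orbT//.
have nd : `|ncdf (dplus lk x (w ^+ 2)) - ncdf (dminus lk x (w ^+ 2))| <= e / 2.
  have dd : dminus lk x (w ^+ 2) <= dplus lk x (w ^+ 2) by rewrite lerDl sqrtr_ge0.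
  rewrite ger0_norm ?subr_ge0 ?ncdf_incr//.
  rewrite (le_trans (ncdf_lipschitz dd))// /dplus addrC addKr sqrtr_sqr gtr0_norm//.
rewrite /call w20 /beta /payoff -/y.
rewrite (_ : _ - _ - _ = (ncdf (dplus lk x (w ^+ 2)) - ncdf (dminus lk x (w ^+ 2))) +
   (ncdf (dminus lk x (w ^+ 2)) * y - Num.max y 0)).
  by rewrite [e]splitr (le_trans (ler_normD _ _))// lerD.
rewrite /y; ring.
Qed.

(** The smaller variance of [call_increment] is sent to 0. The bound is uniform in [x], hence gives
    joint continuity at zero variance. *)
Lemma call_payoff x v : `|call x v - payoff x| <= npeak * Num.sqrt v.
Proof.
have [v0|v0] := ltP 0 v; last first.
  by rewrite /call ltNge v0/= subrr normr0 ler0_sqrtr// mulr0.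
apply/ler_addgt0Pr => e e0; have [v' /andP[v'0 v'v] ce] := call_limit x v0 e0.
rewrite (le_trans (ler_distD (call x v') _ _))// lerD//.
have /andP[c0 c1] := call_increment x v'0 v'v.
rewrite ger0_norm// (le_trans c1)// ler_wpM2l ?(ltW npeak_gt0)//.
by rewrite gerBl sqrtr_ge0.
Qed.

Lemma payoff_continuous : continuous payoff.
Proof. by rewrite /payoff; cont. Qed.

Lemma call_continuous : continuous (fun z => call z.1 z.2).
Proof.
move=> z0; have [v0|v0] := ltP 0 z0.2.
  have c0 : 0 < z0.2 / 2 by rewrite divr_gt0.
  have cc : continuous (fun z => ncdf (dplus lk z.1 (Num.max (z0.2 / 2) z.2))
      - beta z.1 (Num.max (z0.2 / 2) z.2)).
    cont; last exact: beta_cutoff_continuous.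
    apply: (@continuous_comp_fun _ _ _ ncdf (fun z => dplus lk z.1 (Num.max (z0.2 / 2) z.2))).
      by move=> d; exact: is_derive_continuous (ncdf_derive d).
    rewrite /dplus; cont; first exact: dminus_cutoff_continuous.
    by apply: continuous_sqrt_fun; cont.
  have E : \forall z \near z0, ncdf (dplus lk z.1 (Num.max (z0.2 / 2) z.2))
      - beta z.1 (Num.max (z0.2 / 2) z.2) = call z.1 z.2.
    near=> z; have cz : z0.2 / 2 < z.2 by near: z; apply: near_gt_snd; lra.
    by rewrite (max_idPr (ltW cz)) /call ifT// (lt_trans c0).
  rewrite /continuous_at -(nbhs_singleton E).
  exact: cvg_trans (near_eq_cvg E) (cc z0).
apply/cvgrPdist_le => /= e e0.
have c0 : call z0.1 z0.2 = payoff z0.1 by rewrite /call ltNge v0.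
have e2 : 0 < e / 2 by rewrite divr_gt0.
have cp : continuous (fun z => payoff z.1).
  by apply: (@continuous_comp_fun _ _ _ payoff (fun z => z.1)); [exact: payoff_continuous|cont].
have cs : continuous (fun z => npeak * Num.sqrt z.2).
  by cont; apply: continuous_sqrt_fun; cont.
have /cvgrPdist_le/(_ _ e2) np := cp z0.
have /cvgrPdist_le/(_ _ e2) ns := cs z0.
near=> z.
have pz : `|payoff z0.1 - payoff z.1| <= e / 2 by near: z.
have sz : npeak * Num.sqrt z.2 <= e / 2.
  have : `|npeak * Num.sqrt z0.2 - npeak * Num.sqrt z.2| <= e / 2 by near: z.
  by rewrite ler0_sqrtr// mulr0 sub0r normrN; apply: le_trans; exact: ler_norm.
rewrite c0 [e]splitr (le_trans (ler_distD (payoff z.1) _ _))// lerD// distrC.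
exact: le_trans (call_payoff _ _) sz.
Unshelve. all: by end_near. Qed.

End CallRegularity.

(** * Existence *)

Section Rates.
Context {R : realType} {k : nat}.
Variables (lam : 'I_k -> 'I_k -> R -> R) (T : R).
Hypothesis T_ge0 : 0 <= T.
Hypothesis lam_gt0 : forall i j : 'I_k, i != j -> forall y : R, 0 <= y -> 0 < lam i j y.
Hypothesis lam_derivable : forall i j : 'I_k, i != j -> derivable_nonneg (lam i j).

Definition clamp (y : R) : R := Num.max 0 (Num.min y T).

Lemma clamp_bounds y : 0 <= clamp y <= T.
Proof. by rewrite /clamp le_max lexx/= ge_max T_ge0 ge_min lexx orbT. Qed.

Lemma clamp_id y : 0 <= y <= T -> clamp y = y.
Proof. by move=> /andP[y0 yT]; rewrite /clamp (min_idPl yT) (max_idPr y0). Qed.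

Lemma clamp_continuous : continuous clamp.
Proof. by rewrite /clamp; cont. Qed.

Lemma derivable_nonneg_continuous (g : R -> R) : derivable_nonneg g ->
  continuous (fun y => g (clamp y)).
Proof.
move=> dg y0; pose y := clamp y0.
have /andP[yge0 _] : 0 <= y <= T by exact: clamp_bounds.
have /cvg_ex[l gl] := dg y yge0.
have gy : g (y + h) - g y @[h --> within [set h | 0 <= y + h] 0^'] --> (0 : R).
  have hl : h * (h^-1 * (g (y + h) - g y)) @[h --> within [set h | 0 <= y + h] 0^'] --> 0 * l.
    apply: cvgM gl; apply: cvg_trans (@cvg_id _ (nbhs (0 : R))).
    by move=> A A0; apply: cvg_within; apply: cvg_within.
  rewrite mul0r in hl; apply: cvg_trans hl; apply: near_eq_cvg.
  rewrite near_withinE; near=> h => _.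
  have h0 : h != 0 by near: h; exact: nbhs_dnbhs_neq.
  by rewrite mulrA divff// mul1r.
apply/cvgrPdist_le => /= e e0.
move/cvgrPdist_le : gy => /(_ _ e0) [d /= d0 gd].
have cy : clamp z @[z --> y0] --> y by exact: clamp_continuous.
near=> z.
have zd : `|y - clamp z| < d.
  by near: z; move/cvgrPdist_lt : cy; apply.
have [->|zy] := eqVneq (clamp z) y; first by rewrite subrr normr0 ltW.
have := gd (clamp z - y); rewrite /= sub0r normrN distrC => /(_ zd).
rewrite subr_eq0 => /(_ zy); rewrite addrC subrK.
case/andP: (clamp_bounds z) => z0 _ /(_ z0).
by rewrite sub0r normrN distrC.
Unshelve. all: by end_near. Qed.

(** Freezing each rate outside [[0, T]] makes it continuous and bounded on the line. The equation
    only has to be recovered for ages between 0 and [T]. *)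
Lemma rates_exist : exists m : jump_rates R k,
  forall i j y, j != i -> 0 <= y <= T -> rate m i j y = lam i j y.
Proof.
pose q i j y := if j == i then 0 else lam i j (clamp y).
have cq i j : continuous (q i j).
  rewrite /q; case: eqVneq => [_|ji]; first exact: cst_continuous.
  by apply/derivable_nonneg_continuous/lam_derivable; rewrite eq_sym.
have q0 i j y : 0 <= q i j y.
  rewrite /q; case: eqVneq => // ji; apply/ltW/lam_gt0; first by rewrite eq_sym.
  by case/andP: (clamp_bounds y).
pose tq i y := \sum_(j | j != i) q i j y.
have ctq i : continuous (tq i) by rewrite /tq; cont; exact: cq.
have tq0 i y : 0 <= tq i y by apply: sumr_ge0 => j _; exact: q0.
have qcl i j y : q i j (clamp y) = q i j y.
  by rewrite /q; case: eqVneq => // _; rewrite clamp_id// clamp_bounds.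
have /choice[M MP] i : exists M, forall y, tq i y <= M.
  have [y yT My] := EVT_max T_ge0 (continuous_subspaceT (ctq i)).
  exists (tq i y) => z; have := My (clamp z); rewrite in_itv /= clamp_bounds => /(_ isT).
  by apply: le_trans; apply: ler_sum => j _; rewrite qcl.
have /choice[P PP] i : exists P, forall y : R, is_derive y 1 P (tq i y).
  by have [P PP] := continuous_primitive (ctq i); exists P.
have bM i y : tq i y <= \sum_i M i.
  rewrite (bigD1 i)//= (le_trans (MP i y))// lerDl.
  by apply: sumr_ge0 => j _; apply: le_trans (tq0 j 0) (MP j 0).
exists (@JumpRates R k q P (\sum_i M i) cq q0 PP bM) => i j y ji yT /=.
by rewrite /q (negbTE ji) clamp_id.
Qed.

End Rates.

Section Region.
Context {R : realType} {k : nat}.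
Variables (r a : 'I_k -> R) (T amin : R).
Hypothesis r_ge0 : forall i, 0 <= r i.
Hypothesis amin_gt0 : 0 < amin.
Hypothesis amin_le : forall i, amin <= a i.
Local Notation c := (fun i => (r i, a i) : R * R).

(* The points reached from a neighbourhood of [(t0, y0, z0)] stay in a compact
   set on which the accumulated variance is bounded below. *)
Lemma reachable_region (t0 y0 : R) (z0 : R * R) (v : R) :
  0 < t0 < T -> v < z0.2 + amin * t0 ->
  exists (Q : R -> R -> R * R -> Prop) (K : set (R * (R * R))) (T' : R),
    [/\ [/\ T' < T, jump_stable c Q, forall t y z, Q t y z -> 0 <= t <= T',
        compact K & forall i t y z, Q t y z -> K (y + t, z + t *: c i)],
      forall u, K u -> v < u.2.2 &
      \forall u \near (t0, y0, z0), Q u.1.1 u.1.2 u.2].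
Proof.
move=> /andP[t00 t0T] vt.
pose rM := \sum_i r i; pose aM := \sum_i a i; pose T' := (t0 + T) / 2.
pose v' := (v + (z0.2 + amin * t0)) / 2.
have a_ge0 i : 0 <= a i by rewrite (le_trans _ (amin_le i))// ltW.
have rMP i : r i <= rM by rewrite /rM (bigD1 i)//= lerDl sumr_ge0.
have aMP i : a i <= aM by rewrite /aM (bigD1 i)//= lerDl sumr_ge0.
pose X1 := z0.1 - 1; pose X2 := z0.1 + rM * t0 + 1; pose C := z0.2 + aM * t0 + 1.
pose Y1 := Num.min 0 (y0 - 1); pose Y2 := Num.max T (y0 + t0 + 1).
(* Velocities lie between 0 and [rM], respectively [amin] and [aM], so along a trajectory the
   quantities bounded below in the last two clauses do not decrease and those bounded above do not
   increase. The 0 in [Y1] and the [T] in [Y2] allow for the reset of the age at a jump, and [v'] is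
   midway between [v] and the least final variance, which leaves room for a neighbourhood. *)
pose Q t (y : R) (z : R * R) := [/\ 0 <= t <= T', Y1 <= y /\ y + t <= Y2,
  X1 <= z.1 /\ z.1 + rM * t <= X2 & v' <= z.2 + amin * t /\ z.2 + aM * t <= C].
pose K : set (R * (R * R)) := `[Y1, Y2] `*` (`[X1, X2] `*` `[v', C]).
exists Q, K, T'; split; first split.
- by rewrite /T'; lra.
- move=> i t y z u [/andP[t0' tT'] [y1 y2] [x1 x2] [v1 v2]] /andP[u0 ut].
  have ut' : 0 <= t - u by rewrite subr_ge0.
  split; rewrite /=.
  + by rewrite ut'/=; lra.
  + split; first by rewrite ge_min lexx.
    by rewrite add0r le_max; apply/orP; left; rewrite /T' in tT'; lra.
  + have := ler_wpM2l u0 (rMP i); have := mulr_ge0 u0 (r_ge0 i).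
    by rewrite /GRing.scale /= mulrBr [rM * u]mulrC; split; lra.
  + have := ler_wpM2l u0 (aMP i); have := ler_wpM2l u0 (amin_le i).
    by rewrite /GRing.scale /= !mulrBr [aM * u]mulrC [amin * u]mulrC; split; lra.
- by move=> t y z [].
- by apply: compact_setX; [|apply: compact_setX]; exact: segment_compact.
- move=> i t y z [/andP[t0' tT'] [y1 y2] [x1 x2] [v1 v2]].
  have := ler_wpM2l t0' (rMP i); have := mulr_ge0 t0' (r_ge0 i).
  have := ler_wpM2l t0' (aMP i); have := ler_wpM2l t0' (amin_le i).
  rewrite [amin * t]mulrC in v1; rewrite [aM * t]mulrC in v2; rewrite [rM * t]mulrC in x2.
  by move=> *; split; [|split]; rewrite /= in_itv /= /GRing.scale /=; apply/andP; split; lra.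
- move=> u [_ [_ /=]]; rewrite in_itv /= => /andP[+ _]; apply: lt_le_trans.
  by rewrite /v'; lra.
have near_lt (f g : R * R * (R * R) -> R) : continuous f -> continuous g ->
    f (t0, y0, z0) < g (t0, y0, z0) -> \forall u \near (t0, y0, z0), f u <= g u.
  move=> cf cg fg.
  have cfg : continuous (fun u => g u - f u) by cont.
  have /cvgr_gt/(_ 0) := cfg (t0, y0, z0); rewrite subr_gt0 => /(_ fg).
  by apply: filterS => u; rewrite subr_gt0 => /ltW.
have rM0 : 0 <= rM by apply: sumr_ge0.
near=> u; split; [|split|split|split].
- apply/andP; split; near: u.
    by apply: (near_lt (cst 0) (fun u => u.1.1)); cont.
  by apply: (near_lt (fun u => u.1.1) (cst T')); cont => //=; rewrite /T'; lra.
- near: u; apply: (near_lt (cst Y1) (fun u => u.1.2)); cont => //=.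
  by rewrite gt_min; apply/orP; right; lra.
- near: u; apply: (near_lt (fun u => u.1.2 + u.1.1) (cst Y2)); cont => //=.
  by rewrite lt_max; apply/orP; right; lra.
- near: u; apply: (near_lt (cst X1) (fun u => u.2.1)); cont => //=.
  by rewrite /X1; lra.
- near: u; apply: (near_lt (fun u => u.2.1 + rM * u.1.1) (cst X2)); cont => //=.
  by rewrite /X2; lra.
- near: u; apply: (near_lt (cst v') (fun u => u.2.2 + amin * u.1.1)); cont => //=.
  by rewrite /v'; lra.
- near: u; apply: (near_lt (fun u => u.2.2 + aM * u.1.1) (cst C)); cont => //=.
  by rewrite /C; lra.
Unshelve. all: by end_near. Qed.

End Region.

(** * Regularity of the averaged call *)

Section CallSolution.
Context {R : realType} {k : nat}.
Variables (m : jump_rates R k) (r a : 'I_k -> R) (T amin lk : R).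
Hypothesis T_gt0 : 0 < T.
Hypothesis r_ge0 : forall i, 0 <= r i.
Hypothesis amin_gt0 : 0 < amin.
Hypothesis amin_le : forall i, amin <= a i.
Local Notation c := (fun i : 'I_k => (r i, a i) : R * R).
Local Notation sol := (solution m c T).
Implicit Types (i j : 'I_k) (t y x v : R) (z e : R * R).

(* [beta] and [vega] are singular at zero variance; they are frozen below the
   variance [v], which is not felt where the variance stays above [v]. *)
Definition callZ z := call lk z.1 z.2.
Definition betaZ v z := beta lk z.1 (Num.max v z.2).
Definition vegaZ v z := vega lk z.1 (Num.max v z.2).

(** The derivative of the call when the start moves by [e] and the time is lengthened by [al]: the
    extra time is spent in the final regime [i] and moves the end point by [al *: c i]. *)
Definition slope v (al : R) e i z :=
  (e + al *: c i).1 * betaZ v z + (e + al *: c i).2 * (vegaZ v z / 2).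

Lemma betaZ_bounds v z : 0 < v -> 0 <= betaZ v z <= 1.
Proof.
move=> v0; have m0 : 0 < Num.max v z.2 by rewrite lt_max v0.
have /andP[b0 bn] := beta_bounds lk z.1 m0.
by rewrite b0 (le_trans bn)// ncdf_le1.
Qed.

Lemma vegaZ_bounds v z : 0 < v -> 0 <= vegaZ v z <= npeak / Num.sqrt v.
Proof. by move=> v0; rewrite vega_ge0 vega_le// le_max lexx. Qed.

Lemma eq_solution F F' Psi : (forall i y z, F i y z = F' i y z) -> sol F Psi -> sol F' Psi.
Proof. by move=> FF; rewrite (_ : F = F')//; do 3 (apply/funext => ?); exact: FF. Qed.

Lemma solution_bounded F (B : R) : data_continuous F -> (forall i y z, `|F i y z| <= B) ->
  exists2 Phi, sol F Phi & forall i t y z, `|Phi i t y z| <= B.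
Proof.
move=> cF FB; have [Phi [cPhi PhiB PhiE]] := solution_exists m c (ltW T_gt0) cF FB.
by exists Phi => //; split=> //; exists B.
Qed.

Lemma slope_continuous v al e i : 0 < v -> continuous (slope v al e i).
Proof.
move=> v0; rewrite /slope /betaZ /vegaZ; cont.
  exact: beta_cutoff_continuous.
exact: vega_cutoff_continuous.
Qed.

Lemma continuous_data (l : 'I_k -> R * R -> R) : (forall i, continuous (l i)) ->
  data_continuous (fun i _ z => l i z).
Proof.
move=> cl i; apply: (@continuous_comp_fun _ _ _ (l i) (fun p : R * (R * R) => p.2)) => //.
by cont.
Qed.

Lemma slope_solution v al e : 0 < v -> exists Psi, sol (fun i _ z => slope v al e i z) Psi.
Proof.
move=> v0; pose b i := `|(e + al *: c i).1| + `|(e + al *: c i).2| * (npeak / Num.sqrt v / 2).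
have b0 i : 0 <= b i.
  apply: addr_ge0 => //; apply: mulr_ge0 => //.
  by rewrite !divr_ge0 ?sqrtr_ge0// ltW// npeak_gt0.
have [||Psi sPsi _] := @solution_bounded (fun i _ z => slope v al e i z) (\sum_i b i).
- by apply: continuous_data => i; exact: slope_continuous.
- move=> i _ z; apply: (@le_trans _ _ (b i)); last first.
    by rewrite (bigD1 i)//= lerDl sumr_ge0.
  have /andP[bz0 bz1] := betaZ_bounds z v0; have /andP[vz0 vz1] := vegaZ_bounds z v0.
  apply: (le_trans (ler_normD _ _)); apply: lerD; rewrite normrM.
    by apply: ler_piMr => //; rewrite (ger0_norm bz0).
  apply: ler_wpM2l => //; rewrite ger0_norm; last by rewrite divr_ge0.
  by rewrite ler_wpM2r// invr_ge0.
- by exists Psi.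
Qed.

Variable Phi : 'I_k -> R -> R -> R * R -> R.
Hypothesis sPhi : sol (fun _ _ z => callZ z) Phi.

Lemma Phi_first_order v al e Psi i t y z :
  0 < v -> 0 <= al -> sol (fun i _ z => slope v al e i z) Psi ->
  0 < t < T -> v < z.2 + amin * t ->
  first_order (fun (u : R * R * (R * R)) h =>
     Phi i (u.1.1 + al * h) u.1.2 (u.2 + h *: e) - Phi i u.1.1 u.1.2 u.2)
    (Psi i t y z) (t, y, z).
Proof.
move=> v0 al0 sPsi tT vz.
have [Q [K [T' [[T'T Qs QT Kc QK] Kv Qn]]]] :=
  @reachable_region R k r a T amin r_ge0 amin_gt0 amin_le t y z v tT vz.
have cl j : continuous (slope v al e j) by exact: slope_continuous.
have cg : continuous callZ by exact: call_continuous.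
have H := directional_derivative T_gt0 al0 T'T cg cl sPhi sPsi Qs QT Kc QK.
apply: (H e _ i t y z Qn) => j u Ku.
by apply: call_first_order => //; exact: Kv.
Qed.

Lemma beta_solution_first_order v X Y i t y z :
  0 < v -> sol (fun _ _ z => betaZ v z) X -> sol (fun _ _ z => vegaZ v z - betaZ v z) Y ->
  0 < t < T -> v < z.2 + amin * t ->
  first_order (fun (u : R * R * (R * R)) h =>
     X i (u.1.1 + 0 * h) u.1.2 (u.2 + h *: (1, 0)) - X i u.1.1 u.1.2 u.2)
    (Y i t y z) (t, y, z).
Proof.
move=> v0 sX sY tT vz.
have [Q [K [T' [[T'T Qs QT Kc QK] Kv Qn]]]] :=
  @reachable_region R k r a T amin r_ge0 amin_gt0 amin_le t y z v tT vz.
have cg : continuous (betaZ v) by exact: beta_cutoff_continuous.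
have cl (j : 'I_k) : continuous (fun z => vegaZ v z - betaZ v z).
  by rewrite /vegaZ; cont; exact: vega_cutoff_continuous.
have H := directional_derivative T_gt0 (lexx 0) T'T cg cl sX sY Qs QT Kc QK.
apply: (H (1, 0) _ i t y z Qn) => j u Ku.
by rewrite scale0r addr0; apply: beta_first_order => //; exact: Kv.
Qed.

(** Every derivative is a combination of solutions with data [betaZ], [vegaZ] and [slope v 1 0],
    which are jointly continuous by construction. Starting with variance 0, the path accumulates at
    least [amin * t], so the freezing level [v] is not reached. *)
Lemma local_derivatives v : 0 < v -> exists X G W : 'I_k -> R -> R -> R * R -> R,
  [/\ jointly_continuous X, jointly_continuous G, jointly_continuous W &
   forall i t y x, 0 < t < T -> v < amin * t ->
   [/\ is_derive t 1 (fun t => Phi i t y (x, 0)) (W i t y (x, 0)),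
       is_derive x 1 (fun x => Phi i t y (x, 0)) (X i t y (x, 0)),
       is_derive x 1 (fun x => X i t y (x, 0)) (G i t y (x, 0) - X i t y (x, 0)) &
       is_derive y 1 (fun y => Phi i t y (x, 0))
         (W i t y (x, 0) - r i * X i t y (x, 0) - a i * (G i t y (x, 0) / 2)
          + tot m i y * Phi i t y (x, 0)
          - \sum_(j | j != i) rate m i j y * Phi j t 0 (x, 0))]].
Proof.
move=> v0.
have [X sX _] : exists2 X, sol (fun _ _ z => betaZ v z) X & forall i t y z, `|X i t y z| <= 1.
  have cF : data_continuous (fun (_ : 'I_k) (_ : R) z => betaZ v z).
    by apply: (continuous_data (l := fun _ => betaZ v)) => i; exact: beta_cutoff_continuous.
  apply: (solution_bounded cF) => i _ z.
  by have /andP[? ?] := betaZ_bounds z v0; rewrite ger0_norm.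
have [G sG _] : exists2 G, sol (fun _ _ z => vegaZ v z) G &
    forall i t y z, `|G i t y z| <= npeak / Num.sqrt v.
  have cF : data_continuous (fun (_ : 'I_k) (_ : R) z => vegaZ v z).
    by apply: (continuous_data (l := fun _ => vegaZ v)) => i; exact: vega_cutoff_continuous.
  apply: (solution_bounded cF) => i _ z.
  by have /andP[? ?] := vegaZ_bounds z v0; rewrite ger0_norm.
have [W sW] := slope_solution 1 0 v0.
have [cX _ _] := sX; have [cG _ _] := sG; have [cW _ _] := sW.
exists X, G, W; split=> // i t y x tT vt.
have vz : v < (x, (0 : R)).2 + amin * t by rewrite add0r.
split.
- have := Phi_first_order (i := i) (y := y) v0 ler01 sW tT vz.
  have cf : continuous (fun s : R => (s, y, (x, 0 : R)) : R * R * (R * R)) by cont.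
  move=> /(first_order_comp (f := fun s : R => (s, y, (x, 0 : R))) (cf t)) H.
  apply: first_order_derive; apply: (eq_first_order _ _ H) => // s h /=.
  by rewrite mul1r scaler0 addr0.
- have sX' : sol (fun i _ z => slope v 0 (1, 0) i z) X.
    apply: eq_solution sX => j _ z.
    by rewrite /slope /= /GRing.scale /= !mul0r !addr0 mul1r mul0r addr0.
  have := Phi_first_order (i := i) (y := y) v0 (lexx 0) sX' tT vz.
  have cf : continuous (fun s : R => (t, y, (s, 0 : R)) : R * R * (R * R)) by cont.
  move=> /(first_order_comp (f := fun s : R => (t, y, (s, 0 : R))) (cf x)) H.
  apply: first_order_derive; apply: (eq_first_order _ _ H) => // s h /=.
  rewrite mul0r addr0.
  by congr (Phi i t y _ - _); congr (_, _); rewrite /= /GRing.scale /= ?mulr1 ?mulr0 ?addr0.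
- have E (j : 'I_k) (_ : R) z : 1 * vegaZ v z + -1 * betaZ v z = vegaZ v z - betaZ v z.
    by rewrite mul1r mulN1r.
  have sY := @eq_solution _ (fun _ _ z => vegaZ v z - betaZ v z) _ E
    (solution_linear 1 (- 1) sG sX).
  have := beta_solution_first_order (i := i) (y := y) v0 sX sY tT vz; rewrite mul1r mulN1r.
  have cf : continuous (fun s : R => (t, y, (s, 0 : R)) : R * R * (R * R)) by cont.
  move=> /(first_order_comp (f := fun s : R => (t, y, (s, 0 : R))) (cf x)) H.
  apply: first_order_derive; apply: (eq_first_order _ _ H) => // s h /=.
  rewrite mul0r addr0.
  by congr (X i t y _ - _); congr (_, _); rewrite /= /GRing.scale /= ?mulr1 ?mulr0 ?addr0.
(* In the direction [- c i] the regime [i] is the starting one, a constant, while [j] is the final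
   one; linearity therefore reduces this solution to [W], [X] and [G]. *)
- have E (j : 'I_k) (_ : R) z :
      1 * (1 * slope v 1 0 j z + - r i * betaZ v z) + - (a i / 2) * vegaZ v z =
      slope v 1 (- c i) j z by rewrite /slope /= /GRing.scale /=; field.
  have sU := @eq_solution _ (fun j _ z => slope v 1 (- c i) j z) _ E
    (solution_linear 1 (- (a i / 2)) (solution_linear 1 (- r i) sW sX) sG).
  have := Phi_first_order (i := i) (y := y) v0 ler01 sU tT vz.
  move=> /(age_derivative tT sPhi).
  have cf : continuous (fun s : R => (t, s, (x, 0 : R)) : R * R * (R * R)) by cont.
  move=> /(first_order_comp (f := fun s : R => (t, s, (x, 0 : R))) (cf y)) H.
  apply: first_order_derive; apply: (eq_first_order _ _ H) => //=.
  by rewrite !mul1r; field.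
Qed.

End CallSolution.

(** * The price as a classical solution *)

Section Existence.
Context {R : realType} {k : nat}.
Variables (T K : R) (r sigma : 'I_k -> R) (lam : 'I_k -> 'I_k -> R -> R).
Variables (m : jump_rates R k) (amin : R) (Phi : 'I_k -> R -> R -> R * R -> R).
Hypothesis T_gt0 : 0 < T.
Hypothesis K_gt0 : 0 < K.
Hypothesis r_ge0 : forall i, 0 <= r i.
Hypothesis amin_gt0 : 0 < amin.
Hypothesis amin_le : forall i, amin <= sigma i ^+ 2.
Hypothesis rateE : forall i j y, j != i -> 0 <= y <= T -> rate m i j y = lam i j y.
Local Notation c := (fun i : 'I_k => (r i, sigma i ^+ 2) : R * R).
Hypothesis sPhi : solution m c T (fun _ _ z => callZ (ln K) z) Phi.
Hypothesis Phi_le1 : forall i t y z, `|Phi i t y z| <= 1.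
Implicit Types (i j : 'I_k) (t s y v : R).

Definition price t s i y := s * Phi i (T - t) y (ln s, 0).

Lemma ln_cutoff_continuous {U : topologicalType} (f : U -> R) (e : R) :
  0 < e -> continuous f -> continuous (fun u => ln (Num.max e (f u))).
Proof.
move=> e0 cf u; have cm : continuous (fun u => Num.max e (f u)) by cont.
have cl : {for Num.max e (f u), continuous (@ln R)} by apply: continuous_ln; rewrite lt_max e0.
exact: (continuous_comp (cm u) cl).
Qed.

(** The logarithm has to be cut off near 0, and the functions giving the derivatives depend on the
    variance level [v]; a globally continuous representative is thus available only near each given
    point. *)
Lemma within_continuous_local {U : topologicalType} (A : set U) (f : U -> R) :
  (forall x, A x -> exists2 g : U -> R, continuous g & \forall u \near x, A u -> f u = g u) ->
  {within A, continuous f}.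
Proof.
move=> H; apply/subspace_continuousP => x Ax; have [g cg fg] := H x Ax.
have fx : f x = g x by exact: (nbhs_singleton fg Ax).
rewrite /from_subspace fx.
have gA : g @ within A (nbhs x) --> g x.
  exact: cvg_trans (cvg_app g (@cvg_within _ (nbhs x) _ A)) (cg x).
apply: cvg_trans gA; apply: near_eq_cvg; rewrite near_withinE.
by apply: filterS fg => u fu /fu ->.
Qed.

Lemma price_derivatives v : 0 < v -> exists X G W : 'I_k -> R -> R -> R * R -> R,
  [/\ jointly_continuous X, jointly_continuous G, jointly_continuous W &
   forall i t s y, 0 < t < T -> 0 < s -> v < amin * (T - t) ->
   let p := Phi i (T - t) y (ln s, 0) in let x := X i (T - t) y (ln s, 0) in
   let g := G i (T - t) y (ln s, 0) in let w := W i (T - t) y (ln s, 0) in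
   [/\ is_derive t 1 (fun t => price t s i y) (- (s * w)),
       is_derive s 1 (fun s => price t s i y) (p + x),
       is_derive s 1 (fun s => d_s price t s i y) (g / s) &
       is_derive y 1 (price t s i)
         (s * (w - r i * x - sigma i ^+ 2 * (g / 2) + tot m i y * p
          - \sum_(j | j != i) rate m i j y * Phi j (T - t) 0 (ln s, 0)))]].
Proof.
move=> v0.
have [X [G [W [cX cG cW H]]]] := local_derivatives (a := fun i => sigma i ^+ 2)
  T_gt0 r_ge0 amin_gt0 amin_le sPhi v0.
exists X, G, W; split=> // i t s y tT s0 vt.
have tT' : 0 < T - t < T by case/andP: tT; lra.
have dln (u : R) : 0 < u -> is_derive u 1 (@ln R) u^-1 by exact: is_derive1_ln.
have dPhi (u : R) : 0 < u -> is_derive u 1 (fun s => Phi i (T - t) y (ln s, 0))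
    (X i (T - t) y (ln u, 0) / u).
  move=> u0; have [_ dx _ _] := H i (T - t) y (ln u) tT' vt.
  exact: (is_derive1_comp (f := fun x => Phi i (T - t) y (x, 0)) dx (dln u u0)).
have dprice (u : R) : 0 < u -> is_derive u 1 (fun s => price t s i y)
    (Phi i (T - t) y (ln u, 0) + X i (T - t) y (ln u, 0)).
  move=> u0; have := is_deriveM (is_derive_id u 1) (dPhi u u0).
  rewrite (_ : id * _ = (fun s => price t s i y))//; move=> D; apply: (is_derive_eq D).
  by rewrite /GRing.scale /= mulr1 addrC mulrCA divff ?mulr1// gt_eqF.
have [dt dx dxx dy] := H i (T - t) y (ln s) tT' vt.
split.
- have da : is_derive t 1 (fun t => -1 * t + T) (-1 : R) by exact: is_derive_affine.
  have dt' : is_derive (-1 * t + T) 1 (fun t => Phi i t y (ln s, 0)) (W i (T - t) y (ln s, 0)).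
    by rewrite mulN1r addrC.
  have D := @is_deriveZ _ _ _ _ s _ _ _ (is_derive1_comp (g := fun t => -1 * t + T) dt' da).
  rewrite (_ : _ \*: _ = (fun t => price t s i y)) in D; last first.
    by apply/funext => u; rewrite /price fctE /= mulN1r [- u + T]addrC.
  by apply: (is_derive_eq D); rewrite mulrN1 scalerN.
- exact: dprice.
(* The two contributions of [X] cancel: this is the proportionality of gamma and vega. *)
- have D : is_derive s 1 (fun s => Phi i (T - t) y (ln s, 0) + X i (T - t) y (ln s, 0))
      (G i (T - t) y (ln s, 0) / s).
    have D := is_deriveD (dPhi s s0)
      (is_derive1_comp (f := fun x => X i (T - t) y (x, 0)) dxx (dln s s0)).
    by apply: (is_derive_eq D); rewrite mulrBl addrCA subrr addr0.
  apply: near_eq_is_derive D; near=> u.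
  have u0 : 0 < u by near: u; exact: lt_nbhsr.
  by rewrite /d_s derive1E; have := dprice u u0 => du; rewrite derive_val.
- have D := @is_deriveZ _ _ _ _ s _ _ _ dy.
  by apply: (is_derive_eq D).
Unshelve. all: by end_near. Qed.

Lemma dom_cutoff t s y : dom T (t, s, y) ->
  exists v, [/\ 0 < v, v < amin * (T - t), 0 < t < T, 0 < s & 0 < y < T].
Proof.
move=> [/= tT s0 yT _]; exists (amin * (T - t) / 2).
have : 0 < amin * (T - t) by rewrite mulr_gt0// subr_gt0; case/andP: tT.
by split=> //; lra.
Qed.

(** The logarithm of the spot is a separate argument of [g], so that it can be replaced near [s0] by
    its continuous cutoff at [s0 / 2]. *)
Lemma price_local (t0 s0 y0 : R) i (f : R -> R -> R -> R) (g : R * R * R -> R -> R) v :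
  dom T (t0, s0, y0) -> v < amin * (T - t0) ->
  (forall e, 0 < e -> continuous (fun x : R * R * R => g x (ln (Num.max e x.1.2)))) ->
  (forall t s y, dom T (t, s, y) -> v < amin * (T - t) -> f t s y = g (t, s, y) (ln s)) ->
  exists2 h : R * R * R -> R, continuous h &
    \forall u \near (t0, s0, y0), dom T u -> f u.1.1 u.1.2 u.2 = h u.
Proof.
move=> [/= tT s00 yT _] vt cg fg; have e0 : 0 < s0 / 2 by rewrite divr_gt0.
exists (fun x => g x (ln (Num.max (s0 / 2) x.1.2))); first exact: cg.
have c1 : continuous (fun u : R * R * R => u.1.2) by cont.
have c2 : continuous (fun u : R * R * R => amin * (T - u.1.1)) by cont.
have /cvgr_gt/(_ (s0 / 2)) /= H1 := c1 (t0, s0, y0).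
have /cvgr_gt/(_ v) /= H2 := c2 (t0, s0, y0).
near=> u => du.
have u1 : s0 / 2 < u.1.2 by near: u; apply: H1; lra.
have u2 : v < amin * (T - u.1.1) by near: u; apply: H2.
by rewrite (fg u.1.1 u.1.2 u.2 du u2) -!surjective_pairing (max_idPr (ltW u1)).
Unshelve. all: by end_near. Qed.

Lemma price_C121 : C121 T price.
Proof.
move=> i; split.
- move=> t s y d; have [v [v0 vt tT s0 yT]] := dom_cutoff d.
  have [X [G [W [_ _ _ H]]]] := price_derivatives v0.
  have [dt ds dss dy] := H i t s y tT s0 vt.
  have D (f : R -> R) (u l : R) : is_derive u 1 f l -> derivable f u 1 by case.
  by split; [exact: D dt|exact: D ds|exact: D dss|exact: D dy].
- apply: within_continuous_local => -[[t s] y] d; have [v [v0 vt _ _ _]] := dom_cutoff d.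
  have [X [G [W [_ _ cW H]]]] := price_derivatives v0.
  apply: (price_local (f := fun t s y => d_t price t s i y)
    (g := fun x l => - (x.1.2 * W i (T - x.1.1) x.2 (l, 0))) i d vt).
    move=> e e0; cont; apply: jointly_continuous_comp => //; cont.
    by apply: ln_cutoff_continuous => //; cont.
  move=> t' s' y' d' vt'; have [_ [_ _ tT s0 _]] := dom_cutoff d'.
  have [dt _ _ _] := H i t' s' y' tT s0 vt'.
  by rewrite /d_t derive1E derive_val.
- apply: within_continuous_local => -[[t s] y] d; have [v [v0 vt _ _ _]] := dom_cutoff d.
  have [X [G [W [cX _ _ H]]]] := price_derivatives v0; have [cPhi _ _] := sPhi.
  apply: (price_local (f := fun t s y => d_s price t s i y)
    (g := fun x l => Phi i (T - x.1.1) x.2 (l, 0) + X i (T - x.1.1) x.2 (l, 0)) i d vt).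
    by move=> e e0; cont; apply: jointly_continuous_comp => //; cont;
      apply: ln_cutoff_continuous => //; cont.
  move=> t' s' y' d' vt'; have [_ [_ _ tT s0 _]] := dom_cutoff d'.
  have [_ ds _ _] := H i t' s' y' tT s0 vt'.
  by rewrite /d_s derive1E derive_val.
- apply: within_continuous_local => -[[t s] y] d; have [v [v0 vt _ _ _]] := dom_cutoff d.
  have [X [G [W [_ cG _ H]]]] := price_derivatives v0.
  apply: (price_local (f := fun t s y => d_ss price t s i y)
    (g := fun x l => G i (T - x.1.1) x.2 (l, 0) * expR (- l)) i d vt).
    move=> e e0; cont; last by apply: ln_cutoff_continuous => //; cont.
    apply: jointly_continuous_comp => //; cont.
    by apply: ln_cutoff_continuous => //; cont.
  move=> t' s' y' d' vt'; have [_ [_ _ tT s0 _]] := dom_cutoff d'.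
  have [_ _ dss _] := H i t' s' y' tT s0 vt'.
  by rewrite /d_ss /= derive1E derive_val expRN lnK.
- apply: within_continuous_local => -[[t s] y] d; have [v [v0 vt _ _ _]] := dom_cutoff d.
  have [X [G [W [cX cG cW H]]]] := price_derivatives v0; have [cPhi _ _] := sPhi.
  apply: (price_local (f := fun t s y => d_y price t s i y)
    (g := fun x l => x.1.2 * (W i (T - x.1.1) x.2 (l, 0) - r i * X i (T - x.1.1) x.2 (l, 0)
       - sigma i ^+ 2 * (G i (T - x.1.1) x.2 (l, 0) / 2)
       + tot m i x.2 * Phi i (T - x.1.1) x.2 (l, 0)
       - \sum_(j | j != i) rate m i j x.2 * Phi j (T - x.1.1) 0 (l, 0))) i d vt).
    move=> e e0; cont; try (by apply: jointly_continuous_comp => //; cont;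
      apply: ln_cutoff_continuous => //; cont).
      by apply: (@continuous_comp_fun _ _ _ (tot m i)); [exact: tot_continuous|cont].
    by apply: (@continuous_comp_fun _ _ _ (rate m i _)); [exact: rate_continuous|cont].
  move=> t' s' y' d' vt'; have [_ [_ _ tT s0 _]] := dom_cutoff d'.
  have [_ _ _ dy] := H i t' s' y' tT s0 vt'.
  by rewrite /d_y derive1E derive_val.
Qed.

Lemma price_pde : satisfies_pde T r sigma lam price.
Proof.
move=> t s i y d; have [v [v0 vt tT s0 yT]] := dom_cutoff d.
have [X [G [W [_ _ _ H]]]] := price_derivatives v0.
have [dt ds dss dy] := H i t s y tT s0 vt.
have -> : d_t price t s i y = - (s * W i (T - t) y (ln s, 0)).
  by rewrite /d_t derive1E derive_val.
have -> : d_s price t s i y = Phi i (T - t) y (ln s, 0) + X i (T - t) y (ln s, 0).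
  by rewrite /d_s derive1E derive_val.
have -> : d_ss price t s i y = G i (T - t) y (ln s, 0) / s.
  by rewrite /d_ss /= derive1E derive_val.
rewrite /d_y derive1E derive_val.
have yT' : 0 <= y <= T by case/andP: yT => /ltW -> /ltW.
have -> : \sum_(j | j != i) lam i j y * (price t s j 0 - price t s i y) =
    s * (\sum_(j | j != i) rate m i j y * Phi j (T - t) 0 (ln s, 0)) -
    tot m i y * (s * Phi i (T - t) y (ln s, 0)).
  rewrite /tot mulr_sumr mulr_suml -sumrB; apply: eq_bigr => j ji.
  by rewrite rateE// /price; ring.
(* The age derivative already carries the jump terms: [W], [X], [G] and the sums cancel, leaving
   [r i] times the price. *)
by rewrite /price; field; rewrite gt_eqF.
Qed.

Lemma price_classical : classical_solution T K r sigma lam price.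
Proof.
have [cPhi _ _] := sPhi; split.
- move=> i; apply: within_continuous_local => -[[t s] y] [/= tT s0 yt].
  have e0 : 0 < s / 2 by rewrite divr_gt0.
  exists (fun x => x.1.2 * Phi i (T - x.1.1) x.2 (ln (Num.max (s / 2) x.1.2), 0)).
    cont; apply: jointly_continuous_comp => //; cont.
    by apply: ln_cutoff_continuous => //; cont.
  have c1 : continuous (fun u : R * R * R => u.1.2) by cont.
  have /cvgr_gt/(_ (s / 2)) /= H1 := c1 (t, s, y).
  near=> u => _; rewrite /slice /price (_ : Num.max _ _ = u.1.2)//.
  by apply/max_idPr/ltW; near: u; apply: H1; lra.
- exact: price_C121.
- exact: price_pde.
- move=> t i y _ _.
  have s0 : s @[s --> (0 : R)^'+] --> (0 : R) by exact: cvg_within.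
  apply/cvgrPdist_le => e e0; near=> s.
  have sp : 0 < s by near: s; exact: nbhs_right_gt.
  rewrite sub0r normrN /price normrM gtr0_norm// (le_trans (ler_piMr (ltW sp) (Phi_le1 _ _ _ _)))//.
  by near: s; exact: nbhs_right_le.
- move=> s i y s0 _; rewrite /price subrr (solution0 _ _ _ (ltW T_gt0) sPhi) /callZ /call ltxx.
  rewrite /payoff expRD expRN !lnK// maxr_pMr ?ltW// mulr0; congr Num.max.
  by rewrite mulrBr mulr1 mulrCA divff ?mulr1// gt_eqF.
Unshelve. all: by end_near. Qed.

Lemma price_linear_growth : linear_growth T price.
Proof.
exists 1 => _ [t [s [i [y [[/= _ s0 _ _] ->]]]]].
have s1 : 0 < 1 + s by rewrite addr_gt0.
rewrite normrM normfV (gtr0_norm s1) ler_pdivrMr// mul1r /price normrM (gtr0_norm s0).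
by rewrite (le_trans (ler_piMr (ltW s0) (Phi_le1 _ _ _ _)))// lerDr.
Qed.

End Existence.

(** * Uniqueness *)

Section SpotBarrier.
Context {R : realType}.
Implicit Types (A d s : R).

Definition spot_barrier A d s := A / 2 * (1 + s) + d * (1 + s ^+ 2 + s^-1).

(** For [h := spot_barrier A d], the last three bounds control the drift term [s h'], half the
    diffusion term [s^2 h''], and the source. They are the origin of [2 * r], [sg ^+ 2] and, with
    the halving of [A], of [L] in the choice of [C]. *)
Lemma spot_barrier_bounds A d s : 0 <= A -> 0 < d -> 0 < s ->
  [/\ 0 <= spot_barrier A d s,
     A * s / 2 + 2 * (d * s ^+ 2) - d * s^-1 <= 2 * spot_barrier A d s,
     d * (s ^+ 2 + s^-1) <= spot_barrier A d s & A * (1 + s) <= 2 * spot_barrier A d s].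
Proof.
move=> A0 d0 s0.
have -> : spot_barrier A d s = (A + A * s) / 2 + (d + d * s ^+ 2 + d * s^-1).
  by rewrite /spot_barrier; ring.
have As : 0 <= A * s by rewrite mulr_ge0// ltW.
have ds2 : 0 <= d * s ^+ 2 by rewrite mulr_ge0 ?exprn_ge0 ?ltW.
have dsV : 0 <= d * s^-1 by rewrite mulr_ge0 ?invr_ge0 ?ltW.
rewrite [d * (_ + _)]mulrDr [A * (1 + s)]mulrDr mulr1.
by split; lra.
Qed.

End SpotBarrier.

(** * Interior maxima on a compact box *)

Section InteriorMaximum.
Context {R : realType}.
Implicit Types (t s y : R).

Lemma derive_at_max (f : R -> R) (a b x d : R) : a < x < b ->
  (forall u, a < u < b -> derivable f u 1) -> is_derive x 1 f d ->
  (forall u, a < u < b -> f u <= f x) -> d = 0.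
Proof.
move=> /andP[ax xb] df dx fx.
have ab : a <= b by rewrite ltW// (lt_trans ax).
have D : is_derive x 1 f 0.
  apply: (@derive1_at_max _ f a b x ab) => [u||u]; rewrite ?in_itv /=.
  - exact: df.
  - by rewrite ax xb.
  - exact: fx.
by have := @derive_val _ _ _ x 1 f d dx; rewrite (@derive_val _ _ _ x 1 f 0 D).
Qed.

(** If [d2] were positive, [f1] would be positive just to the right of its zero [x], and [f] would
    exceed its maximum there. This asks for differentiability of [f1] at [x] only. *)
Lemma second_derive_at_max (f f1 : R -> R) (a b x d2 : R) : a < x < b ->
  (forall u, a < u < b -> is_derive u 1 f (f1 u)) -> is_derive x 1 f1 d2 ->
  (forall u, a < u < b -> f u <= f x) -> f1 x = 0 /\ d2 <= 0.
Proof.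
move=> axb df dx fx; have /andP[ax xb] := axb.
have f1x : f1 x = 0.
  have dv u : a < u < b -> derivable f u 1 by move=> /df [].
  exact: (derive_at_max axb dv (df x axb) fx).
split=> //; rewrite leNgt; apply/negP => d20.
have [df1 d1E] := dx.
have : h^-1 *: (f1 (h *: 1 + x) - f1 x) @[h --> 0^'] --> d2 by rewrite -d1E; exact: df1.
move=> /cvgr_gt/(_ 0 d20) [e /= e0 He].
pose h0 := Num.min (e / 2) ((b - x) / 2).
have h00 : 0 < h0 by rewrite lt_min !divr_gt0// subr_gt0.
have h0e : h0 < e by rewrite gt_min; apply/orP; left; lra.
have h0b' : h0 <= (b - x) / 2 by rewrite ge_min lexx orbT.
have h0b : x + h0 < b by lra.
have f1pos u : x < u -> u <= x + h0 -> 0 < f1 u.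
  move=> xu uh; have h0' : 0 < u - x by rewrite subr_gt0.
  have := He (u - x); rewrite /= sub0r normrN gtr0_norm// => /(_ _ _).
  rewrite [(u - x) *: 1]mulr1 subrK f1x subr0 /GRing.scale /= pmulr_rgt0 ?invr_gt0//.
  by apply; [lra|rewrite gt_eqF].
have xh : x < x + h0 by rewrite ltrDl.
have [u|u|u] := @MVT _ f f1 x (x + h0) xh.
- by rewrite in_itv /= => /andP[xu ux]; apply: df; rewrite (lt_trans ax)//= (lt_trans ux).
- apply: derivable_within_continuous => v; rewrite in_itv /= => /andP[xv vx].
  by have [] // := df v; rewrite (lt_le_trans ax)//= (le_lt_trans vx).
- rewrite in_itv /= => /andP[xu ux] E.
  have := fx (x + h0); rewrite (lt_trans ax)// h0b => /(_ isT).
  rewrite -subr_le0 E addrC addKr leNgt mulr_gt0//.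
  by apply: f1pos => //; exact: ltW.
Qed.

Lemma cutoff_inv_continuous {U : topologicalType} (f : U -> R) (e : R) :
  0 < e -> continuous f -> continuous (fun u => (Num.max e (f u))^-1).
Proof.
move=> e0 cf; apply: continuousV_fun; last by cont.
by move=> u; rewrite gt_eqF// lt_max e0.
Qed.

Lemma min_half (a b : R) : 0 < a -> 0 < b ->
  exists u, [/\ 0 < u, u < a & 2 * u <= b].
Proof.
move=> a0 b0; exists (Num.min a b / 2).
have m0 : 0 < Num.min a b by rewrite lt_min a0.
have ma : Num.min a b <= a by rewrite ge_min lexx.
have mb : Num.min a b <= b by rewrite ge_min lexx orbT.
by split; lra.
Qed.

Lemma lt_div_small (B d u : R) : 0 <= B -> 0 < d -> 0 < u -> 2 * u <= d / (B + 1) -> B < d / u.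
Proof.
move=> B0 d0 u0; rewrite ler_pdivlMr; last by lra.
rewrite ltr_pdivlMr// => H; have := mulr_ge0 B0 (ltW u0).
by move: H; rewrite mulrDr mulr1 -mulrA [u * B]mulrC; lra.
Qed.

(** On each face one barrier term beats the linear growth by itself. The levels [ya] and [ga] are
    chosen after [sb], since they have to beat [B * (1 + sb)]. *)
Lemma growth_box (B d s y g : R) : 0 <= B -> 0 < d -> 0 < s -> 0 < y -> 0 < g ->
  exists sa sb ya ga, [/\ [/\ 0 < sa, 0 < ya & 0 < ga], sa < s < sb, ya < y, ga < g &
    forall s' y' g', sa <= s' <= sb -> 0 < y' -> 0 < g' ->
      s' = sa \/ s' = sb \/ y' = ya \/ g' = ga ->
      B * (1 + s') < d * s' ^+ 2 + d / s' + d / y' + d / g'].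
Proof.
move=> B0 d0 s0 y0 g0.
have B20 : 0 <= 2 * B by rewrite mulr_ge0.
have e0 b : 0 <= b -> 0 < d / (b + 1) by move=> b0; rewrite divr_gt0// ltr_wpDl.
have [sa [sa0 sas sad]] := min_half (a := Num.min s 1) ltac:(by rewrite lt_min s0 ltr01) (e0 _ B20).
move: sas; rewrite lt_min => /andP[sas sa1].
(* From [(2 * B + 1) / d <= sb] the quadratic term is at least [(2 * B + 1) * sb], which exceeds
   [B * (1 + sb)] because [sb] is at least 1. *)
pose sb := Num.max s (Num.max 1 ((2 * B + 1) / d)) + 1.
have sbs : s + 1 <= sb by rewrite lerD2r le_max lexx.
have sb1 : 1 + 1 <= sb by rewrite lerD2r !le_max lexx !orbT.
have sbd : (2 * B + 1) / d + 1 <= sb by rewrite lerD2r !le_max lexx !orbT.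
have Bb : 0 <= B * (1 + sb) by rewrite mulr_ge0//; lra.
have [ya [ya0 yay yad]] := min_half y0 (e0 _ Bb).
have [ga [ga0 gag gad]] := min_half g0 (e0 _ Bb).
exists sa, sb, ya, ga; split=> //; first by rewrite sas; lra.
move=> s' y' g' /andP[sas' sbs'] y'0 g'0 H.
have s'0 : 0 < s' by exact: lt_le_trans sa0 sas'.
have t1 : 0 <= d * s' ^+ 2 by rewrite mulr_ge0 ?exprn_ge0 ?ltW.
have t2 : 0 <= d / s' by rewrite divr_ge0 ?ltW.
have t3 : 0 <= d / y' by rewrite divr_ge0 ?ltW.
have t4 : 0 <= d / g' by rewrite divr_ge0 ?ltW.
have Bs : B * (1 + s') <= B * (1 + sb) by rewrite ler_wpM2l// lerD2l.
case: H => [sE|[sE|[yE|gE]]].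
- have : B * (1 + s') <= 2 * B by rewrite mulrC ler_wpM2r// sE; lra.
  by have := lt_div_small B20 d0 sa0 sad; rewrite -sE; lra.
- have ds : 2 * B + 1 <= d * s' by rewrite [d * _]mulrC -ler_pdivrMr// sE; lra.
  have s1 : 1 <= s' by rewrite sE; lra.
  have : (2 * B + 1) * s' <= d * s' ^+ 2 by rewrite expr2 mulrA ler_wpM2r// ltW.
  have : B * 1 <= B * s' by rewrite ler_wpM2l.
  by rewrite mulrDr mulrDl mul1r mulr1 -mulrA; lra.
- by have := lt_div_small Bb d0 ya0 yad; rewrite -yE; lra.
- by have := lt_div_small Bb d0 ga0 gad; rewrite -gE; lra.
Qed.

Variables (T sa sb ya ga : R) (U : R -> R -> R -> R).
Hypothesis sa_gt0 : 0 < sa.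
Hypothesis ya_gt0 : 0 < ya.
Hypothesis ga_gt0 : 0 < ga.

(** The box avoids every part of the boundary except [t = T], where the terminal values are known.
    Its face [t = 0] is empty, as [t] is at least [ya + ga]. *)
Definition box : set (R * R * R) :=
  (`[0, T] `*` `[sa, sb] `*` `[ya, T]) `&` [set x | ga <= x.1.1 - x.2].

Lemma boxP t s y : box (t, s, y) <-> [/\ t <= T, sa <= s <= sb, ya <= y & ga <= t - y].
Proof.
rewrite /box /= !in_itv /=; split=> [[[[/andP[_ ?] ?] /andP[? _]]]|[tT ss yy gg]] //.
by split=> //; split; [split=> //|]; apply/andP; split=> //;
  move: ya_gt0 ga_gt0; lra.
Qed.

Lemma box_compact : compact box.
Proof.
apply: compact_closedI.
  by do 2 (apply: compact_setX; last exact: segment_compact); exact: segment_compact.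
have cf : continuous (fun x : R * R * R => x.1.1 - x.2) by cont.
have cl : closed ((fun x : R * R * R => x.1.1 - x.2) @^-1` [set u | ga <= u]).
  by apply: preimage_closed; [move=> x _; exact: cf|exact: closed_ge].
exact: cl.
Qed.

Lemma box_dom_bar : box `<=` dom_bar T.
Proof.
move=> [[t s] y] /boxP[tT /andP[s1 s2] y1 g1].
move: sa_gt0 ya_gt0 ga_gt0 => sa0 ya0 ga0.
by split=> /=; [apply/andP; split|lra|apply/andP; split]; lra.
Qed.

Lemma box_interior_max (t1 s1 y1 : R) :
  {within box, continuous (fun x => U x.1.1 x.1.2 x.2)} ->
  box (t1, s1, y1) -> 0 < U t1 s1 y1 ->
  (forall t s y, box (t, s, y) -> t = T \/ s = sa \/ s = sb \/ y = ya \/ t - y = ga ->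
    U t s y <= 0) ->
  exists t s y, [/\ [/\ t < T, sa < s < sb, ya < y & ga < t - y], box (t, s, y),
    0 < U t s y & forall t' s' y', box (t', s', y') -> U t' s' y' <= U t s y].
Proof.
move=> cU K1 U1 Ub.
have [[[t s] y] /[!inE] Kx Mx] := compact_EVT_max (ex_intro _ _ K1) box_compact cU.
have M t' s' y' : box (t', s', y') -> U t' s' y' <= U t s y.
  by move=> K'; have := Mx (t', s', y'); rewrite inE; apply.
have U0 : 0 < U t s y by exact: lt_le_trans U1 (M _ _ _ K1).
exists t, s, y; split=> //.
have nb : ~ (t = T \/ s = sa \/ s = sb \/ y = ya \/ t - y = ga).
  by move=> /(Ub _ _ _ Kx); rewrite leNgt U0.
have /boxP[tT /andP[sas sbs] yay gag] := Kx.
have neq (u v : R) : (u = v -> t = T \/ s = sa \/ s = sb \/ y = ya \/ t - y = ga) -> u != v.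
  by move=> uv; apply/eqP => /uv.
by split; rewrite ?lt_neqAle ?tT ?sas ?sbs ?yay ?gag ?andbT /=;
  do ?[apply/andP; split]; apply: neq; intuition.
Qed.

Lemma box_max_derive (t s y ut uss uy : R) (us' : R -> R) :
  t < T -> sa < s < sb -> ya < y -> ga < t - y ->
  (forall t' s' y', box (t', s', y') -> U t' s' y' <= U t s y) ->
  (forall t', box (t', s, y) -> t' < T -> derivable (fun t => U t s y) t' 1) ->
  (forall y', box (t, s, y') -> derivable (U t s) y' 1) ->
  (forall s', box (t, s', y) -> is_derive s' 1 (fun s => U t s y) (us' s')) ->
  is_derive t 1 (fun t => U t s y) ut -> is_derive y 1 (U t s) uy ->
  is_derive s 1 us' uss ->
  [/\ ut = 0, us' s = 0, uy = 0 & uss <= 0].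
Proof.
move=> tT ss yy gg M dt dy ds Dt Dy Dss; have /andP[s1 s2] := ss.
move: sa_gt0 ya_gt0 ga_gt0 => sa0 ya0 ga0.
have bt u : y + ga < u < T -> box (u, s, y).
  by move=> /andP[u1 u2]; apply/boxP; split; rewrite ?ltW//; lra.
have by' u : ya < u < t - ga -> box (t, s, u).
  by move=> /andP[u1 u2]; apply/boxP; split; rewrite ?ltW//; lra.
have bs u : sa < u < sb -> box (t, u, y).
  by move=> /andP[u1 u2]; apply/boxP; split; rewrite ?ltW.
have ti : y + ga < t < T by rewrite tT andbT; lra.
have yi : ya < y < t - ga by rewrite yy /=; lra.
have [us0 uss0] := second_derive_at_max ss (fun u ui => ds u (bs u ui)) Dss
  (fun u ui => M _ _ _ (bs u ui)).
split=> //.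
  apply: (derive_at_max ti _ Dt) => u ui; last by apply: M; exact: bt.
  by apply: dt; [exact: bt|case/andP: ui].
apply: (derive_at_max yi _ Dy) => u ui; last by apply: M; exact: by'.
by apply: dy; exact: by'.
Qed.

End InteriorMaximum.

(** * Comparison with the barrier in a single regime *)

Section Uniqueness.
Context {R : realType}.
Implicit Types (t s y : R).
Variable T : R.
Hypothesis T_gt0 : 0 < T.

Lemma closure_le (f g : R * R * R -> R) : {within dom_bar T, continuous f} -> continuous g ->
  (forall x, dom T x -> f x <= g x) -> forall x, dom_bar T x -> f x <= g x.
Proof.
move=> /subspace_continuousP cf cg fg [[t s] y] dx.
have := dx; move=> [/= /andP[t0 tT] s0 /andP[y0 yt]].
(* The point at times [T / 2] and [T / 4] is interior, and by convexity the segment from a boundary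
   point towards it enters the domain at once. *)
pose p (h : R) : R * R * R := (t + h * (T / 2 - t), s, y + h * (T / 4 - y)).
have cp : continuous p by rewrite /p; cont.
have p0 : p 0 = (t, s, y) by rewrite /p !mul0r !addr0.
have pd h : 0 < h -> h < 1 -> dom T (p h).
  move=> h0 h1; have h1' : 0 < 1 - h by rewrite subr_gt0.
  have ht := mulr_ge0 (ltW h1') t0; have hy := mulr_ge0 (ltW h1') y0.
  have hT := mulr_gt0 h0 T_gt0.
  have htT : (1 - h) * t <= (1 - h) * T by rewrite ler_wpM2l// ltW.
  have hyt : (1 - h) * y <= (1 - h) * t by rewrite ler_wpM2l// ltW.
  have E1 : t + h * (T / 2 - t) = (1 - h) * t + (h * T) / 2 by ring.
  have E2 : y + h * (T / 4 - y) = (1 - h) * y + (h * T) / 4 by field.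
  have E3 : (1 - h) * T = T - h * T by ring.
  by split=> //=; rewrite ?E1 ?E2; apply/andP; split; lra.
have cgp : g (p h) @[h --> (0 : R)^'+] --> g (t, s, y).
  rewrite -p0; apply: cvg_trans (cvg_app (g \o p) (@cvg_within _ (nbhs (0 : R)) _ _)) _.
  by have := continuous_comp_fun cg cp; apply.
have cfp : f (p h) @[h --> (0 : R)^'+] --> f (t, s, y).
  have cp0 : p h @[h --> (0 : R)^'+] --> within (dom_bar T) (nbhs (t, s, y)).
    move=> B; rewrite /= -p0 => /(cp 0) H.
    have : \forall h \near (0 : R)^'+, dom_bar T (p h) -> B (p h).
      exact: (@cvg_within _ (nbhs (0 : R)) _ _ _ H).
    move=> {}H; suff: \forall h \near (0 : R)^'+, B (p h) by [].
    near=> h.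
    have h0 : 0 < h by near: h; exact: nbhs_right_gt.
    have h1 : h < 1 by near: h; exact: nbhs_right_lt.
    have := pd h h0 h1; move=> [/= /andP[/ltW a1 /ltW a2] a3 _ /andP[/ltW a4 /ltW a5]].
    have : dom_bar T (p h) -> B (p h) by near: h.
    by apply; split=> //=; rewrite ?a1 ?a2 ?a4.
  exact: cvg_trans (cvg_app f cp0) (cf _ dx).
apply: (ler_cvg_to cfp cgp); near=> h; apply: fg; apply: pd; near: h.
  exact: nbhs_right_gt.
exact: nbhs_right_lt.
Unshelve. all: by end_near. Qed.

Variables (r sg L C : R) (lm : R -> R) (w wt ws wss wy G : R -> R -> R -> R) (A B : R).
Hypothesis r_ge0 : 0 <= r.
Hypothesis lm_bounds : forall y, 0 < y < T -> 0 <= lm y <= L.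
Hypothesis C_ge : L + 2 * r + sg ^+ 2 <= C.
Hypothesis w_continuous : {within dom_bar T, continuous (fun x => w x.1.1 x.1.2 x.2)}.
Hypothesis w_derive : forall t s y, dom T (t, s, y) ->
  [/\ is_derive t 1 (fun t => w t s y) (wt t s y),
      is_derive s 1 (fun s => w t s y) (ws t s y),
      is_derive s 1 (fun s => ws t s y) (wss t s y) &
      is_derive y 1 (w t s) (wy t s y)].
Hypothesis w_pde : forall t s y, dom T (t, s, y) ->
  wt t s y + wy t s y + r * s * ws t s y + 2^-1 * sg ^+ 2 * s ^+ 2 * wss t s y
   + (G t s y - lm y * w t s y) = r * w t s y.
Hypothesis w_terminal : forall s y, 0 < s -> 0 <= y <= T -> w T s y = 0.
Hypothesis A_ge0 : 0 <= A.
Hypothesis G_le : forall t s y, dom T (t, s, y) ->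
  G t s y <= lm y * (A * (1 + s) * expR (C * (T - t))).
Hypothesis B_ge0 : 0 <= B.
Hypothesis w_le : forall t s y, dom T (t, s, y) -> w t s y <= B * (1 + s).

Local Notation h := (spot_barrier A).

Let barrier d t s y := expR (C * (T - t)) * h d s + d * (y^-1 + (t - y)^-1).

Lemma barrier_gt0 d t s y : 0 < d -> 0 < s -> 0 < y -> y < t -> 0 < barrier d t s y.
Proof.
move=> d0 s0 y0 yt; rewrite ltr_wpDl//.
  apply: mulr_ge0; first exact: expR_ge0.
  apply: addr_ge0; apply: mulr_ge0; rewrite ?divr_ge0 ?addr_ge0 ?exprn_ge0 ?invr_ge0//; exact: ltW.
by rewrite mulr_gt0// addr_gt0// invr_gt0// subr_gt0.
Qed.

Lemma h_derive d s : 0 < s -> is_derive s 1 (h d) (A / 2 + d * (2 * s - s ^- 2)).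
Proof.
move=> s0; have sn : s != 0 by rewrite gt_eqF.
have d1 : is_derive s 1 (fun s => A / 2 * s + A / 2) (A / 2) by exact: is_derive_affine.
have d2 := is_deriveX 2 (is_derive_id s 1).
have d3 := is_deriveV (f := id) sn (is_derive_id s 1).
have D := is_deriveD d1 (is_deriveZ d (is_deriveD (is_deriveD (is_derive_cst (1 : R) s 1) d2) d3)).
rewrite (_ : _ + _ = h d) in D; last first.
  by apply/funext => u; rewrite !fctE /spot_barrier /= /GRing.scale /=; ring.
by apply: (is_derive_eq D); rewrite /GRing.scale /= expr1; field.
Qed.

Lemma h_derive2 d s : 0 < s ->
  is_derive s 1 (fun s => A / 2 + d * (2 * s - s ^- 2)) (d * (2 + 2 * s ^- 3)).
Proof.
move=> s0; have sn : s ^+ 2 != 0 by rewrite expf_neq0// gt_eqF.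
have d1 : is_derive s 1 (fun s => 2 * s + 0) 2 by exact: is_derive_affine.
have d2 := is_deriveV (f := fun s => s ^+ 2) sn (is_deriveX 2 (is_derive_id s 1)).
have D := is_deriveD (is_derive_cst (A / 2) s 1) (is_deriveZ d (is_deriveB d1 d2)).
rewrite (_ : _ + _ = (fun s => A / 2 + d * (2 * s - s ^- 2))) in D; last first.
  by apply/funext => u; rewrite !fctE /= /GRing.scale /= addr0.
by apply: (is_derive_eq D); rewrite /GRing.scale /= expr1; field; rewrite gt_eqF.
Qed.

Lemma barrier_derive d t s y : 0 < s -> 0 < y -> y < t ->
  [/\ is_derive t 1 (fun t => barrier d t s y)
        (- C * expR (C * (T - t)) * h d s - d * (t - y) ^- 2),
      is_derive s 1 (fun s => barrier d t s y)
        (expR (C * (T - t)) * (A / 2 + d * (2 * s - s ^- 2))) &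
      is_derive y 1 (barrier d t s) (d * ((t - y) ^- 2 - y ^- 2))].
Proof.
move=> s0 y0 yt; have yn : y != 0 by rewrite gt_eqF.
have tyn : t - y != 0 by rewrite gt_eqF// subr_gt0.
split.
- have dE : is_derive t 1 (expR \o (fun t => - C * t + C * T)) (expR (C * (T - t)) * - C).
    have da : is_derive t 1 (fun t => - C * t + C * T) (- C) by exact: is_derive_affine.
    have de : is_derive (- C * t + C * T) 1 expR (expR (C * (T - t))).
      rewrite (_ : C * (T - t) = - C * t + C * T); last by ring.
      exact: is_derive_expR.
    exact: (is_derive1_comp (g := fun t => - C * t + C * T) de da).
  have dl : is_derive t 1 (fun t => 1 * t + - y) (1 : R) by exact: is_derive_affine.
  have tyn' : 1 * t + - y != 0 by rewrite mul1r.
  have dv := is_deriveV (f := fun t => 1 * t + - y) tyn' dl.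
  have D := is_deriveD (is_deriveZ (h d s) dE)
    (is_deriveZ d (is_deriveD (is_derive_cst y^-1 t 1) dv)).
  rewrite (_ : _ + _ = (fun t => barrier d t s y)) in D; last first.
    apply/funext => u; rewrite !fctE /barrier /= /GRing.scale /= mul1r mulrC.
    by congr (expR _ * _ + _); ring.
  by apply: (is_derive_eq D); rewrite /GRing.scale /= mul1r; field.
- have D := is_deriveD (is_deriveZ (expR (C * (T - t))) (h_derive d s0))
    (is_derive_cst (d * (y^-1 + (t - y)^-1)) s 1).
  rewrite (_ : _ + _ = (fun s => barrier d t s y)) in D; last by [].
  by apply: (is_derive_eq D); rewrite addr0.
- have d1 := is_deriveV (f := id) yn (is_derive_id y 1).
  have dl : is_derive y 1 (fun y => -1 * y + t) (-1 : R) by exact: is_derive_affine.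
  have tyn' : -1 * y + t != 0 by rewrite mulN1r addrC.
  have dv := is_deriveV (f := fun y => -1 * y + t) tyn' dl.
  have D := is_deriveD (is_derive_cst (expR (C * (T - t)) * h d s) y 1)
    (is_deriveZ d (is_deriveD d1 dv)).
  rewrite (_ : _ + _ = barrier d t s) in D; last first.
    by apply/funext => u; rewrite !fctE /barrier /= /GRing.scale /= mulN1r [- u + t]addrC.
  apply: (is_derive_eq D); rewrite /GRing.scale /= mulN1r [- y + t]addrC.
  by field; rewrite yn tyn.
Qed.

(* The barrier is a strict supersolution. *)
Lemma no_interior_max d t s y : 0 < d -> dom T (t, s, y) ->
  barrier d t s y < w t s y ->
  wt t s y = - C * expR (C * (T - t)) * h d s - d * (t - y) ^- 2 ->
  ws t s y = expR (C * (T - t)) * (A / 2 + d * (2 * s - s ^- 2)) ->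
  wy t s y = d * ((t - y) ^- 2 - y ^- 2) ->
  wss t s y <= expR (C * (T - t)) * (d * (2 + 2 * s ^- 3)) -> False.
Proof.
move=> d0 dx bw tE sE yE ssE; have [/= /andP[t0 tT] s0 yT /andP[y0 yt]] := dx.
have := w_pde dx; rewrite tE sE yE; set E := expR _ in ssE * => pde.
have E0 : 0 < E by exact: expR_gt0.
have Gl := G_le dx; rewrite -/E in Gl.
have /andP[l0 lL] := lm_bounds yT.
have sn : s != 0 by rewrite gt_eqF.
have [h0 hs hss hA] := spot_barrier_bounds A_ge0 d0 s0.
have b1 : barrier d t s y = E * h d s + d * (y^-1 + (t - y)^-1) by [].
have dyt : 0 < d * (y^-1 + (t - y)^-1).
  by rewrite mulr_gt0// addr_gt0// invr_gt0// subr_gt0.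
have wEh : (lm y + r) * (E * h d s) <= (lm y + r) * w t s y.
  by rewrite ler_wpM2l ?addr_ge0//; move: bw; rewrite b1; lra.
have ss : 2^-1 * sg ^+ 2 * s ^+ 2 * wss t s y <= sg ^+ 2 * (E * (d * (s ^+ 2 + s^-1))).
  have -> : sg ^+ 2 * (E * (d * (s ^+ 2 + s^-1))) =
      2^-1 * sg ^+ 2 * s ^+ 2 * (E * (d * (2 + 2 * s ^- 3))) by field.
  apply: ler_wpM2l => //; apply: mulr_ge0; last exact: sqr_ge0.
  by apply: mulr_ge0; [rewrite invr_ge0|exact: sqr_ge0].
have rs : r * s * (E * (A / 2 + d * (2 * s - s ^- 2))) <= 2 * r * (E * h d s).
  have -> : r * s * (E * (A / 2 + d * (2 * s - s ^- 2))) =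
      r * (E * (A * s / 2 + 2 * (d * s ^+ 2) - d * s^-1)) by field.
  have -> : 2 * r * (E * h d s) = r * (E * (2 * h d s)) by ring.
  by rewrite ler_wpM2l// ler_wpM2l ?(ltW E0).
have sgh : sg ^+ 2 * (E * (d * (s ^+ 2 + s^-1))) <= sg ^+ 2 * (E * h d s).
  by rewrite ler_wpM2l ?sqr_ge0// ler_wpM2l ?(ltW E0).
(* Halving the bound costs a factor 2 here. One of the two [lm y] is balanced by the term
   [- lm y * w] of the equation, the other by [L] in [C]. *)
have Gh : lm y * (A * (1 + s) * E) <= 2 * (lm y * (E * h d s)).
  have -> : 2 * (lm y * (E * h d s)) = lm y * (2 * h d s * E) by ring.
  by rewrite ler_wpM2l// ler_wpM2r ?(ltW E0).
have lh : lm y * (E * h d s) <= L * (E * h d s) by apply: ler_wpM2r => //; apply: mulr_ge0 => //; exact: ltW.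
have Ch : (L + 2 * r + sg ^+ 2) * (E * h d s) <= C * (E * h d s).
  by apply: ler_wpM2r => //; apply: mulr_ge0 => //; exact: ltW.
(* The contributions of [1/(t - y)] to the two first-order derivatives cancel; that of [1/y] leaves
   [- d * y ^- 2], which makes the contradiction strict. *)
have dy : 0 < d * y ^- 2 by rewrite mulr_gt0// invr_gt0 exprn_gt0.
have rE : 0 <= r * (E * h d s) by apply: mulr_ge0 => //; apply: mulr_ge0 => //; exact: ltW.
move: pde wEh Ch; rewrite !mulrDl mulrBr -!mulrA !mulNr => pde wEh Ch.
rewrite -!mulrA in ss rs.
lra.
Qed.

Lemma barrier_ge d t s y : 0 < d -> 0 < s -> 0 < y -> y < t -> t <= T ->
  d * s ^+ 2 + d / s + d / y + d / (t - y) <= barrier d t s y.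
Proof.
move=> d0 s0 y0 yt tT; have [h0 _ hs _] := spot_barrier_bounds A_ge0 d0 s0.
have E1 : 1 <= expR (C * (T - t)).
  rewrite -expR0 ler_expR mulr_ge0 ?subr_ge0//; apply: le_trans C_ge.
  have /andP[l0 lL] := lm_bounds (y := T / 2) ltac:(apply/andP; split; lra).
  by rewrite !addr_ge0 ?sqr_ge0 ?mulr_ge0// (le_trans l0).
have : h d s <= expR (C * (T - t)) * h d s by rewrite ler_peMl.
by rewrite /barrier; move: hs; rewrite !mulrDr; lra.
Qed.

Lemma box_dom sa sb ya ga t s y : 0 < sa -> 0 < ya -> 0 < ga ->
  box T sa sb ya ga (t, s, y) -> t < T -> dom T (t, s, y).
Proof.
move=> sa0 ya0 ga0 /(boxP _ _ _ ya0 ga0)[_ /andP[s1 _] y1 g1] tT.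
by split=> /=; [apply/andP; split|lra|apply/andP; split|apply/andP; split]; lra.
Qed.

Lemma barrier_within_box d sa sb ya ga : 0 < sa -> 0 < ya -> 0 < ga ->
  {within box T sa sb ya ga, continuous (fun x => w x.1.1 x.1.2 x.2 - barrier d x.1.1 x.1.2 x.2)}.
Proof.
move=> sa0 ya0 ga0.
pose bb (x : R * R * R) := expR (C * (T - x.1.1)) *
   (A / 2 * (1 + x.1.2) + d * (1 + x.1.2 * x.1.2 + (Num.max sa x.1.2)^-1)) +
   d * ((Num.max ya x.2)^-1 + (Num.max ga (x.1.1 - x.2))^-1).
have cbb : continuous bb by rewrite /bb; cont; apply: cutoff_inv_continuous => //; cont.
have bbE x : box T sa sb ya ga x -> bb x = barrier d x.1.1 x.1.2 x.2.
  move: x => [[t s] y] /(boxP _ _ _ ya0 ga0)[_ /andP[s1 _] y1 g1].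
  by rewrite /bb /= !(max_idPr _)// -expr2.
have /subspace_continuousP cw :=
  continuous_subspaceW (@box_dom_bar _ T sa sb ya ga sa0 ya0 ga0) w_continuous.
apply/subspace_continuousP => x Kx; rewrite /from_subspace -(bbE x Kx).
have cb : bb @ within (box T sa sb ya ga) (nbhs x) --> bb x.
  exact: cvg_trans (cvg_app bb (@cvg_within _ (nbhs x) _ _)) (cbb x).
have H : w u.1.1 u.1.2 u.2 - bb u @[u --> within (box T sa sb ya ga) (nbhs x)] -->
    w x.1.1 x.1.2 x.2 - bb x by apply: cvgB; [exact: cw|exact: cb].
apply: cvg_trans H; apply: near_eq_cvg.
rewrite near_withinE; near=> u => Ku.
by rewrite -bbE.
Unshelve. all: by end_near. Qed.

(** The jump sum enters only as the source [G], bounded through the estimate to be halved, so the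
    other regimes do not appear. The crude growth bound [B] serves on the faces of the box alone. *)
Lemma half_bound t s y : dom T (t, s, y) ->
  w t s y <= A / 2 * (1 + s) * expR (C * (T - t)).
Proof.
move=> d1; rewrite leNgt; apply/negP => gap.
have [/= /andP[t0 tT] s0 yT /andP[y0 yt]] := d1.
pose b := expR (C * (T - t)) * (1 + s ^+ 2 + s^-1) + (y^-1 + (t - y)^-1).
have b0 : 0 < b.
  rewrite addr_gt0// ?addr_gt0 ?invr_gt0 ?subr_gt0// mulr_gt0 ?expR_gt0//.
  by rewrite !addr_gt0 ?invr_gt0 ?exprn_gt0.
(* The point where the estimate fails dictates [d]: the correction [d * b] there uses up exactly
   half of the gap, so [w] still exceeds the barrier. *)
pose d := (w t s y - A / 2 * (1 + s) * expR (C * (T - t))) / (2 * b).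
have d0 : 0 < d by rewrite divr_gt0 ?subr_gt0// mulr_gt0.
have gap1 : 0 < w t s y - barrier d t s y.
  have -> : barrier d t s y = A / 2 * (1 + s) * expR (C * (T - t)) + d * b.
    by rewrite /barrier /spot_barrier /b; ring.
  have -> : d * b = (w t s y - A / 2 * (1 + s) * expR (C * (T - t))) / 2.
    by rewrite /d; field; rewrite gt_eqF.
  by move: gap; rewrite -subr_gt0 => gap; lra.
have ty : 0 < t - y by rewrite subr_gt0.
have [sa [sb [ya [ga [[sa0 ya0 ga0] sas yay gag grow]]]]] := growth_box B_ge0 d0 s0 y0 ty.
have K1 : box T sa sb ya ga (t, s, y).
  apply/(boxP _ _ _ ya0 ga0); have /andP[s1 s2] := sas.
  by split; rewrite ?ltW.
have [] := box_interior_max (U := fun t s y => w t s y - barrier d t s y) ya0 ga0 (barrier_within_box (d := d) sa0 ya0 ga0) K1 gap1.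
  move=> t' s' y' K' bd; have /(boxP _ _ _ ya0 ga0)[tT' /[dup] ss /andP[s1 _] y1 g1] := K'.
  have s'0 : 0 < s' by exact: lt_le_trans sa0 s1.
  have y'0 : 0 < y' by exact: lt_le_trans ya0 y1.
  have g'0 : 0 < t' - y' by exact: lt_le_trans ga0 g1.
  have bpos := barrier_gt0 d0 s'0 y'0 (_ : y' < t'); rewrite -subr_gt0 in bpos.
  rewrite subr_le0; move: tT'; rewrite le_eqVlt => /orP[/eqP tE|tT'].
    rewrite tE w_terminal// ?(ltW y'0)/=.
      by rewrite -tE ltW// bpos.
    by rewrite -tE -subr_ge0 ltW.
  have dx := box_dom sa0 ya0 ga0 K' tT'.
  have bd' : s' = sa \/ s' = sb \/ y' = ya \/ t' - y' = ga.
    by case: bd => // tE; move: tT'; rewrite tE ltxx.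
  have := barrier_ge d0 s'0 y'0 (_ : y' < t') (ltW tT'); rewrite -subr_gt0 => /(_ g'0).
  apply: le_trans; apply: le_trans (w_le dx) _.
  exact/ltW/grow.
move=> t' [s' [y' [[tT' ss yy gg] Kx U0 M]]].
have dx := box_dom sa0 ya0 ga0 Kx tT'.
have pos t2 s2 y2 : dom T (t2, s2, y2) -> [/\ 0 < s2, 0 < y2 & y2 < t2].
  by move=> [/= _ ? _ /andP[]].
have bdom t2 s2 y2 : box T sa sb ya ga (t2, s2, y2) -> t2 < T -> dom T (t2, s2, y2).
  exact: box_dom.
have dFt u : dom T (u, s', y') -> is_derive u 1 (fun t => w t s' y' - barrier d t s' y')
     (wt u s' y' - (- C * expR (C * (T - u)) * h d s' - d * (u - y') ^- 2)).
  move=> du; have [dw _ _ _] := w_derive du; have [p1 p2 p3] := pos _ _ _ du.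
  have [db _ _] := barrier_derive d p1 p2 p3; exact: (is_deriveB dw db).
have dFy u : dom T (t', s', u) -> is_derive u 1 (fun y => w t' s' y - barrier d t' s' y)
     (wy t' s' u - d * ((t' - u) ^- 2 - u ^- 2)).
  move=> du; have [_ _ _ dw] := w_derive du; have [p1 p2 p3] := pos _ _ _ du.
  have [_ _ db] := barrier_derive d p1 p2 p3; exact: (is_deriveB dw db).
pose h' u := expR (C * (T - t')) * (A / 2 + d * (2 * u - u ^- 2)).
have dFs u : dom T (t', u, y') ->
    is_derive u 1 (fun s => w t' s y' - barrier d t' s y') (ws t' u y' - h' u).
  move=> du; have [_ dw _ _] := w_derive du; have [p1 p2 p3] := pos _ _ _ du.
  have [_ db _] := barrier_derive d p1 p2 p3; exact: (is_deriveB dw db).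
have [s'0 y'0 yt'] := pos _ _ _ dx.
have dFss : is_derive s' 1 (fun s => ws t' s y' - h' s)
    (wss t' s' y' - expR (C * (T - t')) * (d * (2 + 2 * s' ^- 3))).
  have [_ _ dw _] := w_derive dx.
  have db := is_deriveZ (expR (C * (T - t'))) (h_derive2 d s'0).
  exact: (is_deriveB dw db).
have [] := box_max_derive (U := fun t s y => w t s y - barrier d t s y)
  (us' := fun u => ws t' u y' - h' u) sa0 ya0 ga0 tT' ss yy gg M _ _ _ (dFt _ dx) (dFy _ dx) dFss.
- by move=> u Ku uT; have [] := dFt u (bdom _ _ _ Ku uT).
- by move=> u Ku; have [] := dFy u (bdom _ _ _ Ku tT').
- by move=> u Ku; apply: dFs; exact: bdom.
move=> /eqP; rewrite subr_eq0 => /eqP tE /eqP; rewrite subr_eq0 => /eqP sE.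
move=> /eqP; rewrite subr_eq0 => /eqP yE; rewrite subr_le0 => ssE.
by apply: (no_interior_max d0 dx _ tE sE yE ssE); rewrite -subr_gt0.
Qed.

End Uniqueness.

(** * Iterated halving over all regimes *)

Section Comparison.
Context {R : realType} {k : nat}.
Variables (T K : R) (r sigma : 'I_k -> R) (lam : 'I_k -> 'I_k -> R -> R) (L : R).
Hypothesis T_gt0 : 0 < T.
Hypothesis r_ge0 : forall i, 0 <= r i.
Hypothesis lam_ge0 : forall i j y, j != i -> 0 <= y <= T -> 0 <= lam i j y.
Hypothesis lam_le : forall i y, 0 <= y <= T -> \sum_(j | j != i) lam i j y <= L.
Implicit Types (i j : 'I_k) (t s y : R) (phi psi : R -> R -> 'I_k -> R -> R).
Local Notation solves := (classical_solution T K r sigma lam).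

(** A single constant for all regimes, since the source of each is estimated by the common bound on
    the others. The absolute values make it nonnegative and at least each summand. *)
Let C := \sum_i `|L + 2 * r i + sigma i ^+ 2|.

Lemma solution_derive phi i t s y : C121 T phi -> dom T (t, s, y) ->
  [/\ is_derive t 1 (fun t => phi t s i y) (d_t phi t s i y),
      is_derive s 1 (fun s => phi t s i y) (d_s phi t s i y),
      is_derive s 1 (fun s => d_s phi t s i y) (d_ss phi t s i y) &
      is_derive y 1 (phi t s i) (d_y phi t s i y)].
Proof.
move=> /(_ i)[+ _ _ _ _] dx => /(_ t s y dx)[dt ds dss dy].
have D (f : R -> R) u : derivable f u 1 -> is_derive u 1 f (derive1 f u).
  by move=> df; rewrite derive1E; exact: derivableP.
by split; [exact: D dt|exact: D ds|exact: D dss|exact: D dy].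
Qed.

Lemma linear_growth_bound phi : linear_growth T phi ->
  exists2 B, 0 <= B & forall t s i y, dom T (t, s, y) -> `|phi t s i y| <= B * (1 + s).
Proof.
move=> [B BP]; exists (Num.max 0 B); first by rewrite le_max lexx.
move=> t s i y dx; have [/= _ s0 _ _] := dx.
have s1 : 0 < 1 + s by rewrite addr_gt0.
have := BP `|phi t s i y / (1 + s)|; rewrite normrM normfV (gtr0_norm s1) ler_pdivrMr//.
move=> H; apply: (@le_trans _ _ (B * (1 + s))).
  by apply: H; exists t, s, i, y; split=> //; rewrite normrM normfV (gtr0_norm s1).
by rewrite ler_wpM2r ?(ltW s1)// le_max lexx orbT.
Qed.

(** The bound is assumed up to the boundary because jumps land at age 0. The conclusion lives on
    [dom T] and is carried to the closure by continuity before the next step. *)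
Lemma one_sided_step phi psi (A : R) : solves phi -> solves psi ->
  linear_growth T phi -> linear_growth T psi -> 0 <= A ->
  (forall i x, dom_bar T x -> `|slice psi i x - slice phi i x| <=
     A * (1 + x.1.2) * expR (C * (T - x.1.1))) ->
  forall i t s y, dom T (t, s, y) ->
    psi t s i y - phi t s i y <= A / 2 * (1 + s) * expR (C * (T - t)).
Proof.
move=> [cphi Cphi Pphi _ Tphi] [cpsi Cpsi Ppsi _ Tpsi] gphi gpsi A0 bnd i.
have [B1 B10 B1P] := linear_growth_bound gphi.
have [B2 B20 B2P] := linear_growth_bound gpsi.
apply: (half_bound (sg := sigma i) (r := r i) (L := L) (B := B2 + B1)
  (lm := fun y => \sum_(j | j != i) lam i j y)
  (w := fun t s y => psi t s i y - phi t s i y)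
  (wt := fun t s y => d_t psi t s i y - d_t phi t s i y)
  (ws := fun t s y => d_s psi t s i y - d_s phi t s i y)
  (wss := fun t s y => d_ss psi t s i y - d_ss phi t s i y)
  (wy := fun t s y => d_y psi t s i y - d_y phi t s i y)
  (G := fun t s y => \sum_(j | j != i) lam i j y * (psi t s j 0 - phi t s j 0))).
- exact: r_ge0.
- move=> y /andP[y0 yT]; have yT' : 0 <= y <= T by rewrite (ltW y0) (ltW yT).
  by rewrite lam_le// andbT; apply: sumr_ge0 => j ji; exact: lam_ge0.
- rewrite /C (bigD1 i)//= (le_trans (ler_norm _))// lerDl.
  exact: sumr_ge0.
- move=> x; apply: continuousB; [exact: cpsi|exact: cphi].
- move=> t s y dx; have [p1 p2 p3 p4] := solution_derive i Cpsi dx.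
  have [q1 q2 q3 q4] := solution_derive i Cphi dx.
  by split; exact: is_deriveB.
- move=> t s y dx; have := Ppsi t s i y dx; have := Pphi t s i y dx.
  have E (f : R -> R -> 'I_k -> R -> R) :
      \sum_(j | j != i) lam i j y * (f t s j 0 - f t s i y) =
      \sum_(j | j != i) lam i j y * f t s j 0 - (\sum_(j | j != i) lam i j y) * f t s i y.
    by rewrite mulr_suml -sumrB; apply: eq_bigr => j _; rewrite mulrBr.
  have -> : \sum_(j | j != i) lam i j y * (psi t s j 0 - phi t s j 0) =
      \sum_(j | j != i) lam i j y * psi t s j 0 - \sum_(j | j != i) lam i j y * phi t s j 0.
    by rewrite -sumrB; apply: eq_bigr => j _; rewrite mulrBr.
  rewrite !E => E1 E2; rewrite [r i * (_ - _)]mulrBr -E1 -E2.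
  move: (d_t psi t s i y) (d_t phi t s i y) (d_y psi t s i y) (d_y phi t s i y)
    (d_s psi t s i y) (d_s phi t s i y) (d_ss psi t s i y) (d_ss phi t s i y) => *; ring.
- by move=> s y s0 yT; rewrite Tpsi// Tphi// subrr.
- exact: A0.
- move=> t s y dx; have [/= /andP[t0 tT] s0 /andP[y0 yT] _] := dx.
  rewrite mulr_suml; apply: ler_sum => j ji; apply: ler_wpM2l.
    by apply: lam_ge0 => //; rewrite (ltW y0) (ltW yT).
  have d0 : dom_bar T (t, s, 0) by split=> //=; rewrite ?lexx (ltW t0) ?(ltW tT).
  exact: le_trans (ler_norm _) (bnd j _ d0).
- by rewrite addr_ge0.
- move=> t s y dx; rewrite (le_trans (ler_norm _))// (le_trans (ler_normB _ _))//.
  by rewrite mulrDl lerD ?B2P ?B1P.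
Qed.

Lemma solution_unique phi psi : solves phi -> solves psi ->
  linear_growth T phi -> linear_growth T psi ->
  forall t s i y, dom_bar T (t, s, y) -> psi t s i y = phi t s i y.
Proof.
move=> sphi spsi gphi gpsi.
have [cphi _ _ _ _] := sphi; have [cpsi _ _ _ _] := spsi.
have [B1 B10 B1P] := linear_growth_bound gphi.
have [B2 B20 B2P] := linear_growth_bound gpsi.
pose g A (x : R * R * R) := A * (1 + x.1.2) * expR (C * (T - x.1.1)).
have cg A : continuous (g A) by rewrite /g; cont.
have close A : (forall i x, dom T x -> `|slice psi i x - slice phi i x| <= g A x) ->
    forall i x, dom_bar T x -> `|slice psi i x - slice phi i x| <= g A x.
  move=> H i x dx; rewrite ler_norml; apply/andP; split.
    rewrite lerNl opprB.
    apply: (closure_le T_gt0 (f := fun x => slice phi i x - slice psi i x)) dx => //.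
      by move=> u; apply: continuousB; [exact: cphi|exact: cpsi].
    by move=> u /(H i); rewrite ler_norml lerNl opprB => /andP[].
  apply: (closure_le T_gt0 (f := fun x => slice psi i x - slice phi i x)) dx => //.
    by move=> u; apply: continuousB; [exact: cpsi|exact: cphi].
  by move=> u /(H i); rewrite ler_norml => /andP[].
have B0 : 0 <= B2 + B1 by rewrite addr_ge0.
have q0 n : 0 <= (B2 + B1) * (2^-1) ^+ n by rewrite mulr_ge0// exprn_ge0// invr_ge0.
have C0 : 0 <= C by exact: sumr_ge0.
have bnd n : forall i x, dom_bar T x ->
    `|slice psi i x - slice phi i x| <= g ((B2 + B1) * (2^-1) ^+ n) x.
  elim: n => [|n IH]; apply: close => i [[t s] y] dx.
    have [/= /andP[t0 tT] s0 _ _] := dx.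
    rewrite /slice /g /= expr0 mulr1 (le_trans (ler_normB _ _))//.
    rewrite (le_trans (lerD (B2P t s i y dx) (B1P t s i y dx)))// -mulrDl.
    rewrite ler_peMr//; first by rewrite mulr_ge0// addr_ge0// ltW.
    by rewrite -expR0 ler_expR mulr_ge0// subr_ge0 ltW.
  rewrite /slice /g /= exprSr mulrA ler_norml; apply/andP; split.
    rewrite lerNl opprB; apply: (@one_sided_step psi phi) => // j x dx'.
    by rewrite distrC; exact: IH.
  exact: (@one_sided_step phi psi).
move=> t s i y dx; apply/eqP; rewrite -subr_eq0 -normr_le0.
apply/ler_addgt0Pr => e e0; rewrite add0r.
have half01 : 0 <= (2^-1 : R) < 1 by rewrite invr_ge0 ler0n invf_lt1 ?ltr1n ?ltr0n.
have [n Hn] := geometric_small (g (B2 + B1) (t, s, y)) half01 e0.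
apply: le_trans (bnd n i _ dx) _; apply: le_trans Hn.
have E (a b c d : R) : a * b * c * d <= a * c * d * b.
  by rewrite [leRHS](_ : _ = a * b * c * d)//; ring.
by rewrite /g /=; exact: E.
Qed.

End Comparison.

Unset Implicit Arguments.

Theorem theorem4p2 (R : realType) (T K : R) (k : nat)
  (r sigma : 'I_k -> R) (lam : 'I_k -> 'I_k -> R -> R)
  (T_gt0 : 0 < T) (K_gt0 : 0 < K) (k_gt0 : (0 < k)%N)
  (r_ge0 : forall i, 0 <= r i) (sigma_gt0 : forall i, 0 < sigma i)
  (lam_gt0 : forall i j : 'I_k, i != j -> forall y : R, 0 <= y -> 0 < lam i j y)
  (lam_derivable : forall i j : 'I_k, i != j -> derivable_nonneg (lam i j))
  (Lam_pinfty : forall i, Lam lam i y @[y --> +oo] --> +oo)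
  (irr : irreducible_mx (embedded_mx lam)) :
  exists phi : R -> R -> 'I_k -> R -> R,
    [/\ classical_solution T K r sigma lam phi,
        linear_growth T phi &
        forall psi : R -> R -> 'I_k -> R -> R,
          classical_solution T K r sigma lam psi -> linear_growth T psi ->
          forall t s i y, dom_bar T (t, s, y) ->
            psi t s i y = phi t s i y].
Proof.
have [m mE] := rates_exist (ltW T_gt0) lam_gt0 lam_derivable.
(* The smallest squared volatility is attained, hence positive; it is the guaranteed speed of the
   accumulated variance. *)
have [i0 _ amin_le] := @arg_minP _ _ _ (Ordinal k_gt0) xpredT (fun i => sigma i ^+ 2) isT.
have amin_gt0 : 0 < sigma i0 ^+ 2 by rewrite exprn_gt0.
have cF : data_continuous (fun (_ : 'I_k) (_ : R) => callZ (ln K)).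
  exact: continuous_data (fun _ => callZ (ln K)) (fun _ => @call_continuous R (ln K)).
have [Phi [cPhi Phi1 PhiE]] :=
  solution_exists m (fun i => (r i, sigma i ^+ 2) : R * R) (ltW T_gt0) cF (B := 1)
  (fun _ _ z => ltac:(by have /andP[? ?] := call_bounds (ln K) z.1 z.2; rewrite ger0_norm)).
have sPhi : solution m (fun i => (r i, sigma i ^+ 2) : R * R) T (fun _ _ z => callZ (ln K) z) Phi.
  by split=> //; exists 1.
have am i : sigma i0 ^+ 2 <= sigma i ^+ 2 by exact: amin_le.
have solves := price_classical T_gt0 K_gt0 r_ge0 amin_gt0 am mE sPhi Phi1.
have grows := price_linear_growth T Phi1.
exists (price T Phi); split=> // psi spsi gpsi.
apply: (solution_unique T_gt0 r_ge0 _ _ solves spsi grows gpsi) => [i j y ji /andP[y0 _]|i y yT].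
  by apply/ltW/lam_gt0; rewrite 1?eq_sym.
rewrite -(eq_bigr _ (fun j ji => mE i j y ji yT)).
exact: (@rate_le _ _ m).
Qed.
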